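(* Let $a<b$ be real numbers, let $R>0$, and let $F$ be analytic in the rectangular region $(a,b)\times(0,R)=\{x+iy\in\mathbb{C}: a<x<b,\ 0<y<R\}$. Suppose $f(x)=\lim_{y\to0^{+}}F(x+iy)$ in the space $\mathcal{D}'(a,b)$. Let $x_{0}\in(a,b)$ be such that the distributional limit $\lim_{y\to0^{+}}F(x_{0}+iy)=\gamma$ $(\mathrm{L})$ exists. If $f$ is distributionally bounded at $x=x_{0}$, then $f(x_{0})=\gamma$ $(\mathrm{L})$ and the angular (ordinary) limit exists: $\lim_{z\to x_{0}}F(z)=\gamma$.
   Context: The equality $f(x)=\lim_{y\to0^{+}}F(x+iy)$ in $\mathcal{D}'(a,b)$ means that $\langle f,\phi\rangle=\lim_{y\to0^{+}}\int_{a}^{b}F(x+iy)\phi(x)\,\mathrm{d}x$ for every $\phi\in\mathcal{D}(a,b)$ (the smooth functions with compact support in $(a,b)$). Here $\gamma\in\mathbb{C}$. The distributional limit $\lim_{y\to0^{+}}F(x_{0}+iy)=\gamma$ $(\mathrm{L})$ is the distributional lateral limit at $0$ from the right of the function $y\mapsto F(x_{0}+iy)$, $0<y<R$; that is, $\lim_{\varepsilon\to0^{+}}\int_{0}^{\infty}F(x_{0}+i\varepsilon y)\phi(y)\,\mathrm{d}y=\gamma\int_{0}^{\infty}\phi(y)\,\mathrm{d}y$ for every $\phi\in\mathcal{D}(\mathbb{R})$ with (compact) support contained in $(0,\infty)$ (the integral is defined for all sufficiently small $\varepsilon>0$). Distributional (Łojasiewicz) point value: for $f\in\mathcal{D}'(a,b)$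 and $x_0\in(a,b)$, $f(x_{0})=\gamma$ $(\mathrm{L})$ means that $\lim_{\varepsilon\to0^{+}}\langle f(x_{0}+\varepsilon x),\phi(x)\rangle=\gamma\int_{-\infty}^{\infty}\phi(x)\,\mathrm{d}x$ for every $\phi\in\mathcal{D}(\mathbb{R})$ (the pairing is defined for all sufficiently small $\varepsilon>0$). Distributional boundedness: let $\partial_{x_{0}}(g)=((x-x_{0})g(x))'$ (distributional derivative). The distribution $f\in\mathcal{D}'(a,b)$ is distributionally bounded at $x=x_{0}$ if there exist $n\in\mathbb{N}$ and $f_{n}\in\mathcal{D}'(a,b)$ such that $f=\partial_{x_{0}}^{n}f_{n}$ and, for some $\varepsilon>0$, $f_{n}$ coincides on $(x_{0}-\varepsilon,x_{0}+\varepsilon)$ with the regular distribution given by a function that is continuous and bounded on $(x_{0}-\varepsilon,x_{0})\cup(x_{0},x_{0}+\varepsilon)$. The angular limit $\lim_{z\to x_{0}}F(z)=\gamma$ means: for every $\theta\in(0,\pi/2)$, $F(z)\to\gamma$ as $z\to x_{0}$ with $z$ restricted to the sector $\theta\le\arg(z-x_{0})\le\pi-\theta$. *)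

(* Defs.v *)
From Stdlib Require Import Reals.
From Coquelicot Require Import Coquelicot.

Open Scope R_scope.

(* Stdlib's concrete reals [R] with Coquelicot's complex numbers [C].
   Coquelicot has no complete normed R-module structure on [C], so derivatives
   and integrals of functions [R -> C] are taken componentwise. *)

Definition CDerive_n (phi : R -> C) (n : nat) (x : R) : C :=
  (Derive_n (fun t => Re (phi t)) n x, Derive_n (fun t => Im (phi t)) n x).

Definition CRInt (h : R -> C) (a b : R) : C :=
  (RInt (fun t => Re (h t)) a b, RInt (fun t => Im (h t)) a b).

Definition CRInt_gen (h : R -> C) (Fa Fb : (R -> Prop) -> Prop) : C :=
  (RInt_gen (fun t => Re (h t)) Fa Fb, RInt_gen (fun t => Im (h t)) Fa Fb).

Definition smooth (phi : R -> C) : Prop :=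
  forall (n : nat) (x : R),
    ex_derive_n (fun t => Re (phi t)) n x /\ ex_derive_n (fun t => Im (phi t)) n x.

Definition supported_in (c d : R) (phi : R -> C) : Prop :=
  forall x : R, x < c \/ d < x -> phi x = 0%C.

(* phi is in D(a,b); the endpoints may be infinite. *)
Definition test_function (a b : Rbar) (phi : R -> C) : Prop :=
  smooth phi /\
  exists c d : R, Rbar_lt a c /\ Rbar_lt d b /\ supported_in c d phi.

(* T is in D'(a,b).  A distribution is represented by a total functional on
   [R -> C] of which only the values on D(a,b) are meaningful.  Continuity is
   the usual estimate: for each compact [c,d] in (a,b) there are N and K with
   |<T,phi>| <= K * max_{k <= N} sup |phi^(k)| when phi is supported in [c,d]. *)
Definition is_distribution (a b : Rbar) (T : (R -> C) -> C) : Prop :=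
  (forall phi psi, test_function a b phi -> test_function a b psi ->
     T (fun x => phi x + psi x)%C = (T phi + T psi)%C) /\
  (forall (k : C) phi, test_function a b phi ->
     T (fun x => k * phi x)%C = (k * T phi)%C) /\
  (forall c d : R, Rbar_lt a c -> Rbar_lt d b ->
     exists (N : nat) (K : R), forall phi (M : R),
       smooth phi -> supported_in c d phi ->
       (forall (k : nat) (x : R), (k <= N)%nat -> Cmod (CDerive_n phi k x) <= M) ->
       Cmod (T phi) <= K * M).

Definition dist_eq (a b : Rbar) (T U : (R -> C) -> C) : Prop :=
  forall phi, test_function a b phi -> T phi = U phi.

Definition dist_deriv (T : (R -> C) -> C) : (R -> C) -> C :=
  fun phi => (- T (CDerive_n phi 1))%C.

Definition dist_mult (m : R -> C) (T : (R -> C) -> C) : (R -> C) -> C :=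
  fun phi => T (fun x => m x * phi x)%C.

Definition partial_at (x0 : R) (T : (R -> C) -> C) : (R -> C) -> C :=
  dist_deriv (dist_mult (fun x => RtoC (x - x0)) T).

Definition dist_bounded_at (a b : R) (f : (R -> C) -> C) (x0 : R) : Prop :=
  exists (n : nat) (fn : (R -> C) -> C),
    is_distribution a b fn /\
    dist_eq a b f (Nat.iter n (partial_at x0) fn) /\
    exists (eps : R) (g : R -> C) (M : R),
      0 < eps /\ a <= x0 - eps /\ x0 + eps <= b /\
      (forall x, x0 - eps < x < x0 + eps -> x <> x0 ->
         continuous g x /\ Cmod (g x) <= M) /\
      dist_eq (x0 - eps) (x0 + eps) fn
        (fun phi => CRInt (fun x => g x * phi x)%C (x0 - eps) (x0 + eps)).

Definition analytic_on_rect (a b r : R) (F : C -> C) : Prop :=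
  forall z : C, a < Re z < b -> 0 < Im z < r ->
    @ex_derive C_AbsRing C_NormedModule F z.

Definition boundary_value (a b : R) (F : C -> C) (f : (R -> C) -> C) : Prop :=
  forall phi, test_function a b phi ->
    filterlim (fun y : R => CRInt (fun x => F (x, y) * phi x)%C a b)
      (at_right 0) (locally (f phi)).

Definition radial_dist_limit (F : C -> C) (x0 : R) (gamma : C) : Prop :=
  forall phi, test_function 0 p_infty phi ->
    filterlim
      (fun eps : R =>
         CRInt_gen (fun y => F (x0, (eps * y)%R) * phi y)%C
           (at_right 0) (Rbar_locally p_infty))
      (at_right 0)
      (locally (gamma * CRInt_gen phi (at_right 0) (Rbar_locally p_infty))%C).

(* <f(x0 + eps x), phi(x)> is (1/eps) <f(x), phi((x - x0)/eps)>; the rescaled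
   test function is in D(a,b) for all small eps. *)
Definition dist_point_value (f : (R -> C) -> C) (x0 : R) (gamma : C) : Prop :=
  forall phi, test_function m_infty p_infty phi ->
    filterlim
      (fun eps : R => (RtoC (/ eps) * f (fun x => phi ((x - x0) / eps)%R))%C)
      (at_right 0)
      (locally
         (gamma * CRInt_gen phi (Rbar_locally m_infty) (Rbar_locally p_infty))%C).

(* theta <= arg (z - x0) <= PI - theta, with z <> x0. *)
Definition in_sector (x0 theta : R) (z : C) : Prop :=
  exists rho t : R, 0 < rho /\ theta <= t <= PI - theta /\
    z = (x0 + rho * cos t, rho * sin t)%R.

Definition angular_limit (F : C -> C) (x0 : R) (gamma : C) : Prop :=
  forall theta : R, 0 < theta < PI / 2 ->
    filterlim F (within (in_sector x0 theta) (locally (RtoC x0))) (locally gamma).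

(* Main.v *)
Require Import Defs.
From Stdlib Require Import Reals Lra Lia FunctionalExtensionality IndefiniteDescription Classical.
From Coquelicot Require Import Coquelicot.

Open Scope R_scope.

(** Put [F_e w = F (x0 + e w) - gamma].  Both conclusions say that [F_e] tends to 0 as [e] does: the
    angular limit locally uniformly in the upper half-plane, the point value in the sense of
    distributions at its boundary.

    The heart is an a priori bound: near [x0], [|F z|] is at most a power of [1 / sin (arg (z - x0))]
    ([polynomial_growth]).  Cauchy's formula with the kernel of Poisson and a cutoff [chi] in the
    direction of the real axis gives [F z] as the pairing of [f] with [chi] times the Poisson kernel
    of [z], plus a term from the sides.  In the pairing, [f] is an [n]-fold Euler derivative of a
    bounded function; the transposed operator [(x - x0) d/dx] commutes with dilations about [x0],
    so on the Poisson kernel it costs only powers of [1 / sin (arg (z - x0))] ([euler_bound]).  The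
    term from the sides involves [F] near the real axis, where nothing but the convergence of
    its slices to [f] is known; the uniform boundedness principle turns this into a bound by one
    seminorm ([slices_equicontinuous]).  Subtracting the pole of the conjugate point matters: the
    Cauchy kernel itself would lose a logarithm, the Poisson kernel has bounded integral.

    By this bound the [F_e] are uniformly bounded on compact sets, hence equicontinuous, and the
    distributional radial limit becomes an ordinary one on the imaginary axis ([radial_limit]).
    A bounded family of holomorphic functions that tends to 0 on a segment tends to 0 in the
    region to its side; here this is quantitative, by Cauchy's formula with the weight
    of Carleman ([carleman], [sector_limit]), and no compactness argument is needed.  This gives
    the angular limit.

    For the point value, a test function is extended to the upper half-plane by its Taylor
    polynomial in the imaginary direction.  Green's formula moves the pairing from near the
    real axis to a fixed small height, where [F_e] tends to 0 uniformly; the area term is small because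
    the Cauchy-Riemann derivative of the extension vanishes at the real axis to the order
    at which [F_e] may blow up there ([line_shift]).

    Analyticity means that a complex derivative exists at each point.  Therefore everything rests on Green's
    formula for functions with arbitrary derivatives ([green_rectangle]), proved by
    bisection as in Goursat's theorem, and on the formula of Cauchy and Pompeiu that follows
    from it ([cauchy_pompeiu]). *)

(** * Green's formula on rectangles, without continuity of the derivatives *)

Record rect := mkrect { xl : R; xr : R; yl : R; yr : R }.

Definition quarter (J : R -> R -> R -> R -> R) (q : rect) : rect :=
  let xm := (xl q + xr q) / 2 in
  let ym := (yl q + yr q) / 2 in
  let t := Rabs (J (xl q) (xr q) (yl q) (yr q)) / 4 in
  if Rle_dec t (Rabs (J (xl q) xm (yl q) ym)) then mkrect (xl q) xm (yl q) ym
  else if Rle_dec t (Rabs (J xm (xr q) (yl q) ym)) then mkrect xm (xr q) (yl q) ym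
  else if Rle_dec t (Rabs (J (xl q) xm ym (yr q))) then mkrect (xl q) xm ym (yr q)
  else mkrect xm (xr q) ym (yr q).

Lemma nested_intervals (u v : nat -> R) :
  (forall n, u n <= u (S n)) -> (forall n, v (S n) <= v n) ->
  (forall n, u n <= v n) -> exists x, forall n, u n <= x <= v n.
Proof.
  intros Hu Hv Huv.
  assert (Hmu : forall n k, u n <= u (n + k)%nat).
  { intros n; induction k as [|k IH]; [rewrite Nat.add_0_r; lra|].
    rewrite Nat.add_succ_r. generalize (Hu (n + k)%nat); lra. }
  assert (Hmv : forall n k, v (n + k)%nat <= v n).
  { intros n; induction k as [|k IH]; [rewrite Nat.add_0_r; lra|].
    rewrite Nat.add_succ_r. generalize (Hv (n + k)%nat); lra. }
  assert (Hc : forall n m, u n <= v m).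
  { intros n m.
    generalize (Hmu n m) (Hmv m n) (Huv (n + m)%nat). rewrite (Nat.add_comm m n). lra. }
  destruct (completeness (fun x => exists n, x = u n)) as [x [Hx1 Hx2]].
  - exists (v 0%nat). intros y [n ->]. apply Hc.
  - exists (u 0%nat), 0%nat. reflexivity.
  - exists x. intros n. split.
    + apply Hx1. exists n; reflexivity.
    + apply Hx2. intros y [m ->]. apply Hc.
Qed.

(** Goursat's argument: of the four quarters of a rectangle, one carries at least a quarter of
    [J]; the quarters chosen in this way shrink to a point, where [J] is small compared with the
    square of the size.  Only additivity of [J] matters, so that Green's formula with an area
    term is covered as well as Cauchy's theorem. *)
Lemma bisection (J : R -> R -> R -> R -> R) (x1 x2 y1 y2 : R) :
  x1 <= x2 -> y1 <= y2 ->
  (forall u v w p q, x1 <= u <= v -> v <= w <= x2 -> y1 <= p <= q -> q <= y2 ->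
     J u w p q = J u v p q + J v w p q) ->
  (forall u v p q s, x1 <= u <= v -> v <= x2 -> y1 <= p <= q -> q <= s <= y2 ->
     J u v p s = J u v p q + J u v q s) ->
  (forall x y, x1 <= x <= x2 -> y1 <= y <= y2 -> forall eta, 0 < eta ->
     exists delta, 0 < delta /\ forall u v p q,
       x1 <= u <= x -> x <= v <= x2 -> y1 <= p <= y -> y <= q <= y2 ->
       v - u < delta -> q - p < delta ->
       Rabs (J u v p q) <= eta * ((v - u) + (q - p)) ^ 2) ->
  J x1 x2 y1 y2 = 0.
Proof.
  intros Hx Hy Haddx Haddy Hloc.
  set (Rn := fun n => Nat.iter n (quarter J) (mkrect x1 x2 y1 y2)).
  assert (Hstep : forall q, x1 <= xl q <= xr q -> xr q <= x2 -> y1 <= yl q <= yr q -> yr q <= y2 ->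
    let q' := quarter J q in
    (xl q <= xl q' <= xr q' /\ xr q' <= xr q /\ yl q <= yl q' <= yr q' /\ yr q' <= yr q) /\
    xr q' - xl q' = (xr q - xl q) / 2 /\ yr q' - yl q' = (yr q - yl q) / 2 /\
    Rabs (J (xl q) (xr q) (yl q) (yr q)) / 4 <= Rabs (J (xl q') (xr q') (yl q') (yr q'))).
  { intros [u w p s]; simpl. intros H1 H2 H3 H4.
    unfold quarter; simpl.
    assert (E : J u w p s = J u ((u + w) / 2) p ((p + s) / 2) + J ((u + w) / 2) w p ((p + s) / 2)
      + J u ((u + w) / 2) ((p + s) / 2) s + J ((u + w) / 2) w ((p + s) / 2) s).
    { rewrite (Haddx u ((u + w) / 2) w p s) by lra.
      rewrite (Haddy u ((u + w) / 2) p ((p + s) / 2) s) by lra.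
      rewrite (Haddy ((u + w) / 2) w p ((p + s) / 2) s) by lra. ring. }
    destruct Rle_dec as [d1|d1]; simpl; [repeat split; lra|].
    destruct Rle_dec as [d2|d2]; simpl; [repeat split; lra|].
    destruct Rle_dec as [d3|d3]; simpl; [repeat split; lra|].
    repeat split; try lra.
    revert d1 d2 d3. rewrite E.
    set (j1 := J u _ p _). set (j2 := J _ w p _). set (j3 := J u _ _ s). set (j4 := J _ w _ s).
    intros d1 d2 d3.
    generalize (Rabs_triang (j1 + j2 + j3) j4) (Rabs_triang (j1 + j2) j3) (Rabs_triang j1 j2). lra. }
  assert (Hinv : forall n, x1 <= xl (Rn n) <= xr (Rn n) /\ xr (Rn n) <= x2 /\
     y1 <= yl (Rn n) <= yr (Rn n) /\ yr (Rn n) <= y2).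
  { induction n as [|n IH]; [simpl; lra|].
    destruct IH as (H1 & H2 & H3 & H4).
    generalize (Hstep (Rn n) H1 H2 H3 H4). simpl. fold (Rn n). lra. }
  assert (Hst : forall n, let q := Rn n in let q' := Rn (S n) in
    (xl q <= xl q' <= xr q' /\ xr q' <= xr q /\ yl q <= yl q' <= yr q' /\ yr q' <= yr q) /\
    xr q' - xl q' = (xr q - xl q) / 2 /\ yr q' - yl q' = (yr q - yl q) / 2 /\
    Rabs (J (xl q) (xr q) (yl q) (yr q)) / 4 <= Rabs (J (xl q') (xr q') (yl q') (yr q'))).
  { intros n. destruct (Hinv n) as (H1 & H2 & H3 & H4).
    exact (Hstep (Rn n) H1 H2 H3 H4). }
  assert (Hw : forall n, xr (Rn n) - xl (Rn n) = (x2 - x1) * (/ 2) ^ n /\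
     yr (Rn n) - yl (Rn n) = (y2 - y1) * (/ 2) ^ n /\
     Rabs (J x1 x2 y1 y2) * (/ 4) ^ n <=
       Rabs (J (xl (Rn n)) (xr (Rn n)) (yl (Rn n)) (yr (Rn n)))).
  { induction n as [|n (I1 & I2 & I3)]; [simpl; repeat split; lra|].
    destruct (Hst n) as (_ & W1 & W2 & W3).
    rewrite W1, W2, I1, I2. simpl pow. repeat split; try lra. }
  destruct (nested_intervals (fun n => xl (Rn n)) (fun n => xr (Rn n))) as [x Hxn].
  { intros n; destruct (Hst n) as ((? & ?) & _); lra. }
  { intros n; destruct (Hst n) as ((? & ? & ?) & _); lra. }
  { intros n; destruct (Hinv n); lra. }
  destruct (nested_intervals (fun n => yl (Rn n)) (fun n => yr (Rn n))) as [y Hyn].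
  { intros n; destruct (Hst n) as ((? & ? & ? & ?) & _); lra. }
  { intros n; destruct (Hst n) as ((? & ? & ? & ?) & _); lra. }
  { intros n; destruct (Hinv n) as (? & ? & ? & ?); lra. }
  destruct (Req_dec (J x1 x2 y1 y2) 0) as [|Hne]; [assumption|exfalso].
  apply Rabs_pos_lt in Hne.
  set (c := Rabs (J x1 x2 y1 y2)) in *.
  set (L := (x2 - x1) + (y2 - y1)).
  assert (HL : 0 <= L) by (unfold L; lra).
  assert (HL1 : 0 < 2 * (L ^ 2 + 1)) by nra.
  destruct (Hloc x y) with (eta := c / (2 * (L ^ 2 + 1))) as (delta & Hd & Hdel).
  { generalize (Hxn 0%nat); simpl; lra. }
  { generalize (Hyn 0%nat); simpl; lra. }
  { apply Rdiv_lt_0_compat; assumption. }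
  destruct (pow_lt_1_zero (/ 2)) with (y := delta / (L + 1)) as [N HN].
  { rewrite Rabs_right; lra. }
  { apply Rdiv_lt_0_compat; lra. }
  specialize (HN N (le_n N)).
  assert (Hp : 0 < (/ 2) ^ N) by (apply pow_lt; lra).
  rewrite Rabs_right in HN by lra. apply Rlt_div_r in HN; [|lra].
  destruct (Hw N) as (W1 & W2 & W3).
  specialize (Hdel (xl (Rn N)) (xr (Rn N)) (yl (Rn N)) (yr (Rn N))).
  destruct (Hinv N) as (V1 & V2 & V3 & V4).
  generalize (Hxn N) (Hyn N); intros Vx Vy.
  assert (K : Rabs (J (xl (Rn N)) (xr (Rn N)) (yl (Rn N)) (yr (Rn N))) <=
     c / (2 * (L ^ 2 + 1)) * (xr (Rn N) - xl (Rn N) + (yr (Rn N) - yl (Rn N))) ^ 2).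
  { apply Hdel; try lra; [rewrite W1|rewrite W2]; unfold L in *; nra. }
  rewrite W1, W2 in K.
  replace ((x2 - x1) * (/ 2) ^ N + (y2 - y1) * (/ 2) ^ N) with (L * (/ 2) ^ N) in K
    by (unfold L; ring).
  rewrite Rpow_mult_distr, <- pow_mult, Nat.mul_comm, pow_mult in K.
  replace ((/ 2) ^ 2) with (/ 4) in K by field.
  assert (Hp4 : 0 < (/ 4) ^ N) by (apply pow_lt; lra).
  assert (K2 : c * (/ 4) ^ N <= c / (2 * (L ^ 2 + 1)) * L ^ 2 * (/ 4) ^ N) by lra.
  apply Rmult_le_reg_r in K2; [|assumption].
  assert (K3 : c / (2 * (L ^ 2 + 1)) * L ^ 2 < c).
  { apply Rmult_lt_reg_r with (2 * (L ^ 2 + 1)); [assumption|].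
    replace (c / (2 * (L ^ 2 + 1)) * L ^ 2 * (2 * (L ^ 2 + 1))) with (c * L ^ 2) by (field; lra).
    nra. }
  lra.
Qed.

Lemma RInt_Rplus (f g : R -> R) a b : ex_RInt f a b -> ex_RInt g a b ->
  RInt (fun x => f x + g x) a b = RInt f a b + RInt g a b.
Proof. exact (RInt_plus f g a b). Qed.

Lemma RInt_Rminus (f g : R -> R) a b : ex_RInt f a b -> ex_RInt g a b ->
  RInt (fun x => f x - g x) a b = RInt f a b - RInt g a b.
Proof. exact (RInt_minus f g a b). Qed.

Lemma RInt_Rscal (k : R) (f : R -> R) a b : ex_RInt f a b ->
  RInt (fun x => k * f x) a b = k * RInt f a b.
Proof. exact (RInt_scal f a b k). Qed.

Lemma RInt_cat (f : R -> R) a b c : ex_RInt f a b -> ex_RInt f b c ->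
  RInt f a c = RInt f a b + RInt f b c.
Proof. intros H1 H2. symmetry. exact (RInt_Chasles f a b c H1 H2). Qed.

Lemma ex_RInt_cont (f : R -> R) a b : a <= b -> (forall x, a <= x <= b -> continuous f x) -> ex_RInt f a b.
Proof.
  intros Hab Hf. apply (ex_RInt_continuous (V := R_CompleteNormedModule)). rewrite Rmin_left, Rmax_right; assumption.
Qed.

Lemma locally_R (P : R -> Prop) x d : 0 < d -> (forall y, Rabs (y - x) < d -> P y) -> locally x P.
Proof. intros Hd HP. exists (mkposreal d Hd). exact HP. Qed.

Lemma is_RInt_affine (k l m a b : R) :
  is_RInt (fun x => k + l * (x - m)) a b
    (k * (b - a) + l * ((b - m) ^ 2 - (a - m) ^ 2) / 2).
Proof.
  replace (k * (b - a) + l * ((b - m) ^ 2 - (a - m) ^ 2) / 2)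
    with (minus ((fun x => k * x + l * (x - m) ^ 2 / 2) b)
                ((fun x => k * x + l * (x - m) ^ 2 / 2) a)).
  2:{ unfold minus, plus, opp; simpl; field. }
  apply (is_RInt_derive (fun x => k * x + l * (x - m) ^ 2 / 2)).
  - intros x _. auto_derive; [trivial|field].
  - intros x _. apply (ex_derive_continuous (fun x => k + l * (x - m))).
    auto_derive; trivial.
Qed.

Lemma RInt_affine_approx (f : R -> R) k l m a b e : a <= b -> ex_RInt f a b ->
  (forall x, a <= x <= b -> Rabs (f x - (k + l * (x - m))) <= e) ->
  Rabs (RInt f a b - (k * (b - a) + l * ((b - m) ^ 2 - (a - m) ^ 2) / 2)) <= (b - a) * e.
Proof.
  intros Hab Hf He.
  assert (Ha : ex_RInt (fun x => k + l * (x - m)) a b) by (eexists; apply is_RInt_affine).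
  rewrite <- (is_RInt_unique _ _ _ _ (is_RInt_affine k l m a b)).
  rewrite <- RInt_Rminus by assumption.
  apply abs_RInt_le_const; [assumption| |exact He].
  apply (ex_RInt_minus (V := R_NormedModule)); assumption.
Qed.

Definition circulation (P Q : R -> R -> R) (x1 x2 y1 y2 : R) : R :=
  RInt (fun x => P x y1) x1 x2 + RInt (fun y => Q x2 y) y1 y2
  - RInt (fun x => P x y2) x1 x2 - RInt (fun y => Q x1 y) y1 y2.

Definition dint (D : R -> R -> R) (x1 x2 y1 y2 : R) : R :=
  RInt (fun y => RInt (fun x => D x y) x1 x2) y1 y2.

Lemma continuity_2d_fix_y f x y : continuity_2d_pt f x y -> continuous (fun t => f t y) x.
Proof.
  intros H. apply continuity_pt_filterlim. intros e He.
  destruct (H (mkposreal e He)) as [d Hd].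
  exists d. split; [apply cond_pos|]. intros t [_ Ht]. apply Hd.
  - exact Ht.
  - rewrite Rminus_diag, Rabs_R0. apply cond_pos.
Qed.

Lemma continuity_2d_fix_x f x y : continuity_2d_pt f x y -> continuous (fun t => f x t) y.
Proof.
  intros H. apply continuity_pt_filterlim. intros e He.
  destruct (H (mkposreal e He)) as [d Hd].
  exists d. split; [apply cond_pos|]. intros t [_ Ht]. apply Hd.
  - rewrite Rminus_diag, Rabs_R0. apply cond_pos.
  - exact Ht.
Qed.

Definition open_rect_cont (a b c d : R) (f : R -> R -> R) :=
  forall x y, a < x < b -> c < y < d -> continuity_2d_pt f x y.

Section OpenRect.
Variables a b c d : R.

Lemma ex_RInt_hor f u v y : open_rect_cont a b c d f -> a < u -> u <= v < b -> c < y < d ->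
  ex_RInt (fun x => f x y) u v.
Proof.
  intros Hf Hu Hv Hy. apply ex_RInt_cont; [lra|]. intros x Hx.
  apply (continuity_2d_fix_y f). apply Hf; lra.
Qed.

Lemma ex_RInt_ver f x p q : open_rect_cont a b c d f -> a < x < b -> c < p -> p <= q < d ->
  ex_RInt (fun y => f x y) p q.
Proof.
  intros Hf Hu Hv Hy. apply ex_RInt_cont; [lra|]. intros y Hy'.
  apply (continuity_2d_fix_x f). apply Hf; lra.
Qed.

Lemma continuous_RInt_hor D u v y : open_rect_cont a b c d D -> a < u -> u <= v < b -> c < y < d ->
  continuous (fun t => RInt (fun x => D x t) u v) y.
Proof.
  intros HD Hu Hv Hy. apply continuity_pt_filterlim. intros e He.
  assert (He' : 0 < e / (v - u + 1)) by (apply Rdiv_lt_0_compat; lra).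
  destruct (uniform_continuity_2d_1d D u v y) with (eps := mkposreal _ He') as [dl Hdl].
  { intros x Hx. apply HD; lra. }
  assert (Hm : 0 < Rmin dl (Rmin (y - c) (d - y))).
  { apply Rmin_pos; [apply cond_pos|apply Rmin_pos; lra]. }
  exists (Rmin dl (Rmin (y - c) (d - y))). split; [exact Hm|].
  intros t [_ Ht]. simpl in Ht. unfold R_dist in Ht.
  assert (H1 := Rmin_l dl (Rmin (y - c) (d - y))).
  assert (H2 := Rmin_r dl (Rmin (y - c) (d - y))).
  assert (H3 := Rmin_l (y - c) (d - y)).
  assert (H4 := Rmin_r (y - c) (d - y)).
  apply Rabs_def2 in Ht.
  simpl; unfold R_dist.
  rewrite <- RInt_Rminus; try (apply ex_RInt_hor; try assumption; lra).
  apply Rle_lt_trans with ((v - u) * (e / (v - u + 1))).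
  - apply abs_RInt_le_const; [lra| |].
    + apply (ex_RInt_minus (V := R_NormedModule)); apply ex_RInt_hor; try assumption; lra.
    + intros x Hx. apply Rlt_le. apply Hdl; try lra.
      rewrite Rminus_diag, Rabs_R0. apply cond_pos.
  - apply Rlt_le_trans with ((v - u + 1) * (e / (v - u + 1))).
    + apply Rmult_lt_compat_r; lra.
    + right; field; lra.
Qed.

Lemma ex_RInt_dint D u v p q : open_rect_cont a b c d D -> a < u -> u <= v < b ->
  c < p -> p <= q < d -> ex_RInt (fun y => RInt (fun x => D x y) u v) p q.
Proof.
  intros HD Hu Hv Hp Hq. apply ex_RInt_cont; [lra|]. intros y Hy.
  apply continuous_RInt_hor; try assumption; lra.
Qed.

Variables P Q D : R -> R -> R.
Hypothesis HP : open_rect_cont a b c d P.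
Hypothesis HQ : open_rect_cont a b c d Q.
Hypothesis HD : open_rect_cont a b c d D.

Let J u v p q := circulation P Q u v p q - dint D u v p q.

Lemma green_defect_add_x u v w p q : a < u -> u <= v -> v <= w < b -> c < p -> p <= q < d ->
  J u w p q = J u v p q + J v w p q.
Proof.
  intros. unfold J, circulation, dint.
  rewrite (RInt_cat (fun x => P x p) u v w) by (apply ex_RInt_hor; trivial; lra).
  rewrite (RInt_cat (fun x => P x q) u v w) by (apply ex_RInt_hor; trivial; lra).
  rewrite (RInt_ext (fun y => RInt (fun x => D x y) u w)
    (fun y => RInt (fun x => D x y) u v + RInt (fun x => D x y) v w)).
  2:{ intros y. rewrite Rmin_left, Rmax_right by lra. intros Hy.
      apply RInt_cat; apply ex_RInt_hor; trivial; lra. }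
  rewrite RInt_Rplus by (apply ex_RInt_dint; trivial; lra).
  ring.
Qed.

Lemma green_defect_add_y u v p q s : a < u -> u <= v < b -> c < p -> p <= q -> q <= s < d ->
  J u v p s = J u v p q + J u v q s.
Proof.
  intros. unfold J, circulation, dint.
  rewrite (RInt_cat (fun y => Q v y) p q s) by (apply ex_RInt_ver; trivial; lra).
  rewrite (RInt_cat (fun y => Q u y) p q s) by (apply ex_RInt_ver; trivial; lra).
  rewrite (RInt_cat _ p q s) by (apply ex_RInt_dint; trivial; lra).
  ring.
Qed.

(** For the affine parts of [P] and [Q] at a point the circulation is exactly [Qx - Py] times the
    area; what remains is a small multiple of the distance, integrated along the sides. *)
Lemma green_defect_local x y Px Py Qx Qy eta : a < x < b -> c < y < d ->
  differentiable_pt_lim P x y Px Py -> differentiable_pt_lim Q x y Qx Qy ->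
  D x y = Qx - Py -> 0 < eta ->
  exists delta, 0 < delta /\ forall u v p q,
    a < u <= x -> x <= v < b -> c < p <= y -> y <= q < d ->
    v - u < delta -> q - p < delta ->
    Rabs (J u v p q) <= eta * ((v - u) + (q - p)) ^ 2.
Proof.
  intros Hx Hy HPd HQd HDe Heta.
  assert (He : 0 < eta / 3) by lra.
  destruct (HPd (mkposreal _ He)) as [d1 H1].
  destruct (HQd (mkposreal _ He)) as [d2 H2].
  destruct (HD x y Hx Hy (mkposreal _ He)) as [d3 H3].
  simpl in H1, H2, H3.
  exists (Rmin d1 (Rmin d2 d3)). split.
  { apply Rmin_pos; [|apply Rmin_pos]; apply cond_pos. }
  intros u v p q Hu Hv Hp Hq Hvu Hqp.
  assert (M1 := Rmin_l d1 (Rmin d2 d3)). assert (M2 := Rmin_r d1 (Rmin d2 d3)).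
  assert (M3 := Rmin_l d2 d3). assert (M4 := Rmin_r d2 d3).
  set (S := (v - u) + (q - p)).
  assert (Habs : forall s t w, u <= s <= v -> u <= t <= v -> v - u < w -> Rabs (s - t) < w).
  { intros. apply Rabs_def1; lra. }
  assert (Habs' : forall s t w, p <= s <= q -> p <= t <= q -> q - p < w -> Rabs (s - t) < w).
  { intros. apply Rabs_def1; lra. }
  assert (HS : forall s t, u <= s <= v -> p <= t <= q -> Rmax (Rabs (s - x)) (Rabs (t - y)) <= S).
  { intros s t Hs Ht. apply Rmax_lub; apply Rabs_le; unfold S; lra. }
  assert (EP : forall t, p <= t <= q -> Rabs (RInt (fun s => P s t) u v -
     ((P x y + Py * (t - y)) * (v - u) + Px * ((v - x) ^ 2 - (u - x) ^ 2) / 2)) <= (v - u) * (eta / 3 * S)).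
  { intros t Ht. apply RInt_affine_approx; [lra|apply ex_RInt_hor; trivial; lra|].
    intros s Hs. replace (P s t - (P x y + Py * (t - y) + Px * (s - x)))
      with (P s t - P x y - (Px * (s - x) + Py * (t - y))) by ring.
    eapply Rle_trans; [apply H1|].
    - apply Habs; lra.
    - apply Habs'; lra.
    - apply Rmult_le_compat_l; [lra|]. apply HS; lra. }
  assert (EQ : forall s, u <= s <= v -> Rabs (RInt (fun t => Q s t) p q -
     ((Q x y + Qx * (s - x)) * (q - p) + Qy * ((q - y) ^ 2 - (p - y) ^ 2) / 2)) <= (q - p) * (eta / 3 * S)).
  { intros s Hs. apply RInt_affine_approx; [lra|apply ex_RInt_ver; trivial; lra|].
    intros t Ht. replace (Q s t - (Q x y + Qx * (s - x) + Qy * (t - y)))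
      with (Q s t - Q x y - (Qx * (s - x) + Qy * (t - y))) by ring.
    eapply Rle_trans; [apply H2|].
    - apply Habs; lra.
    - apply Habs'; lra.
    - apply Rmult_le_compat_l; [lra|]. apply HS; lra. }
  assert (ED : Rabs (dint D u v p q - D x y * (v - u) * (q - p)) <= (q - p) * ((v - u) * (eta / 3))).
  { replace (D x y * (v - u) * (q - p)) with
      (D x y * (v - u) * (q - p) + 0 * ((q - 0) ^ 2 - (p - 0) ^ 2) / 2) by field.
    apply RInt_affine_approx; [lra|apply ex_RInt_dint; trivial; lra|].
    intros t Ht. replace (D x y * (v - u) + 0 * (t - 0)) with
      (D x y * (v - u) + 0 * ((v - 0) ^ 2 - (u - 0) ^ 2) / 2) by field.
    apply RInt_affine_approx; [lra|apply ex_RInt_hor; trivial; lra|].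
    intros s Hs. replace (D s t - (D x y + 0 * (s - 0))) with (D s t - D x y) by ring.
    apply Rlt_le. apply H3; [apply Habs|apply Habs']; lra. }
  assert (B1 := EP p ltac:(lra)). assert (B2 := EP q ltac:(lra)).
  assert (B3 := EQ u ltac:(lra)). assert (B4 := EQ v ltac:(lra)).
  rewrite HDe in ED.
  apply Rabs_le_between in B1, B2, B3, B4, ED.
  assert (Hprod : (q - p) * (v - u) <= S ^ 2 / 2) by (unfold S; nra).
  assert (HS2 : (q - p) * S + (v - u) * S = S ^ 2) by (unfold S; ring).
  assert (HE : eta / 3 * ((q - p) * (v - u)) <= eta / 3 * (S ^ 2 / 2)).
  { apply Rmult_le_compat_l; lra. }
  unfold J, circulation.
  set (I1 := RInt (fun s => P s p) u v) in *. set (I2 := RInt (fun s => P s q) u v) in *.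
  set (I3 := RInt (fun s => Q u s) p q) in *. set (I4 := RInt (fun s => Q v s) p q) in *.
  set (I5 := dint D u v p q) in *.
  apply Rabs_le.
  assert (HS3 : eta / 3 * ((q - p) * S) + eta / 3 * ((v - u) * S) = eta / 3 * S ^ 2)
    by (rewrite <- HS2; ring).
  assert (0 <= eta / 3 * S ^ 2) by (apply Rmult_le_pos; [lra|apply pow2_ge_0]).
  split; lra.
Qed.

Theorem green_rectangle u v p q : a < u -> u <= v < b -> c < p -> p <= q < d ->
  (forall x y, u <= x <= v -> p <= y <= q -> exists Px Py Qx Qy,
     differentiable_pt_lim P x y Px Py /\ differentiable_pt_lim Q x y Qx Qy /\
     D x y = Qx - Py) ->
  circulation P Q u v p q = dint D u v p q.
Proof.
  intros Hu Hv Hp Hq Hd. apply Rminus_diag_uniq.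
  apply (bisection J); try lra.
  - intros. apply green_defect_add_x; lra.
  - intros. apply green_defect_add_y; lra.
  - intros x y Hx Hy eta Heta.
    destruct (Hd x y Hx Hy) as (Px & Py & Qx & Qy & H1 & H2 & H3).
    destruct (green_defect_local x y Px Py Qx Qy eta) as (dl & Hdl & HH); trivial; try lra.
    exists dl. split; [assumption|]. intros. apply HH; lra.
Qed.

End OpenRect.

(** * Complex-valued integrals, and functions of a complex variable *)

Definition ex_CRInt (h : R -> C) (a b : R) : Prop :=
  ex_RInt (fun t => Re (h t)) a b /\ ex_RInt (fun t => Im (h t)) a b.

Lemma CRInt_ext h k a b : a <= b -> (forall x, a < x < b -> h x = k x) ->
  CRInt h a b = CRInt k a b.
Proof.
  intros Hab H. unfold CRInt. f_equal; apply RInt_ext; rewrite Rmin_left, Rmax_right by lra;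
  intros x Hx; rewrite H; trivial.
Qed.

Lemma ex_CRInt_ext h k a b : a <= b -> (forall x, a < x < b -> h x = k x) ->
  ex_CRInt h a b -> ex_CRInt k a b.
Proof.
  intros Hab H [H1 H2]. split; [revert H1|revert H2]; apply ex_RInt_ext;
  rewrite Rmin_left, Rmax_right by lra; intros x Hx; rewrite H; trivial.
Qed.

Lemma CRInt_plus h k a b : ex_CRInt h a b -> ex_CRInt k a b ->
  CRInt (fun x => h x + k x)%C a b = (CRInt h a b + CRInt k a b)%C.
Proof.
  intros [H1 H2] [K1 K2]. unfold CRInt, Cplus; simpl.
  f_equal; apply RInt_Rplus; assumption.
Qed.

Lemma CRInt_minus h k a b : ex_CRInt h a b -> ex_CRInt k a b ->
  CRInt (fun x => h x - k x)%C a b = (CRInt h a b - CRInt k a b)%C.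
Proof.
  intros [H1 H2] [K1 K2]. unfold CRInt, Cminus, Cplus, Copp; simpl.
  f_equal; apply RInt_Rminus; assumption.
Qed.

Lemma ex_CRInt_plus h k a b : ex_CRInt h a b -> ex_CRInt k a b ->
  ex_CRInt (fun x => h x + k x)%C a b.
Proof.
  intros [H1 H2] [K1 K2]. split; simpl; apply (ex_RInt_plus (V := R_NormedModule)); assumption.
Qed.

Lemma ex_CRInt_minus h k a b : ex_CRInt h a b -> ex_CRInt k a b ->
  ex_CRInt (fun x => h x - k x)%C a b.
Proof.
  intros [H1 H2] [K1 K2]. split; simpl; apply (ex_RInt_minus (V := R_NormedModule)); assumption.
Qed.

Lemma ex_CRInt_scal k h a b : ex_CRInt h a b -> ex_CRInt (fun x => k * h x)%C a b.
Proof.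
  intros [H1 H2]. split; simpl.
  - apply (ex_RInt_minus (V := R_NormedModule));
    apply (ex_RInt_scal (V := R_NormedModule)); assumption.
  - apply (ex_RInt_plus (V := R_NormedModule));
    apply (ex_RInt_scal (V := R_NormedModule)); assumption.
Qed.

Lemma CRInt_scal k h a b : ex_CRInt h a b ->
  CRInt (fun x => k * h x)%C a b = (k * CRInt h a b)%C.
Proof.
  intros [H1 H2]. unfold CRInt, Cmult; simpl. f_equal.
  - rewrite RInt_Rminus; try (apply (ex_RInt_scal (V := R_NormedModule)); assumption).
    rewrite !RInt_Rscal by assumption. reflexivity.
  - rewrite RInt_Rplus; try (apply (ex_RInt_scal (V := R_NormedModule)); assumption).
    rewrite !RInt_Rscal by assumption. reflexivity.
Qed.

Lemma CRInt_cat h a b c : ex_CRInt h a b -> ex_CRInt h b c ->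
  CRInt h a c = (CRInt h a b + CRInt h b c)%C.
Proof.
  intros [H1 H2] [K1 K2]. unfold CRInt, Cplus; simpl.
  f_equal; apply RInt_cat; assumption.
Qed.

Lemma ex_CRInt_cat h a b c : ex_CRInt h a b -> ex_CRInt h b c -> ex_CRInt h a c.
Proof. intros [H1 H2] [K1 K2]. split; eapply ex_RInt_Chasles; eassumption. Qed.

Lemma ex_CRInt_sub h a b c d : a <= b -> b <= c -> c <= d -> ex_CRInt h a d -> ex_CRInt h b c.
Proof.
  intros Hab Hbc Hcd [H1 H2].
  split; apply (ex_RInt_Chasles_1 (V := R_CompleteNormedModule) _ b c d); try lra;
  apply (ex_RInt_Chasles_2 (V := R_CompleteNormedModule) _ a b d); trivial; lra.
Qed.

Lemma CRInt_RtoC (u : R -> R) a b : CRInt (fun x => RtoC (u x)) a b = RtoC (RInt u a b).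
Proof.
  unfold CRInt, RtoC; simpl. f_equal. rewrite RInt_const. unfold scal; simpl; unfold mult; simpl. ring.
Qed.

Lemma CRInt_zero (h : R -> C) a b : a <= b -> (forall x, a < x < b -> h x = 0%C) ->
  ex_CRInt h a b /\ CRInt h a b = 0%C.
Proof.
  intros Hab H0.
  assert (E : ex_CRInt (fun _ => 0%C) a b) by (split; apply ex_RInt_const).
  split; [apply (ex_CRInt_ext (fun _ => 0%C)); trivial; intros; symmetry; auto|].
  rewrite (CRInt_ext h (fun _ => RtoC 0)), (CRInt_RtoC (fun _ => 0)), RInt_const by auto.
  unfold scal; simpl; unfold mult; simpl. rewrite Rmult_0_r. reflexivity.
Qed.

Lemma Cmod_le_Rabs (z : C) : Cmod z <= Rabs (Re z) + Rabs (Im z).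
Proof.
  destruct z as [x y]; simpl.
  replace (x, y) with (RtoC x + Ci * RtoC y)%C by (unfold RtoC, Ci, Cmult, Cplus; simpl; f_equal; ring).
  eapply Rle_trans; [apply Cmod_triangle|].
  rewrite Cmod_mult, Cmod_Ci, !Cmod_R. lra.
Qed.

Lemma im_le_Cmod (z : C) : Rabs (Im z) <= Cmod z.
Proof. destruct z as [x y]. eapply Rle_trans; [apply Rmax_r|apply (Rmax_Cmod (x, y))]. Qed.

(** The factor 2 comes from adding the bounds of the real and imaginary parts; no constant
    matters in what follows. *)
Lemma CRInt_le h m a b : a <= b -> ex_CRInt h a b -> ex_RInt m a b ->
  (forall x, a < x < b -> Cmod (h x) <= m x) -> Cmod (CRInt h a b) <= 2 * RInt m a b.
Proof.
  intros Hab [H1 H2] Hm Hle.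
  eapply Rle_trans; [apply Cmod_le_Rabs|]. unfold CRInt; simpl.
  assert (forall f, ex_RInt f a b -> (forall x, a < x < b -> Rabs (f x) <= m x) ->
    Rabs (RInt f a b) <= RInt m a b) as Hgen.
  { intros f Hf Hfm. eapply Rle_trans; [apply abs_RInt_le; assumption|].
    apply RInt_le; try assumption. apply (ex_RInt_norm f); assumption. }
  assert (Rabs (RInt (fun t => Re (h t)) a b) <= RInt m a b).
  { apply Hgen; [assumption|]. intros x Hx.
    eapply Rle_trans; [apply re_le_Cmod|]. apply Hle; assumption. }
  assert (Rabs (RInt (fun t => Im (h t)) a b) <= RInt m a b).
  { apply Hgen; [assumption|]. intros x Hx.
    eapply Rle_trans; [apply im_le_Cmod|]. apply Hle; assumption. }
  lra.
Qed.

Lemma CRInt_bound h M a b : a <= b -> ex_CRInt h a b ->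
  (forall x, a < x < b -> Cmod (h x) <= M) -> Cmod (CRInt h a b) <= 2 * (b - a) * M.
Proof.
  intros Hab Hh HM.
  assert (E : RInt (fun _ => M) a b = (b - a) * M) by apply (RInt_const a b M).
  rewrite Rmult_assoc, <- E. apply CRInt_le; trivial. apply (ex_RInt_const a b M).
Qed.

Definition cont_C (H : C -> C) (w : C) : Prop :=
  continuity_2d_pt (fun x y => Re (H (x, y))) (Re w) (Im w) /\
  continuity_2d_pt (fun x y => Im (H (x, y))) (Re w) (Im w).

(** Real differentiability: [A] and [B] are the partial derivatives in [x] and [y], and
    [Ci * A - B] is twice [Ci] times the Cauchy-Riemann derivative. *)
Definition diff_C (H : C -> C) (w A B : C) : Prop :=
  differentiable_pt_lim (fun x y => Re (H (x, y))) (Re w) (Im w) (Re A) (Re B) /\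
  differentiable_pt_lim (fun x y => Im (H (x, y))) (Re w) (Im w) (Im A) (Im B).

Lemma cont_C_const k w : cont_C (fun _ => k) w.
Proof. split; simpl; apply continuity_2d_pt_const. Qed.

Lemma cont_C_id w : cont_C (fun z => z) w.
Proof. split; simpl; [apply continuity_2d_pt_id1|apply continuity_2d_pt_id2]. Qed.

Lemma cont_C_plus H K w : cont_C H w -> cont_C K w -> cont_C (fun z => H z + K z)%C w.
Proof. intros [H1 H2] [K1 K2]. split; simpl; apply continuity_2d_pt_plus; assumption. Qed.

Lemma cont_C_minus H K w : cont_C H w -> cont_C K w -> cont_C (fun z => H z - K z)%C w.
Proof. intros [H1 H2] [K1 K2]. split; simpl; apply continuity_2d_pt_minus; assumption. Qed.

Lemma cont_C_mult H K w : cont_C H w -> cont_C K w -> cont_C (fun z => H z * K z)%C w.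
Proof.
  intros [H1 H2] [K1 K2].
  split; simpl; [apply continuity_2d_pt_minus|apply continuity_2d_pt_plus];
  apply continuity_2d_pt_mult; assumption.
Qed.

Lemma norm2_pos (z : C) : z <> 0%C -> 0 < fst z ^ 2 + snd z ^ 2.
Proof.
  destruct z as [x y]; simpl fst; simpl snd; intros Hz.
  destruct (Req_dec x 0) as [->|Hx]; [|generalize (pow2_gt_0 x Hx) (pow2_ge_0 y); lra].
  destruct (Req_dec y 0) as [->|Hy]; [exfalso; apply Hz; reflexivity|].
  generalize (pow2_gt_0 y Hy) (pow2_ge_0 0); lra.
Qed.

Lemma cont_C_inv H w : cont_C H w -> H w <> 0%C -> cont_C (fun z => / H z)%C w.
Proof.
  intros [H1 H2] Hw.
  assert (Hn := norm2_pos _ Hw).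
  assert (HN : continuity_2d_pt (fun x y => / (fst (H (x, y)) ^ 2 + snd (H (x, y)) ^ 2)) (Re w) (Im w)).
  { apply continuity_2d_pt_inv.
    - apply continuity_2d_pt_plus; simpl; repeat apply continuity_2d_pt_mult; try assumption;
      apply continuity_2d_pt_const.
    - destruct w; simpl in *; lra. }
  split; simpl.
  - apply continuity_2d_pt_mult; assumption.
  - apply continuity_2d_pt_mult; [apply continuity_2d_pt_opp|]; assumption.
Qed.

Lemma cont_C_ext_loc H K w d : 0 < d ->
  (forall z, Rabs (Re z - Re w) < d -> Rabs (Im z - Im w) < d -> H z = K z) ->
  cont_C H w -> cont_C K w.
Proof.
  intros Hd He [H1 H2]. split; [revert H1|revert H2]; apply continuity_2d_pt_ext_loc;
  exists (mkposreal d Hd); simpl; intros u v Hu Hv; rewrite He; trivial.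
Qed.

Lemma cont_C_Re H w (f : R -> R) : continuous f (Re (H w)) -> cont_C H w ->
  cont_C (fun z => RtoC (f (Re (H z)))) w.
Proof.
  intros Hf [H1 _]. destruct w as [x y]. split; simpl.
  - apply (continuity_1d_2d_pt_comp f (fun x y => Re (H (x, y)))); [|exact H1].
    apply continuity_pt_filterlim. exact Hf.
  - apply continuity_2d_pt_const.
Qed.

Lemma cont_C_eps H w : cont_C H w -> forall e, 0 < e -> exists d, 0 < d /\
  forall z, Rabs (Re z - Re w) < d -> Rabs (Im z - Im w) < d -> Cmod (H z - H w) < e.
Proof.
  intros [H1 H2] e He.
  assert (He2 : 0 < e / 2) by lra.
  destruct (H1 (mkposreal _ He2)) as [d1 D1]. destruct (H2 (mkposreal _ He2)) as [d2 D2].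
  exists (Rmin d1 d2). split; [apply Rmin_pos; apply cond_pos|].
  intros [x y] Hx Hy. destruct w as [wx wy].
  simpl in *. eapply Rle_lt_trans; [apply Cmod_le_Rabs|]. simpl.
  assert (M1 := Rmin_l d1 d2). assert (M2 := Rmin_r d1 d2).
  specialize (D1 x y). specialize (D2 x y).
  assert (Rabs (Re (H (x, y)) - Re (H (wx, wy))) < e / 2) by (apply D1; eapply Rlt_le_trans; eassumption).
  assert (Rabs (Im (H (x, y)) - Im (H (wx, wy))) < e / 2) by (apply D2; eapply Rlt_le_trans; eassumption).
  unfold Rminus, Re, Im in *. lra.
Qed.

Lemma differentiable_pt_lim_const k x y : differentiable_pt_lim (fun _ _ => k) x y 0 0.
Proof.
  intros e. exists (mkposreal 1 Rlt_0_1). intros u v _ _.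
  replace (k - k - (0 * (u - x) + 0 * (v - y))) with 0 by ring. rewrite Rabs_R0.
  apply Rmult_le_pos; [left; apply cond_pos|].
  eapply Rle_trans; [apply Rabs_pos|apply Rmax_l].
Qed.

Lemma differentiable_pt_lim_affine (k l m : R) x y :
  differentiable_pt_lim (fun u v => k + l * u + m * v) x y l m.
Proof.
  intros e. exists (mkposreal 1 Rlt_0_1). intros u v _ _.
  match goal with |- Rabs ?z <= _ => replace z with 0 by ring end. rewrite Rabs_R0.
  apply Rmult_le_pos; [left; apply cond_pos|].
  eapply Rle_trans; [apply Rabs_pos|apply Rmax_l].
Qed.

Lemma differentiable_pt_lim_ext_eq f g x y lx ly lx' ly' : (forall u v, f u v = g u v) ->
  lx = lx' -> ly = ly' ->
  differentiable_pt_lim f x y lx ly -> differentiable_pt_lim g x y lx' ly'.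
Proof.
  intros He -> ->. apply differentiable_pt_lim_ext.
  exists (mkposreal 1 Rlt_0_1). intros; apply He.
Qed.

Lemma differentiable_pt_lim_mul x y : differentiable_pt_lim Rmult x y y x.
Proof.
  intros e. exists e. intros u v Hu Hv.
  replace (u * v - x * y - (y * (u - x) + x * (v - y))) with ((u - x) * (v - y)) by ring.
  rewrite Rabs_mult. apply Rmult_le_compat; try apply Rabs_pos; [lra|apply Rmax_r].
Qed.

Lemma differentiable_pt_lim_mult f g x y fx fy gx gy :
  differentiable_pt_lim f x y fx fy -> differentiable_pt_lim g x y gx gy ->
  differentiable_pt_lim (fun u v => f u v * g u v) x y (g x y * fx + f x y * gx) (g x y * fy + f x y * gy).
Proof.
  intros Hf Hg.
  exact (differentiable_pt_lim_comp Rmult f g x y _ _ _ _ _ _ (differentiable_pt_lim_mul _ _) Hf Hg).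
Qed.

Lemma differentiable_pt_lim_lin (l m : R) f g x y fx fy gx gy :
  differentiable_pt_lim f x y fx fy -> differentiable_pt_lim g x y gx gy ->
  differentiable_pt_lim (fun u v => l * f u v + m * g u v) x y (l * fx + m * gx) (l * fy + m * gy).
Proof.
  intros Hf Hg.
  assert (Ha := differentiable_pt_lim_affine 0 l m (f x y) (g x y)).
  generalize (differentiable_pt_lim_comp _ f g x y _ _ _ _ _ _ Ha Hf Hg).
  apply differentiable_pt_lim_ext_eq; trivial. intros; simpl; ring.
Qed.

Lemma differentiable_pt_lim_inv f x y fx fy : differentiable_pt_lim f x y fx fy -> f x y <> 0 ->
  differentiable_pt_lim (fun u v => / f u v) x y (- fx / f x y ^ 2) (- fy / f x y ^ 2).
Proof.
  intros Hf Hne.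
  assert (Hi : derivable_pt_lim Rinv (f x y) (- / f x y ^ 2)).
  { apply is_derive_Reals. auto_derive; [assumption|field; assumption]. }
  generalize (differentiable_pt_lim_comp _ f f x y _ _ _ _ _ _
    (differentiable_pt_lim_proj1_0 _ _ (f x y) _ Hi) Hf Hf).
  apply differentiable_pt_lim_ext_eq; trivial; field; assumption.
Qed.

Lemma diff_C_cont H w A B : diff_C H w A B -> cont_C H w.
Proof.
  intros [H1 H2]. split; apply differentiable_continuity_pt; [exists (Re A), (Re B)|exists (Im A), (Im B)]; assumption.
Qed.

Lemma diff_C_const k w : diff_C (fun _ => k) w 0 0.
Proof. split; simpl; apply differentiable_pt_lim_const. Qed.

Lemma diff_C_id w : diff_C (fun z => z) w 1 Ci.
Proof.
  split; simpl.
  - generalize (differentiable_pt_lim_affine 0 1 0 (Re w) (Im w)).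
    apply differentiable_pt_lim_ext_eq; trivial; intros; ring.
  - generalize (differentiable_pt_lim_affine 0 0 1 (Re w) (Im w)).
    apply differentiable_pt_lim_ext_eq; trivial; intros; ring.
Qed.

Lemma diff_C_plus H K w A B A' B' : diff_C H w A B -> diff_C K w A' B' ->
  diff_C (fun z => H z + K z)%C w (A + A') (B + B').
Proof.
  intros [H1 H2] [K1 K2]. split; simpl.
  - generalize (differentiable_pt_lim_lin 1 1 _ _ _ _ _ _ _ _ H1 K1).
    apply differentiable_pt_lim_ext_eq; intros; unfold Re; ring.
  - generalize (differentiable_pt_lim_lin 1 1 _ _ _ _ _ _ _ _ H2 K2).
    apply differentiable_pt_lim_ext_eq; intros; unfold Im; ring.
Qed.

Lemma diff_C_minus H K w A B A' B' : diff_C H w A B -> diff_C K w A' B' ->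
  diff_C (fun z => H z - K z)%C w (A - A') (B - B').
Proof.
  intros [H1 H2] [K1 K2]. split; simpl.
  - generalize (differentiable_pt_lim_lin 1 (-1) _ _ _ _ _ _ _ _ H1 K1).
    apply differentiable_pt_lim_ext_eq; intros; unfold Re; ring.
  - generalize (differentiable_pt_lim_lin 1 (-1) _ _ _ _ _ _ _ _ H2 K2).
    apply differentiable_pt_lim_ext_eq; intros; unfold Im; ring.
Qed.

Lemma diff_C_mult H K w A B A' B' : diff_C H w A B -> diff_C K w A' B' ->
  diff_C (fun z => H z * K z)%C w (K w * A + H w * A') (K w * B + H w * B').
Proof.
  intros [H1 H2] [K1 K2]. destruct w as [x y]; simpl in *. split; simpl.
  - generalize (differentiable_pt_lim_lin 1 (-1) _ _ _ _ _ _ _ _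
      (differentiable_pt_lim_mult _ _ _ _ _ _ _ _ H1 K1)
      (differentiable_pt_lim_mult _ _ _ _ _ _ _ _ H2 K2)).
    apply differentiable_pt_lim_ext_eq; intros; unfold Re, Im; ring.
  - generalize (differentiable_pt_lim_lin 1 1 _ _ _ _ _ _ _ _
      (differentiable_pt_lim_mult _ _ _ _ _ _ _ _ H1 K2)
      (differentiable_pt_lim_mult _ _ _ _ _ _ _ _ H2 K1)).
    apply differentiable_pt_lim_ext_eq; intros; unfold Re, Im; ring.
Qed.

Lemma diff_C_ext H K w A B A' B' : (forall z, H z = K z) -> A = A' -> B = B' ->
  diff_C H w A B -> diff_C K w A' B'.
Proof.
  intros He -> -> [H1 H2]. split; [revert H1|revert H2]; apply differentiable_pt_lim_ext_eq; trivial;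
  intros; rewrite He; trivial.
Qed.

Lemma diff_C_inv H w A B : diff_C H w A B -> H w <> 0%C ->
  diff_C (fun z => / H z)%C w (- A / (H w * H w)) (- B / (H w * H w)).
Proof.
  intros [H1 H2] Hw.
  assert (Hn := norm2_pos _ Hw).
  destruct w as [x y].
  assert (HN := differentiable_pt_lim_lin 1 1 _ _ _ _ _ _ _ _
      (differentiable_pt_lim_mult _ _ _ _ _ _ _ _ H1 H1)
      (differentiable_pt_lim_mult _ _ _ _ _ _ _ _ H2 H2)).
  simpl in HN.
  apply differentiable_pt_lim_inv in HN.
  2:{ simpl. unfold Re, Im. simpl in Hn. lra. }
  set (p := fst (H (x, y))) in *. set (q := snd (H (x, y))) in *.
  assert (Hne : p * p + q * q <> 0) by (simpl in Hn; lra).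
  assert (Hne2 : (p * p - q * q) * (p * p - q * q) + (p * q + q * p) * (p * q + q * p) <> 0).
  { replace ((p * p - q * q) * (p * p - q * q) + (p * q + q * p) * (p * q + q * p))
      with ((p * p + q * q) * (p * p + q * q)) by ring.
    apply Rmult_integral_contrapositive; split; assumption. }
  split; simpl.
  - generalize (differentiable_pt_lim_mult _ _ _ _ _ _ _ _ H1 HN).
    apply differentiable_pt_lim_ext_eq.
    + intros u v. unfold Re, Im, Rdiv. f_equal. f_equal. ring.
    + unfold Re, Im in *; simpl. fold p q. field. split; [|lra]. intro E; apply Hne2; rewrite <- E; ring.
    + unfold Re, Im in *; simpl. fold p q. field. split; [|lra]. intro E; apply Hne2; rewrite <- E; ring.
  - generalize (differentiable_pt_lim_lin (-1) 0 _ _ _ _ _ _ _ _ (differentiable_pt_lim_mult _ _ _ _ _ _ _ _ H2 HN) H2).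
    apply differentiable_pt_lim_ext_eq.
    + intros u v. unfold Re, Im, Rdiv. ring_simplify.
      replace (/ (fst (H (u, v)) * (fst (H (u, v)) * 1) + snd (H (u, v)) * (snd (H (u, v)) * 1)))
        with (/ (1 * (fst (H (u, v)) * fst (H (u, v))) + 1 * (snd (H (u, v)) * snd (H (u, v))))) by (f_equal; ring).
      f_equal; ring_simplify; trivial.
    + unfold Re, Im in *; simpl. fold p q. field. split; [|lra]. intro E; apply Hne2; rewrite <- E; ring.
    + unfold Re, Im in *; simpl. fold p q. field. split; [|lra]. intro E; apply Hne2; rewrite <- E; ring.
Qed.

Lemma diff_C_Re (f : R -> R) w l : is_derive f (Re w) l ->
  diff_C (fun z => RtoC (f (Re z))) w (RtoC l) 0.
Proof.
  intros Hf. split; simpl.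
  - apply differentiable_pt_lim_proj1_0. apply is_derive_Reals. exact Hf.
  - apply differentiable_pt_lim_const.
Qed.

Definition rect_cont (a b c d : R) (H : C -> C) : Prop :=
  forall x y, a < x < b -> c < y < d -> cont_C H (x, y).

Definition bd_int (H : C -> C) (x1 x2 y1 y2 : R) : C :=
  (CRInt (fun x => H (x, y1)) x1 x2 + Ci * CRInt (fun y => H (x2, y)) y1 y2
   - CRInt (fun x => H (x, y2)) x1 x2 - Ci * CRInt (fun y => H (x1, y)) y1 y2)%C.

Definition area_int (D : C -> C) (x1 x2 y1 y2 : R) : C :=
  CRInt (fun y => CRInt (fun x => D (x, y)) x1 x2) y1 y2.

Lemma ex_CRInt_hor H x1 x2 y : x1 <= x2 -> (forall x, x1 <= x <= x2 -> cont_C H (x, y)) ->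
  ex_CRInt (fun x => H (x, y)) x1 x2.
Proof.
  intros Hx HH. split; (apply ex_RInt_cont; [assumption|]); intros x Hx'; destruct (HH x Hx') as [H1 H2].
  - exact (continuity_2d_fix_y _ x y H1).
  - exact (continuity_2d_fix_y _ x y H2).
Qed.

Lemma ex_CRInt_ver H x y1 y2 : y1 <= y2 -> (forall y, y1 <= y <= y2 -> cont_C H (x, y)) ->
  ex_CRInt (fun y => H (x, y)) y1 y2.
Proof.
  intros Hy HH. split; (apply ex_RInt_cont; [assumption|]); intros y Hy'; destruct (HH y Hy') as [H1 H2].
  - exact (continuity_2d_fix_x _ x y H1).
  - exact (continuity_2d_fix_x _ x y H2).
Qed.

Lemma ex_CRInt_area a b c d D x1 x2 y1 y2 : rect_cont a b c d D ->
  a < x1 -> x1 <= x2 < b -> c < y1 -> y1 <= y2 < d ->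
  ex_CRInt (fun y => CRInt (fun x => D (x, y)) x1 x2) y1 y2.
Proof.
  intros HD H1 H2 H3 H4. split; simpl.
  - apply (ex_RInt_dint a b c d (fun x y => Re (D (x, y)))); trivial.
    intros x y Hx Hy. apply HD; assumption.
  - apply (ex_RInt_dint a b c d (fun x y => Im (D (x, y)))); trivial.
    intros x y Hx Hy. apply HD; assumption.
Qed.

Theorem green_complex a b c d H D x1 x2 y1 y2 :
  rect_cont a b c d H -> rect_cont a b c d D ->
  a < x1 -> x1 <= x2 < b -> c < y1 -> y1 <= y2 < d ->
  (forall x y, x1 <= x <= x2 -> y1 <= y <= y2 -> exists A B,
     diff_C H (x, y) A B /\ D (x, y) = (Ci * A - B)%C) ->
  bd_int H x1 x2 y1 y2 = area_int D x1 x2 y1 y2.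
Proof.
  intros HH HD Hx1 Hx2 Hy1 Hy2 Hd.
  set (U := fun x y => Re (H (x, y))). set (V := fun x y => Im (H (x, y))).
  set (D1 := fun x y => Re (D (x, y))). set (D2 := fun x y => Im (D (x, y))).
  assert (HU : open_rect_cont a b c d U) by (intros x y ? ?; apply HH; assumption).
  assert (HV : open_rect_cont a b c d V) by (intros x y ? ?; apply HH; assumption).
  assert (HV' : open_rect_cont a b c d (fun x y => - V x y))
    by (intros x y ? ?; apply continuity_2d_pt_opp; apply HV; assumption).
  assert (HD1 : open_rect_cont a b c d D1) by (intros x y ? ?; apply HD; assumption).
  assert (HD2 : open_rect_cont a b c d D2) by (intros x y ? ?; apply HD; assumption).
  assert (G1 : circulation U (fun x y => - V x y) x1 x2 y1 y2 = dint D1 x1 x2 y1 y2).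
  { apply (green_rectangle a b c d); trivial.
    intros x y Hx Hy. destruct (Hd x y Hx Hy) as (A & B & [HA HB] & E).
    exists (Re A), (Re B), (- Im A), (- Im B). repeat split; [exact HA| |].
    - generalize (differentiable_pt_lim_lin (-1) 0 _ _ _ _ _ _ _ _ HB HB).
      apply differentiable_pt_lim_ext_eq; intros; unfold V; simpl; ring.
    - unfold D1. rewrite E. simpl. unfold Re, Im. ring. }
  assert (G2 : circulation V U x1 x2 y1 y2 = dint D2 x1 x2 y1 y2).
  { apply (green_rectangle a b c d); trivial.
    intros x y Hx Hy. destruct (Hd x y Hx Hy) as (A & B & [HA HB] & E).
    exists (Im A), (Im B), (Re A), (Re B). repeat split; [exact HB|exact HA|].
    unfold D2. rewrite E. simpl. unfold Re, Im. ring. }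
  unfold circulation in G1, G2.
  assert (O : forall x, a < x < b -> RInt (fun y => - V x y) y1 y2 = - RInt (fun y => V x y) y1 y2).
  { intros x Hx. apply (RInt_opp (V := R_CompleteNormedModule) (fun y => V x y)).
    apply (ex_RInt_ver a b c d V); trivial. }
  rewrite !O in G1 by lra.
  unfold bd_int, area_int, CRInt. unfold dint in G1, G2.
  apply injective_projections; simpl.
  - unfold D1, U, V in G1. rewrite <- G1. ring.
  - unfold D2, U, V in G2. rewrite <- G2. ring.
Qed.

(** Only the four rectangles around [(u,v) x (p,q)] need Green's formula, so [H] may be singular
    inside the latter. *)
Lemma bd_int_shrink a b c d H D x1 x2 y1 y2 u v p q :
  a < x1 -> x1 < u -> u < v -> v < x2 -> x2 < b -> c < y1 -> y1 < p -> p < q -> q < y2 -> y2 < d ->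
  (forall x y, a < x < b -> c < y < d -> (x <= u \/ v <= x \/ y <= p \/ q <= y) -> cont_C H (x, y)) ->
  rect_cont a b c d D ->
  (forall x1' x2' y1' y2', (x2' = u \/ x1' = v \/ y2' = p \/ y1' = q) ->
     x1 <= x1' -> x1' <= x2' <= x2 -> y1 <= y1' -> y1' <= y2' <= y2 ->
     bd_int H x1' x2' y1' y2' = area_int D x1' x2' y1' y2') ->
  (bd_int H x1 x2 y1 y2 - area_int D x1 x2 y1 y2 =
   bd_int H u v p q - area_int D u v p q)%C.
Proof.
  intros h1 h2 h3 h4 h5 h6 h7 h8 h9 h10 HH HD HG.
  assert (E1 := HG x1 u y1 y2 ltac:(tauto) ltac:(lra) ltac:(lra) ltac:(lra) ltac:(lra)).
  assert (E2 := HG v x2 y1 y2 ltac:(tauto) ltac:(lra) ltac:(lra) ltac:(lra) ltac:(lra)).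
  assert (E3 := HG u v y1 p ltac:(tauto) ltac:(lra) ltac:(lra) ltac:(lra) ltac:(lra)).
  assert (E4 := HG u v q y2 ltac:(tauto) ltac:(lra) ltac:(lra) ltac:(lra) ltac:(lra)).
  assert (A : area_int D x1 x2 y1 y2 = (area_int D x1 u y1 y2 + area_int D v x2 y1 y2 +
     area_int D u v y1 p + area_int D u v p q + area_int D u v q y2)%C).
  { unfold area_int.
    rewrite (CRInt_ext (fun y => CRInt (fun x => D (x, y)) x1 x2)
      (fun y => CRInt (fun x => D (x, y)) x1 u + CRInt (fun x => D (x, y)) v x2 + CRInt (fun x => D (x, y)) u v)%C).
    3:{ intros y Hy. rewrite (CRInt_cat _ x1 u x2).
        2,3: apply ex_CRInt_hor; [lra|]; intros; apply HD; lra.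
        rewrite (CRInt_cat _ u v x2).
        2,3: apply ex_CRInt_hor; [lra|]; intros; apply HD; lra.
        ring. }
    2: lra.
    assert (Ex : forall s t, x1 <= s -> s <= t <= x2 -> forall s' t', y1 <= s' -> s' <= t' <= y2 ->
       ex_CRInt (fun y => CRInt (fun x => D (x, y)) s t) s' t').
    { intros. apply (ex_CRInt_area a b c d); trivial; lra. }
    rewrite (CRInt_plus (fun y => CRInt (fun x => D (x, y)) x1 u + CRInt (fun x => D (x, y)) v x2)%C
      (fun y => CRInt (fun x => D (x, y)) u v));
      [|apply (ex_CRInt_plus (fun y => CRInt (fun x => D (x, y)) x1 u)
          (fun y => CRInt (fun x => D (x, y)) v x2)); apply Ex; lra|apply Ex; lra].
    rewrite (CRInt_plus (fun y => CRInt (fun x => D (x, y)) x1 u)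
      (fun y => CRInt (fun x => D (x, y)) v x2)) by (apply Ex; lra).
    rewrite (CRInt_cat (fun y => CRInt (fun x => D (x, y)) u v) y1 p y2) by (apply Ex; lra).
    rewrite (CRInt_cat (fun y => CRInt (fun x => D (x, y)) u v) p q y2) by (apply Ex; lra).
    ring. }
  rewrite A, <- E1, <- E2, <- E3, <- E4.
  unfold bd_int.
  assert (Eh : forall y s t, c < y < d -> (y <= p \/ q <= y) -> x1 <= s -> s <= t <= x2 ->
     ex_CRInt (fun x => H (x, y)) s t).
  { intros y s t Hy Hy' Hs Ht. apply ex_CRInt_hor; [lra|]; intros; apply HH; lra. }
  assert (Ev : forall x s t, a < x < b -> (x <= u \/ v <= x) -> y1 <= s -> s <= t <= y2 ->
     ex_CRInt (fun y => H (x, y)) s t).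
  { intros y s t Hy Hy' Hs Ht. apply ex_CRInt_ver; [lra|]; intros; apply HH; lra. }
  rewrite (CRInt_cat (fun x => H (x, y1)) x1 u x2) by (apply Eh; lra).
  rewrite (CRInt_cat (fun x => H (x, y1)) u v x2) by (apply Eh; lra).
  rewrite (CRInt_cat (fun x => H (x, y2)) x1 u x2) by (apply Eh; lra).
  rewrite (CRInt_cat (fun x => H (x, y2)) u v x2) by (apply Eh; lra).
  rewrite (CRInt_cat (fun y => H (u, y)) y1 p y2) by (apply Ev; lra).
  rewrite (CRInt_cat (fun y => H (u, y)) p q y2) by (apply Ev; lra).
  rewrite (CRInt_cat (fun y => H (v, y)) y1 p y2) by (apply Ev; lra).
  rewrite (CRInt_cat (fun y => H (v, y)) p q y2) by (apply Ev; lra).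
  ring.
Qed.

Lemma RInt_square_side (m d : R) : 0 < d ->
  RInt (fun s => 2 * d / ((s - m) ^ 2 + d ^ 2)) (m - d) (m + d) = PI.
Proof.
  intros Hd. apply is_RInt_unique.
  replace PI with (minus ((fun s => 2 * atan ((s - m) / d)) (m + d)) ((fun s => 2 * atan ((s - m) / d)) (m - d))).
  2:{ unfold minus, plus, opp; simpl.
      replace ((m + d - m) / d) with 1 by (field; lra). replace ((m - d - m) / d) with (Ropp 1) by (field; lra).
      rewrite atan_opp, atan_1. field. }
  assert (Hne : forall x, (x - m) ^ 2 + d ^ 2 <> 0).
  { intros x. generalize (pow2_ge_0 (x - m)) (pow2_gt_0 d ltac:(lra)); lra. }
  apply (is_RInt_derive (fun s => 2 * atan ((s - m) / d))).
  - intros x _. auto_derive; [lra|]. specialize (Hne x). field.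
    repeat split; try (intro E; lra); intro E; apply Hne; rewrite <- E; ring.
  - intros x _. apply (ex_derive_continuous (fun s => 2 * d / ((s - m) ^ 2 + d ^ 2))).
    auto_derive. exact (Hne x).
Qed.

Lemma C_sub_neq (x y u v : R) : (x <> u \/ y <> v) -> ((x, y) - (u, v))%C <> 0%C.
Proof.
  intros Hne E. unfold Cminus, Cplus, Copp in E; simpl in E.
  injection E; intros. destruct Hne; lra.
Qed.

Lemma cont_C_inv_sub p w : w <> p -> cont_C (fun z => / (z - p))%C w.
Proof.
  intros Hne. apply cont_C_inv.
  - apply cont_C_minus; [apply cont_C_id|apply cont_C_const].
  - intros E. apply Hne. replace w with (w - p + p)%C by ring. rewrite E. ring.
Qed.

Lemma Cinv_pair (x y : R) : (/ (x, y))%C = (x / (x ^ 2 + y ^ 2), - y / (x ^ 2 + y ^ 2)).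
Proof. reflexivity. Qed.

(** The two horizontal sides contribute [i PI], and so do the two vertical ones. *)
Lemma bd_int_inv_square (px py d : R) : 0 < d ->
  bd_int (fun w => / (w - (px, py)))%C (px - d) (px + d) (py - d) (py + d) = (2 * PI * Ci)%C.
Proof.
  intros Hd. set (H := (fun w => / (w - (px, py)))%C).
  assert (Hc : forall x y, (x <> px \/ y <> py) -> cont_C H (x, y)).
  { intros x y Hxy. apply cont_C_inv_sub. intros E; injection E; intros; lra. }
  assert (E1 : (CRInt (fun x => H (x, (py - d)%R)) (px - d)%R (px + d)%R -
    CRInt (fun x => H (x, (py + d)%R)) (px - d)%R (px + d)%R)%C = (Ci * PI)%C).
  { rewrite <- CRInt_minus.
    2,3: apply ex_CRInt_hor; [lra|]; intros; apply Hc; lra.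
    assert (E : CRInt (fun x => H (x, (py - d)%R) - H (x, (py + d)%R))%C (px - d) (px + d) =
      CRInt (fun x => (0, 2 * d / ((x - px) ^ 2 + d ^ 2))) (px - d) (px + d)).
    { apply CRInt_ext; [lra|]. intros x _.
      unfold H.
      replace ((x, (py - d)%R) - (px, py))%C with ((x - px)%R, (- d)%R)
        by (unfold Cminus, Cplus, Copp; simpl; f_equal; ring).
      replace ((x, (py + d)%R) - (px, py))%C with ((x - px)%R, d)
        by (unfold Cminus, Cplus, Copp; simpl; f_equal; ring).
      rewrite (Cinv_pair (x - px) (- d)), (Cinv_pair (x - px) d).
      replace ((- d) ^ 2) with (d ^ 2) by ring.
      unfold Cminus, Cplus, Copp, Rdiv; apply injective_projections; cbn [fst snd]; ring. }
    rewrite E. unfold CRInt; cbn [Re Im fst snd].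
    rewrite (RInt_const (px - d) (px + d) 0), RInt_square_side by assumption.
    unfold Cmult, Ci, RtoC, scal; simpl; unfold mult; simpl. f_equal; ring. }
  assert (E2 : (CRInt (fun y => H ((px + d)%R, y)) (py - d)%R (py + d)%R -
    CRInt (fun y => H ((px - d)%R, y)) (py - d)%R (py + d)%R)%C = RtoC PI).
  { rewrite <- CRInt_minus.
    2,3: apply ex_CRInt_ver; [lra|]; intros; apply Hc; lra.
    assert (E : CRInt (fun y => H ((px + d)%R, y) - H ((px - d)%R, y))%C (py - d) (py + d) =
      CRInt (fun y => (2 * d / ((y - py) ^ 2 + d ^ 2), 0)) (py - d) (py + d)).
    { apply CRInt_ext; [lra|]. intros x _.
      unfold H.
      replace (((px + d)%R, x) - (px, py))%C with (d, (x - py)%R)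
        by (unfold Cminus, Cplus, Copp; simpl; f_equal; ring).
      replace (((px - d)%R, x) - (px, py))%C with ((- d)%R, (x - py)%R)
        by (unfold Cminus, Cplus, Copp; simpl; f_equal; ring).
      rewrite (Cinv_pair d), (Cinv_pair (- d)).
      replace ((- d) ^ 2) with (d ^ 2) by ring. rewrite (Rplus_comm (d ^ 2)).
      unfold Cminus, Cplus, Copp, Rdiv; apply injective_projections; cbn [fst snd]; ring. }
    rewrite E. unfold CRInt; cbn [Re Im fst snd].
    rewrite (RInt_const (py - d) (py + d) 0), RInt_square_side by assumption.
    unfold RtoC, scal; simpl; unfold mult; simpl. f_equal; ring. }
  unfold bd_int.
  match goal with |- (?A + Ci * ?B - ?A' - Ci * ?B' = _)%C =>
    replace (A + Ci * B - A' - Ci * B')%C with ((A - A') + Ci * (B - B'))%C by ring end.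
  rewrite E1, E2. ring.
Qed.

(** * The Cauchy-Pompeiu formula *)

Definition on_boundary (x1 x2 y1 y2 x y : R) : Prop :=
  x1 <= x <= x2 /\ y1 <= y <= y2 /\ (x = x1 \/ x = x2 \/ y = y1 \/ y = y2).

Definition bd_cont (H : C -> C) (x1 x2 y1 y2 : R) : Prop :=
  forall x y, on_boundary x1 x2 y1 y2 x y -> cont_C H (x, y).

Lemma bd_cont_ex H x1 x2 y1 y2 : x1 <= x2 -> y1 <= y2 -> bd_cont H x1 x2 y1 y2 ->
  ex_CRInt (fun x => H (x, y1)) x1 x2 /\ ex_CRInt (fun y => H (x2, y)) y1 y2 /\
  ex_CRInt (fun x => H (x, y2)) x1 x2 /\ ex_CRInt (fun y => H (x1, y)) y1 y2.
Proof.
  intros Hx Hy Hc.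
  split; [|split; [|split]];
  [apply ex_CRInt_hor|apply ex_CRInt_ver|apply ex_CRInt_hor|apply ex_CRInt_ver]; trivial;
  intros; apply Hc; unfold on_boundary; repeat split; try lra; tauto.
Qed.

Lemma bd_int_plus H K x1 x2 y1 y2 : x1 <= x2 -> y1 <= y2 ->
  bd_cont H x1 x2 y1 y2 -> bd_cont K x1 x2 y1 y2 ->
  bd_int (fun w => H w + K w)%C x1 x2 y1 y2 = (bd_int H x1 x2 y1 y2 + bd_int K x1 x2 y1 y2)%C.
Proof.
  intros Hx Hy HH HK. 
  destruct (bd_cont_ex _ _ _ _ _ Hx Hy HH) as (H1 & H2 & H3 & H4).
  destruct (bd_cont_ex _ _ _ _ _ Hx Hy HK) as (K1 & K2 & K3 & K4).
  unfold bd_int.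
  rewrite (CRInt_plus (fun x => H (x, y1)) (fun x => K (x, y1)) x1 x2 H1 K1),
    (CRInt_plus (fun x => H (x, y2)) (fun x => K (x, y2)) x1 x2 H3 K3),
    (CRInt_plus (fun y => H (x1, y)) (fun y => K (x1, y)) y1 y2 H4 K4),
    (CRInt_plus (fun y => H (x2, y)) (fun y => K (x2, y)) y1 y2 H2 K2).
  ring.
Qed.

Lemma bd_int_scal k H x1 x2 y1 y2 : x1 <= x2 -> y1 <= y2 -> bd_cont H x1 x2 y1 y2 ->
  bd_int (fun w => k * H w)%C x1 x2 y1 y2 = (k * bd_int H x1 x2 y1 y2)%C.
Proof.
  intros Hx Hy HH. 
  destruct (bd_cont_ex _ _ _ _ _ Hx Hy HH) as (H1 & H2 & H3 & H4).
  unfold bd_int.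
  rewrite (CRInt_scal k (fun x => H (x, y1)) x1 x2 H1),
    (CRInt_scal k (fun x => H (x, y2)) x1 x2 H3),
    (CRInt_scal k (fun y => H (x1, y)) y1 y2 H4),
    (CRInt_scal k (fun y => H (x2, y)) y1 y2 H2).
  ring.
Qed.

Lemma bd_int_ext H K x1 x2 y1 y2 : x1 <= x2 -> y1 <= y2 ->
  (forall x y, on_boundary x1 x2 y1 y2 x y -> H (x, y) = K (x, y)) ->
  bd_int H x1 x2 y1 y2 = bd_int K x1 x2 y1 y2.
Proof.
  intros Hx Hy E. unfold bd_int. unfold on_boundary in E.
  rewrite (CRInt_ext (fun x => H (x, y1)) (fun x => K (x, y1))) by (trivial; intros; apply E; repeat split; try lra; tauto).
  rewrite (CRInt_ext (fun x => H (x, y2)) (fun x => K (x, y2))) by (trivial; intros; apply E; repeat split; try lra; tauto).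
  rewrite (CRInt_ext (fun y => H (x1, y)) (fun y => K (x1, y))) by (trivial; intros; apply E; repeat split; try lra; tauto).
  rewrite (CRInt_ext (fun y => H (x2, y)) (fun y => K (x2, y))) by (trivial; intros; apply E; repeat split; try lra; tauto).
  reflexivity.
Qed.

Lemma bd_sum_bound (p q r s : C) P Q R' S : Cmod p <= P -> Cmod q <= Q -> Cmod r <= R' -> Cmod s <= S ->
  Cmod (p + Ci * q - r - Ci * s)%C <= P + Q + R' + S.
Proof.
  intros. unfold Cminus.
  eapply Rle_trans; [apply Cmod_triangle|]. apply Rplus_le_compat.
  2:{ rewrite Cmod_opp, Cmod_mult, Cmod_Ci. lra. }
  eapply Rle_trans; [apply Cmod_triangle|]. apply Rplus_le_compat.
  2:{ rewrite Cmod_opp. lra. }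
  eapply Rle_trans; [apply Cmod_triangle|]. apply Rplus_le_compat; [lra|].
  rewrite Cmod_mult, Cmod_Ci. lra.
Qed.

Lemma bd_int_bound H M x1 x2 y1 y2 : x1 <= x2 -> y1 <= y2 -> bd_cont H x1 x2 y1 y2 ->
  (forall x y, on_boundary x1 x2 y1 y2 x y -> Cmod (H (x, y)) <= M) ->
  Cmod (bd_int H x1 x2 y1 y2) <= 4 * ((x2 - x1) + (y2 - y1)) * M.
Proof.
  intros Hx Hy HH HM.
  destruct (bd_cont_ex _ _ _ _ _ Hx Hy HH) as (H1 & H2 & H3 & H4).
  unfold on_boundary in HM. unfold bd_int.
  replace (4 * (x2 - x1 + (y2 - y1)) * M) with
    (2 * (x2 - x1) * M + 2 * (y2 - y1) * M + 2 * (x2 - x1) * M + 2 * (y2 - y1) * M) by ring.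
  apply bd_sum_bound; apply CRInt_bound; trivial; intros; apply HM; repeat split; try lra; tauto.
Qed.

Lemma area_int_bound a b c d D M x1 x2 y1 y2 : rect_cont a b c d D ->
  a < x1 -> x1 <= x2 < b -> c < y1 -> y1 <= y2 < d ->
  (forall x y, x1 <= x <= x2 -> y1 <= y <= y2 -> Cmod (D (x, y)) <= M) ->
  Cmod (area_int D x1 x2 y1 y2) <= 4 * (x2 - x1) * (y2 - y1) * M.
Proof.
  intros HD H1 H2 H3 H4 HM. unfold area_int.
  replace (4 * (x2 - x1) * (y2 - y1) * M) with (2 * (y2 - y1) * (2 * (x2 - x1) * M)) by ring.
  apply CRInt_bound; [lra|apply (ex_CRInt_area a b c d); trivial; lra|].
  intros y Hy. apply CRInt_bound; [lra| |intros; apply HM; lra].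
  apply ex_CRInt_hor; [lra|]. intros; apply HD; lra.
Qed.

Lemma common_lower_bound p q r s : 0 < p -> 0 < q -> 0 < r -> 0 < s ->
  exists m, 0 < m /\ m <= p /\ m <= q /\ m <= r /\ m <= s.
Proof.
  intros. exists (Rmin (Rmin p q) (Rmin r s)). repeat split.
  - repeat apply Rmin_pos; trivial.
  - eapply Rle_trans; apply Rmin_l.
  - eapply Rle_trans; [apply Rmin_l|apply Rmin_r].
  - eapply Rle_trans; [apply Rmin_r|apply Rmin_l].
  - eapply Rle_trans; apply Rmin_r.
Qed.

Lemma C_eq_eps (z w : C) K : (forall e, 0 < e -> Cmod (z - w) <= K * e) -> z = w.
Proof.
  intros HE. apply Ceq_minus. apply Cmod_eq_0.
  assert (0 <= Cmod (z - w)) by apply Cmod_ge_0.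
  destruct (Rle_lt_dec K 0) as [HK|HK].
  - specialize (HE 1 Rlt_0_1). lra.
  - destruct (Req_dec (Cmod (z - w)) 0) as [|Hne]; [assumption|exfalso].
    assert (0 < Cmod (z - w) / (2 * K)) by (apply Rdiv_lt_0_compat; lra).
    specialize (HE _ H0). 
    replace (K * (Cmod (z - w) / (2 * K))) with (Cmod (z - w) / 2) in HE by (field; lra). lra.
Qed.

Lemma Cmod_ge_Re (x y u v d : R) : Rabs (x - u) = d -> d <= Cmod ((x, y) - (u, v)).
Proof. intros <-. exact (re_le_Cmod ((x, y) - (u, v))). Qed.

Lemma Cmod_ge_Im (x y u v d : R) : Rabs (y - v) = d -> d <= Cmod ((x, y) - (u, v)).
Proof. intros <-. exact (im_le_Cmod ((x, y) - (u, v))). Qed.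

(** [D] is the Cauchy-Riemann derivative of [h w / (w - p)].  By Green's formula the defect of this
    quotient on the rectangle is its defect on an arbitrarily small square about [p]; there [h] is
    almost [h p], while the integral of [1 / (w - p)] is [2 PI Ci] whatever the size. *)
Theorem cauchy_pompeiu a b c d h D x1 x2 y1 y2 px py :
  rect_cont a b c d h -> rect_cont a b c d D ->
  a < x1 -> x1 < px < x2 -> x2 < b -> c < y1 -> y1 < py < y2 -> y2 < d ->
  (forall x y, x1 <= x <= x2 -> y1 <= y <= y2 -> (x <> px \/ y <> py) -> exists A B,
     diff_C h (x, y) A B /\ (((x, y) - (px, py)) * D (x, y) = Ci * A - B)%C) ->
  (bd_int (fun w => h w / (w - (px, py)))%C x1 x2 y1 y2 - area_int D x1 x2 y1 y2
   = 2 * PI * Ci * h (px, py))%C.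
Proof.
  intros Hh HD h1 h2 h3 h4 h5 h6 Hd.
  set (p := (px, py) : C). set (H := (fun w => h w / (w - p))%C).
  assert (Hne : forall x y, (x <> px \/ y <> py) -> ((x, y) - p)%C <> 0%C)
    by (intros; apply C_sub_neq; assumption).
  assert (HH : forall x y, a < x < b -> c < y < d -> (x <> px \/ y <> py) -> cont_C H (x, y)).
  { intros x y Hx Hy Hxy. apply cont_C_mult; [apply Hh; assumption|].
    apply cont_C_inv_sub. intros E; injection E; intros; lra. }
  assert (HHd : forall x y, x1 <= x <= x2 -> y1 <= y <= y2 -> (x <> px \/ y <> py) ->
    exists A B, diff_C H (x, y) A B /\ D (x, y) = (Ci * A - B)%C).
  { intros x y Hx Hy Hxy. destruct (Hd x y Hx Hy Hxy) as (A & B & HA & HE).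
    generalize (Hne x y Hxy). intros N.
    eexists; eexists. split.
    - apply diff_C_mult; [exact HA|]. apply diff_C_inv; [|exact N].
      apply diff_C_minus; [apply diff_C_id|apply diff_C_const].
    - cbv beta. set (z := ((x, y) - p)%C) in *.
      assert (E : D (x, y) = ((Ci * A - B) / z)%C) by (rewrite <- HE; fold p z; field; exact N).
      rewrite E. field. exact N. }
  apply C_eq_eps with 32. intros e He.
  destruct (cont_C_eps h (px, py) (Hh px py ltac:(lra) ltac:(lra)) e He) as (d1 & Hd1 & Hc1).
  destruct (cont_C_eps D (px, py) (HD px py ltac:(lra) ltac:(lra)) 1 Rlt_0_1) as (d2 & Hd2 & Hc2).
  set (M := Cmod (D (px, py)) + 1).
  assert (HM : 0 < M) by (unfold M; generalize (Cmod_ge_0 (D (px, py))); lra).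
  destruct (common_lower_bound (Rmin d1 d2) (Rmin (px - x1) (x2 - px)) (Rmin (py - y1) (y2 - py)) (Rmin 1 (e / M)))
    as (m & Hm & m1 & m2 & m3 & m4); try (apply Rmin_pos; lra).
  { apply Rmin_pos; [lra|]. apply Rdiv_lt_0_compat; lra. }
  assert (n1 := Rmin_l d1 d2). assert (n2 := Rmin_r d1 d2).
  assert (n3 := Rmin_l (px - x1) (x2 - px)). assert (n4 := Rmin_r (px - x1) (x2 - px)).
  assert (n5 := Rmin_l (py - y1) (y2 - py)). assert (n6 := Rmin_r (py - y1) (y2 - py)).
  assert (n7 := Rmin_l 1 (e / M)). assert (n8 := Rmin_r 1 (e / M)).
  set (t := m / 2). assert (Ht : 0 < t < m) by (unfold t; lra).
  assert (HtM : t * M <= e).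
  { replace e with (e / M * M) by (field; lra). apply Rmult_le_compat_r; lra. }
  rewrite (bd_int_shrink a b c d H D x1 x2 y1 y2 (px - t) (px + t) (py - t) (py + t)); try lra; trivial.
  2:{ intros; apply HH; lra. }
  2:{ intros u v r s Hc Hu Hv Hr Hs.
      assert (G : exists a' b' c' d', a' < u /\ v < b' /\ c' < r /\ s < d' /\ a <= a' /\ b' <= b /\ c <= c' /\ d' <= d /\
         (b' <= px \/ px <= a' \/ d' <= py \/ py <= c')).
      { destruct Hc as [Hc|[Hc|[Hc|Hc]]].
        - exists a, px, c, d; repeat split; lra.
        - exists px, b, c, d; repeat split; lra.
        - exists a, b, c, py; repeat split; lra.
        - exists a, b, py, d; repeat split; lra. }
      destruct G as (a' & b' & c' & d' & g1 & g2 & g3 & g4 & g5 & g6 & g7 & g8 & g9).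
      apply (green_complex a' b' c' d'); try lra.
      - intros x y Hx Hy. apply HH; lra.
      - intros x y Hx Hy. apply HD; lra.
      - intros x y Hx Hy. apply HHd; lra. }
  set (u := px - t). set (v := px + t). set (r := py - t). set (s := py + t).
  assert (Hbd : forall x y, on_boundary u v r s x y -> (x <> px \/ y <> py) /\
     a < x < b /\ c < y < d /\ Rabs (x - px) <= t /\ Rabs (y - py) <= t /\ t <= Cmod ((x, y) - p)).
  { unfold on_boundary, u, v, r, s. intros x y (Hx & Hy & Hxy).
    split; [lra|]. split; [lra|]. split; [lra|]. split; [apply Rabs_le; lra|]. split; [apply Rabs_le; lra|].
    destruct Hxy as [E|[E|[E|E]]]; subst.
    - apply Cmod_ge_Re. rewrite Rabs_left; lra.
    - apply Cmod_ge_Re. rewrite Rabs_right; lra.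
    - apply Cmod_ge_Im. rewrite Rabs_left; lra.
    - apply Cmod_ge_Im. rewrite Rabs_right; lra. }
  assert (Hinv : bd_cont (fun w => / (w - p))%C u v r s).
  { intros x y Hxy. apply cont_C_inv_sub. destruct (Hbd x y Hxy) as (N & _).
    intros E; injection E; intros; lra. }
  assert (HR : bd_cont (fun w => (h w - h p) * / (w - p))%C u v r s).
  { intros x y Hxy. apply cont_C_mult; [|apply Hinv; assumption].
    destruct (Hbd x y Hxy) as (N & Hx & Hy & _).
    apply cont_C_minus; [apply Hh; assumption|apply cont_C_const]. }
  rewrite (bd_int_ext H (fun w => h p * / (w - p) + (h w - h p) * / (w - p))%C).
  2,3: unfold u, v, r, s; lra.
  2:{ intros x y Hxy. unfold H. destruct (Hbd x y Hxy) as (N & _). field. apply Hne; assumption. }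
  rewrite (bd_int_plus (fun w => h p * / (w - p))%C (fun w => (h w - h p) * / (w - p))%C).
  2,3: unfold u, v, r, s; lra.
  2:{ intros x y Hxy. apply cont_C_mult; [apply cont_C_const|apply Hinv; assumption]. }
  2: exact HR.
  rewrite (bd_int_scal (h p) (fun w => / (w - p))%C) by (try exact Hinv; unfold u, v, r, s; lra).
  assert (Esq := bd_int_inv_square px py t (proj1 Ht)).
  fold p u v r s in Esq. rewrite Esq.
  match goal with |- Cmod (?A + ?B - ?E - ?F) <= _ => replace (A + B - E - F)%C with (B + - E)%C by (unfold p; ring) end.
  eapply Rle_trans; [apply Cmod_triangle|]. rewrite Cmod_opp.
  assert (B1 : Cmod (bd_int (fun w => (h w - h p) * / (w - p))%C u v r s) <= 4 * ((v - u) + (s - r)) * (e * / t)).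
  { apply bd_int_bound; try exact HR; try (unfold u, v, r, s; lra).
    intros x y Hxy. destruct (Hbd x y Hxy) as (N & Hx & Hy & Hx' & Hy' & Hl).
    rewrite Cmod_mult, Cmod_inv by (apply Hne; assumption).
    apply Rmult_le_compat; try apply Cmod_ge_0.
    - left. apply Rinv_0_lt_compat. lra.
    - left. apply Hc1; simpl; lra.
    - apply Rinv_le_contravar; lra. }
  assert (B2 : Cmod (area_int D u v r s) <= 4 * (v - u) * (s - r) * M).
  { apply (area_int_bound a b c d); trivial; try (unfold u, v, r, s; lra).
    intros x y Hx Hy. unfold M.
    replace (D (x, y)) with (D (px, py) + (D (x, y) - D (px, py)))%C by ring.
    eapply Rle_trans; [apply Cmod_triangle|]. apply Rplus_le_compat_l.
    unfold u, v, r, s in Hx, Hy.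
    left. apply Hc2; simpl; apply Rabs_def1; lra. }
  replace (4 * ((v - u) + (s - r)) * (e * / t)) with (16 * e) in B1 by (unfold u, v, r, s; field; lra).
  replace (4 * (v - u) * (s - r) * M) with (16 * t * (t * M)) in B2 by (unfold u, v, r, s; ring).
  assert (t * (t * M) <= 1 * e) by (apply Rmult_le_compat; try lra; apply Rmult_le_pos; lra).
  lra.
Qed.

(** * Families of smooth functions with uniformly bounded derivatives *)

(** [ubd X m k h]: the first [k] iterates of the derivations [m i d/dx] applied to the functions
    [h i] are bounded on [X], uniformly in [i].  The choice [m = 1] gives smoothness and the usual
    seminorms; the other one used is the Euler operator [(x - x0) d/dx], up to a factor. *)
Fixpoint ubd {I : Type} (X : R -> Prop) (m : I -> R -> R) (k : nat) (h : I -> R -> R) : Prop :=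
  (exists K, forall i x, X x -> Rabs (h i x) <= K) /\
  match k with
  | O => True
  | S k => (forall i x, ex_derive (h i) x) /\ ubd X m k (fun i x => m i x * Derive (h i) x)
  end.

Section Ubd.
Context {I : Type}.
Variable X : R -> Prop.

Lemma ubd_bound (m : I -> R -> R) k h : ubd X m k h -> exists K, 0 <= K /\ forall i x, X x -> Rabs (h i x) <= K.
Proof.
  intros HH. assert (exists K, forall i x, X x -> Rabs (h i x) <= K) as [K HK] by (destruct k; apply HH).
  exists (Rmax 0 K). split; [apply Rmax_l|]. intros. eapply Rle_trans; [|apply Rmax_r]. auto.
Qed.

Lemma ubd_pred (m : I -> R -> R) k : forall h, ubd X m (S k) h -> ubd X m k h.
Proof.
  induction k as [|k IH]; intros h [H1 [H2 H3]]; [split; trivial|].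
  split; [assumption|]. split; [assumption|]. apply IH. exact H3.
Qed.

Lemma ubd_step (m : I -> R -> R) k h dh : (exists K, forall i x, X x -> Rabs (h i x) <= K) ->
  (forall i x, is_derive (h i) x (dh i x)) -> ubd X m k (fun i x => m i x * dh i x) ->
  ubd X m (S k) h.
Proof.
  intros HB Hd HU. split; [assumption|]. split.
  - intros i x. exists (dh i x). apply Hd.
  - replace (fun i x => m i x * Derive (h i) x) with (fun i x => m i x * dh i x); [assumption|].
    apply functional_extensionality; intro i. apply functional_extensionality; intro x.
    rewrite (is_derive_unique (h i) x (dh i x)); trivial.
Qed.

Lemma ubd_ext (m : I -> R -> R) k h g : (forall i x, h i x = g i x) -> ubd X m k h -> ubd X m k g.
Proof.
  intros E. replace g with h; [trivial|].
  apply functional_extensionality; intro i. apply functional_extensionality; intro x. apply E.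
Qed.

Lemma ubd_derive (m : I -> R -> R) k h i x : ubd X m (S k) h -> is_derive (h i) x (Derive (h i) x).
Proof. intros [_ [H1 _]]. apply Derive_correct. apply H1. Qed.

Lemma ubd_const (m : I -> R -> R) k : forall (c : I -> R), (exists K, forall i, Rabs (c i) <= K) ->
  ubd X m k (fun i _ => c i).
Proof.
  induction k as [|k IH]; intros c [K HK].
  - split; trivial. exists K; auto.
  - apply ubd_step with (fun _ _ => 0).
    + exists K; auto.
    + intros i x. apply (is_derive_const (K := R_AbsRing) (V := R_NormedModule)).
    + apply ubd_ext with (fun i _ => (fun _ => 0) i); [intros; ring|].
      apply IH. exists 0. intros. rewrite Rabs_R0. lra.
Qed.

Lemma ubd_plus (m : I -> R -> R) k : forall h g, ubd X m k h -> ubd X m k g ->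
  ubd X m k (fun i x => h i x + g i x).
Proof.
  induction k as [|k IH]; intros h g Hh Hg;
  destruct (ubd_bound _ _ _ Hh) as (K1 & _ & HK1); destruct (ubd_bound _ _ _ Hg) as (K2 & _ & HK2);
  assert (HB : exists K, forall i x, X x -> Rabs (h i x + g i x) <= K)
    by (exists (K1 + K2); intros; eapply Rle_trans; [apply Rabs_triang|apply Rplus_le_compat; auto]).
  - split; trivial.
  - apply ubd_step with (fun i x => Derive (h i) x + Derive (g i) x); [assumption| |].
    + intros i x. apply (is_derive_plus (K := R_AbsRing) (V := R_NormedModule)); eapply ubd_derive; eassumption.
    + eapply ubd_ext; [|apply IH; [apply Hh|apply Hg]]. intros; simpl; ring.
Qed.

Lemma ubd_mult (m : I -> R -> R) k : forall h g, ubd X m k h -> ubd X m k g ->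
  ubd X m k (fun i x => h i x * g i x).
Proof.
  induction k as [|k IH]; intros h g Hh Hg;
  destruct (ubd_bound _ _ _ Hh) as (K1 & P1 & HK1); destruct (ubd_bound _ _ _ Hg) as (K2 & P2 & HK2);
  assert (HB : exists K, forall i x, X x -> Rabs (h i x * g i x) <= K)
    by (exists (K1 * K2); intros; rewrite Rabs_mult; apply Rmult_le_compat; auto; apply Rabs_pos).
  - split; trivial.
  - apply ubd_step with (fun i x => Derive (h i) x * g i x + h i x * Derive (g i) x); [assumption| |].
    + intros i x. apply (is_derive_mult (K := R_AbsRing) (h i) (g i)); [eapply ubd_derive; eassumption|eapply ubd_derive; eassumption|].
      intros; apply Rmult_comm.
    + apply ubd_ext with (fun i x => (m i x * Derive (h i) x) * g i x + h i x * (m i x * Derive (g i) x));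
        [intros; ring|].
      apply ubd_plus.
      * apply (IH (fun i x => m i x * Derive (h i) x) g); [apply Hh|apply ubd_pred; assumption].
      * apply (IH h (fun i x => m i x * Derive (g i) x)); [apply ubd_pred; assumption|apply Hg].
Qed.

Lemma ubd_opp (m : I -> R -> R) k h : ubd X m k h -> ubd X m k (fun i x => - h i x).
Proof.
  intros Hh. apply ubd_ext with (fun i x => (fun (i : I) (x : R) => -1) i x * h i x); [intros; ring|].
  apply ubd_mult; [|assumption]. apply ubd_const. exists 1. intros. rewrite Rabs_left; lra.
Qed.

Lemma ubd_inv (m : I -> R -> R) c k h : 0 < c -> (forall i x, h i x <> 0) ->
  (forall i x, X x -> c <= Rabs (h i x)) -> ubd X m k h -> ubd X m k (fun i x => / h i x).
Proof.
  intros Hc Hne Hlow. induction k as [|k IH]; intros Hh;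
  assert (HB : exists K, forall i x, X x -> Rabs (/ h i x) <= K)
    by (exists (/ c); intros; rewrite Rabs_inv; apply Rinv_le_contravar; auto).
  - split; trivial.
  - apply ubd_step with (fun i x => - Derive (h i) x / h i x ^ 2); [assumption| |].
    + intros i x. apply is_derive_inv; [|apply Hne]. eapply ubd_derive; eassumption.
    + specialize (IH (ubd_pred _ _ _ Hh)). destruct Hh as [_ [_ Hh]].
      apply ubd_ext with (fun i x => - ((m i x * Derive (h i) x) * (/ h i x * / h i x))).
      * intros i x. simpl. field. apply Hne.
      * apply ubd_opp, (ubd_mult m k _ _ Hh), (ubd_mult m k _ _ IH IH).
Qed.

Lemma ubd_change (m : I -> R -> R) : (forall k, ubd X (fun _ _ => 1) k m) ->
  forall k h, ubd X (fun _ _ => 1) k h -> ubd X m k h.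
Proof.
  intros Hm. induction k as [|k IH]; intros h Hh; [exact Hh|].
  destruct Hh as (H1 & H2 & H3). split; [assumption|]. split; [assumption|].
  apply IH. apply ubd_mult; [apply Hm|].
  eapply ubd_ext; [|exact H3]. intros; simpl; ring.
Qed.

Lemma ubd_Derive_n k h : ubd X (fun (_ : I) _ => 1) k h -> forall j, (j <= k)%nat ->
  ubd X (fun (_ : I) _ => 1) (k - j) (fun i => Derive_n (h i) j).
Proof.
  intros Hh. induction j as [|j IH]; intros Hj; [rewrite Nat.sub_0_r; exact Hh|].
  specialize (IH ltac:(lia)). replace (k - j)%nat with (S (k - S j)) in IH by lia.
  destruct IH as (_ & _ & IH). eapply ubd_ext; [|exact IH].
  intros; simpl; ring.
Qed.

Lemma ubd_derivs_bound h : (forall k, ubd X (fun (_ : I) _ => 1) k h) -> forall N,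
  exists K, 0 <= K /\ forall i j x, (j <= N)%nat -> X x -> Rabs (Derive_n (h i) j x) <= K.
Proof.
  intros Hh. induction N as [|N (K & HK & IH)].
  - destruct (ubd_bound _ _ _ (Hh 0%nat)) as (K & HK & HB). exists K. split; trivial.
    intros i j x Hj Hx. replace j with 0%nat by lia. apply HB; assumption.
  - destruct (ubd_bound _ _ _ (ubd_Derive_n _ _ (Hh (S N)) (S N) (le_n _))) as (K' & HK' & HB).
    exists (Rmax K K'). split; [eapply Rle_trans; [exact HK|apply Rmax_l]|].
    intros i j x Hj Hx. destruct (Nat.eq_dec j (S N)) as [->|Hne].
    + eapply Rle_trans; [|apply Rmax_r]. apply (HB i x Hx).
    + eapply Rle_trans; [|apply Rmax_l]. apply IH; [lia|assumption].
Qed.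

Lemma ubd_smooth h i : (forall k, ubd X (fun (_ : I) _ => 1) k h) -> forall n x, ex_derive_n (h i) n x.
Proof.
  intros Hh n x. destruct n as [|n]; [exact Logic.I|].
  generalize (ubd_Derive_n _ _ (Hh (S n)) n ltac:(lia)).
  replace (S n - n)%nat with 1%nat by lia. intros (_ & Hd & _). apply Hd.
Qed.

End Ubd.

Definition smooth_R (u : R -> R) : Prop := forall n x, ex_derive_n u n x.

Lemma smooth_R_Derive u : smooth_R u -> smooth_R (Derive u).
Proof.
  intros Hu n x. destruct n as [|n]; [exact I|].
  simpl. apply ex_derive_ext with (Derive_n u (S n)); [|exact (Hu (S (S n)) x)].
  intros t. rewrite <- (Nat.add_1_r n). symmetry. exact (Derive_n_comp u n 1 t).
Qed.

Lemma smooth_R_derivable u x : smooth_R u -> ex_derive u x.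
Proof. intros Hu. exact (Hu 1%nat x). Qed.

Lemma smooth_R_continuous u x : smooth_R u -> continuous u x.
Proof. intros Hu. apply (ex_derive_continuous (V := R_NormedModule)). apply smooth_R_derivable; assumption. Qed.

Lemma bounded_on_segment (u : R -> R) c d : (forall x, c <= x <= d -> continuous u x) ->
  exists K, forall x, c <= x <= d -> Rabs (u x) <= K.
Proof.
  intros Hu. destruct (Rle_lt_dec c d) as [Hcd|Hcd].
  - destruct (continuity_ab_maj (fun x => Rabs (u x)) c d Hcd) as (M & HM & _).
    + intros x Hx. apply continuity_pt_filterlim.
      apply (continuous_comp u Rabs); [apply Hu; assumption|]. apply continuous_Rabs.
    + exists (Rabs (u M)). exact HM.
  - exists 0. intros; lra.
Qed.

Lemma smooth_R_ubd {I : Type} c d k : forall u, smooth_R u ->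
  ubd (fun x => c <= x <= d) (fun (_ : I) _ => 1) k (fun _ => u).
Proof.
  induction k as [|k IH]; intros u Hu;
  destruct (bounded_on_segment u c d) as [K HK]; try (intros; apply smooth_R_continuous; assumption).
  - split; trivial. exists K; auto.
  - split; [exists K; auto|]. split; [intros; apply smooth_R_derivable; assumption|].
    apply ubd_ext with (fun _ => Derive u); [intros; ring|]. apply IH. apply smooth_R_Derive; assumption.
Qed.

Lemma ubd_smooth_R {I : Type} X (h : I -> R -> R) i : (forall k, ubd X (fun _ _ => 1) k h) -> smooth_R (h i).
Proof. intros HH n x. apply (ubd_smooth X h i HH). Qed.

Lemma smooth_R_mult u v : smooth_R u -> smooth_R v -> smooth_R (fun x => u x * v x).
Proof.
  intros Hu Hv. apply (ubd_smooth_R (fun x => 0 <= x <= 0) (fun _ : unit => fun x => u x * v x) tt).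
  intros k. apply (ubd_mult _ _ k (fun _ => u) (fun _ => v)); apply smooth_R_ubd; assumption.
Qed.

Lemma smooth_R_plus u v : smooth_R u -> smooth_R v -> smooth_R (fun x => u x + v x).
Proof.
  intros Hu Hv. apply (ubd_smooth_R (fun x => 0 <= x <= 0) (fun _ : unit => fun x => u x + v x) tt).
  intros k. apply (ubd_plus _ _ k (fun _ => u) (fun _ => v)); apply smooth_R_ubd; assumption.
Qed.

Lemma smooth_R_const c : smooth_R (fun _ => c).
Proof. intros n x. apply ex_derive_n_const. Qed.

Lemma smooth_R_ext u v : (forall x, u x = v x) -> smooth_R u -> smooth_R v.
Proof. intros E Hu n x. apply ex_derive_n_ext with u; [exact E|apply Hu]. Qed.

Lemma smooth_R_opp u : smooth_R u -> smooth_R (fun x => - u x).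
Proof. intros Hu n x. apply ex_derive_n_opp. apply Hu. Qed.

Lemma smooth_R_minus u v : smooth_R u -> smooth_R v -> smooth_R (fun x => u x - v x).
Proof. intros Hu Hv. apply smooth_R_plus; [|apply smooth_R_opp]; assumption. Qed.

Lemma smooth_R_inv u : smooth_R u -> (forall x, u x <> 0) -> smooth_R (fun x => / u x).
Proof.
  intros Hu Hne. apply (ubd_smooth_R (fun x => 0 <= x <= 0) (fun _ : unit => fun x => / u x) tt).
  intros k. apply (ubd_inv _ _ (Rabs (u 0))) with (h := fun _ => u).
  - apply Rabs_pos_lt, Hne.
  - intros; apply Hne.
  - intros _ x Hx. replace x with 0 by lra. lra.
  - apply smooth_R_ubd; assumption.
Qed.

Lemma smooth_R_affine u a b : smooth_R u -> smooth_R (fun x => u (a * x + b)).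
Proof.
  intros Hu n x. apply (ex_derive_n_comp_scal (fun z => u (z + b)) a n x).
  exists (mkposreal 1 Rlt_0_1). intros y _ k _. apply (ex_derive_n_comp_trans u k y b). apply Hu.
Qed.

Lemma smooth_R_id : smooth_R (fun x => x).
Proof.
  intros n x. apply ex_derive_n_ext with (fun y => y ^ 1); [intros; ring|]. apply ex_derive_n_pow.
Qed.

(** * A smooth cutoff function *)

(** The family of all [exp (- 1 / t) / t ^ k] is stable under differentiation, which makes each of
    its members smooth by induction on the order alone. *)
Definition flat (k : nat) (t : R) : R := if Rlt_dec 0 t then exp (- / t) * (/ t) ^ k else 0.

Lemma pow_le_exp n : exists K, 0 < K /\ forall s, 0 <= s -> s ^ n <= K * exp s.
Proof.
  induction n as [|n (K & HK & IH)].
  - exists 1. split; [lra|]. intros s Hs. simpl. generalize (exp_ineq1_le s). lra.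
  - exists (K * 2 ^ S n). split; [apply Rmult_lt_0_compat; [|apply pow_lt]; lra|].
    intros s Hs. specialize (IH (s / 2) ltac:(lra)).
    assert (E : exp s = exp (s / 2) * exp (s / 2)) by (rewrite <- exp_plus; f_equal; field).
    assert (H1 := exp_ineq1_le (s / 2)). assert (H2 := exp_pos (s / 2)).
    replace (s ^ S n) with (2 ^ S n * ((s / 2) ^ n * (s / 2))).
    2:{ replace (s ^ S n) with ((2 * (s / 2)) ^ S n) by (f_equal; field).
        rewrite Rpow_mult_distr. simpl. field. }
    rewrite E.
    apply Rle_trans with (2 ^ S n * ((K * exp (s / 2)) * exp (s / 2))); [|right; ring].
    apply Rmult_le_compat_l; [apply pow_le; lra|].
    apply Rmult_le_compat; [apply pow_le; lra|lra|exact IH|lra].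
Qed.

Lemma flat_small k : exists K, 0 < K /\ forall t, Rabs (flat k t) <= K * t ^ 2.
Proof.
  destruct (pow_le_exp (k + 2)) as (K & HK & HE). exists K. split; trivial.
  intros t. unfold flat. destruct Rlt_dec as [Ht|Ht].
  - assert (Hi : 0 < / t) by (apply Rinv_0_lt_compat; assumption).
    rewrite Rabs_right.
    2:{ apply Rle_ge, Rmult_le_pos; [left; apply exp_pos|apply pow_le; lra]. }
    specialize (HE (/ t) ltac:(lra)).
    rewrite exp_Ropp. rewrite pow_add in HE.
    assert (Hx := exp_pos (/ t)).
    apply Rmult_le_reg_r with (exp (/ t)); [assumption|].
    apply Rmult_le_reg_r with ((/ t) ^ 2); [apply pow_lt; assumption|].
    replace (/ exp (/ t) * (/ t) ^ k * exp (/ t) * (/ t) ^ 2) with ((/ t) ^ k * (/ t) ^ 2) by (field; lra).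
    replace (K * t ^ 2 * exp (/ t) * (/ t) ^ 2) with (K * exp (/ t)) by (field; lra). exact HE.
  - rewrite Rabs_R0. apply Rmult_le_pos; [lra|apply pow2_ge_0].
Qed.

(** At 0 the derivative vanishes because [flat k] is quadratically small there. *)
Lemma flat_derive k t : is_derive (flat k) t (- INR k * flat (S k) t + flat (S (S k)) t).
Proof.
  destruct (Rtotal_order t 0) as [Ht|[->|Ht]].
  - apply is_derive_ext_loc with (fun _ => 0).
    + apply locally_R with (- t); [lra|]. intros y Hy. apply Rabs_def2 in Hy.
      unfold flat. destruct Rlt_dec; [lra|trivial].
    + unfold flat. destruct Rlt_dec; [lra|].
      replace (- INR k * 0 + 0) with 0 by ring. apply (is_derive_const (K := R_AbsRing) (V := R_NormedModule)).
  - assert (E0 : forall j, flat j 0 = 0) by (intros j; unfold flat; destruct Rlt_dec; [lra|trivial]).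
    rewrite !E0. replace (- INR k * 0 + 0) with 0 by ring.
    apply is_derive_Reals. destruct (flat_small k) as (K & HK & HE).
    intros e He. assert (Hd : 0 < e / K) by (apply Rdiv_lt_0_compat; assumption).
    exists (mkposreal _ Hd). intros h Hh Hhd. simpl in Hhd.
    rewrite E0, Rplus_0_l, !Rminus_0_r. unfold Rdiv. rewrite Rabs_mult, Rabs_inv.
    assert (Hp := Rabs_pos_lt h Hh).
    apply Rmult_lt_reg_r with (Rabs h); [assumption|]. rewrite Rmult_assoc, Rinv_l, Rmult_1_r by lra.
    eapply Rle_lt_trans; [apply HE|].
    replace (K * h ^ 2) with (K * Rabs h * Rabs h) by (rewrite <- (pow2_abs h); ring).
    apply Rmult_lt_compat_r; [assumption|].
    apply Rmult_lt_reg_l with (/ K); [apply Rinv_0_lt_compat; assumption|].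
    replace (/ K * (K * Rabs h)) with (Rabs h) by (field; lra). unfold Rdiv in Hhd. lra.
  - apply is_derive_ext_loc with (fun s => exp (- / s) * (/ s) ^ k).
    + apply locally_R with t; [assumption|]. intros y Hy. apply Rabs_def2 in Hy.
      unfold flat. destruct Rlt_dec; [trivial|lra].
    + unfold flat. destruct Rlt_dec; [|lra].
      destruct k as [|k].
      * simpl. auto_derive; [lra|]. field; lra.
      * auto_derive; [lra|].
        rewrite S_INR. simpl. replace (match k with 0%nat => 1 | S _ => INR k + 1 end) with (INR k + 1) by (destruct k; simpl; ring).
        field; lra.
Qed.

Lemma smooth_R_flat j : smooth_R (flat j).
Proof.
  assert (HU : forall k j, ubd (fun _ => False) (fun (_ : unit) _ => 1) k (fun _ => flat j)).
  { induction k as [|k IH]; intros i.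
    - split; trivial. exists 0. tauto.
    - apply ubd_step with (fun _ t => - INR i * flat (S i) t + flat (S (S i)) t).
      + exists 0; tauto.
      + intros _. apply flat_derive.
      + apply ubd_ext with (fun (_ : unit) t => (fun _ _ => - INR i) tt t * flat (S i) t + flat (S (S i)) t);
          [intros; ring|].
        apply ubd_plus; [|apply IH]. apply ubd_mult; [|apply IH].
        apply ubd_const. exists (Rabs (- INR i)). intros _; lra. }
  apply (ubd_smooth_R (fun _ => False) (fun _ : unit => flat j) tt). intros k; apply HU.
Qed.

Lemma flat_pos j t : 0 < t -> 0 < flat j t.
Proof.
  intros Ht. unfold flat. destruct Rlt_dec; [|lra].
  apply Rmult_lt_0_compat; [apply exp_pos|]. apply pow_lt, Rinv_0_lt_compat; assumption.
Qed.

Lemma flat_zero j t : t <= 0 -> flat j t = 0.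
Proof. intros Ht. unfold flat. destruct Rlt_dec; [lra|trivial]. Qed.

Lemma flat_nonneg j t : 0 <= flat j t.
Proof.
  destruct (Rlt_le_dec 0 t); [left; apply flat_pos|rewrite flat_zero]; lra.
Qed.

Definition step (t : R) : R := flat 0 t / (flat 0 t + flat 0 (1 - t)).

Lemma smooth_R_step : smooth_R step.
Proof.
  assert (H1 : smooth_R (fun t => flat 0 (1 - t))).
  { apply smooth_R_ext with (fun t => flat 0 (-1 * t + 1)); [intros; f_equal; ring|].
    apply smooth_R_affine, smooth_R_flat. }
  apply smooth_R_mult; [apply smooth_R_flat|]. apply smooth_R_inv.
  - apply smooth_R_plus; [apply smooth_R_flat|assumption].
  - intros t. destruct (Rlt_le_dec 0 t) as [Ht|Ht].
    + generalize (flat_pos 0 t Ht) (flat_nonneg 0 (1 - t)). lra.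
    + generalize (flat_nonneg 0 t) (flat_pos 0 (1 - t) ltac:(lra)). lra.
Qed.

Lemma step_one t : 1 <= t -> step t = 1.
Proof.
  intros Ht. unfold step. rewrite (flat_zero 0 (1 - t)) by lra.
  assert (H := flat_pos 0 t ltac:(lra)). field. lra.
Qed.

Lemma step_zero t : t <= 0 -> step t = 0.
Proof. intros Ht. unfold step. rewrite (flat_zero 0 t) by lra. unfold Rdiv. apply Rmult_0_l. Qed.

Lemma step_bounds t : 0 <= step t <= 1.
Proof.
  unfold step. assert (H1 := flat_nonneg 0 t). assert (H2 := flat_nonneg 0 (1 - t)).
  assert (H3 : 0 < flat 0 t + flat 0 (1 - t)).
  { destruct (Rlt_le_dec 0 t) as [Ht|Ht].
    - generalize (flat_pos 0 t Ht). lra.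
    - generalize (flat_pos 0 (1 - t) ltac:(lra)). lra. }
  assert (H4 := Rinv_0_lt_compat _ H3). split; [apply Rmult_le_pos; lra|].
  apply Rmult_le_reg_r with (flat 0 t + flat 0 (1 - t)); [assumption|].
  unfold Rdiv. rewrite Rmult_assoc, Rinv_l; lra.
Qed.

Lemma smooth_cutoff (x0 d : R) : 0 < d -> exists chi, smooth_R chi /\
  (forall x, Rabs (x - x0) <= d -> chi x = 1) /\ (forall x, 2 * d <= Rabs (x - x0) -> chi x = 0) /\
  (forall x, 0 <= chi x <= 1).
Proof.
  intros Hd.
  exists (fun x => step (/ d * x + (2 - x0 / d)) * step (- / d * x + (2 + x0 / d))).
  assert (E1 : forall x, / d * x + (2 - x0 / d) = 2 + (x - x0) / d) by (intros; field; lra).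
  assert (E2 : forall x, - / d * x + (2 + x0 / d) = 2 - (x - x0) / d) by (intros; field; lra).
  split; [|split; [|split]].
  - apply smooth_R_mult; apply smooth_R_affine, smooth_R_step.
  - intros x Hx. rewrite E1, E2. apply Rabs_le_between in Hx.
    assert (- 1 <= (x - x0) / d <= 1).
    { split; apply Rmult_le_reg_r with d; try assumption; unfold Rdiv; rewrite Rmult_assoc, Rinv_l; lra. }
    rewrite !step_one by lra. ring.
  - intros x Hx. rewrite E1, E2. unfold Rabs in Hx. destruct Rcase_abs.
    + rewrite (step_zero (2 + (x - x0) / d)); [ring|].
      apply Rmult_le_reg_r with d; [assumption|]. unfold Rdiv.
      rewrite Rmult_plus_distr_r, Rmult_assoc, Rinv_l; lra.
    + rewrite (step_zero (2 - (x - x0) / d)); [ring|].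
      apply Rmult_le_reg_r with d; [assumption|]. unfold Rdiv.
      rewrite Rmult_minus_distr_r, Rmult_assoc, Rinv_l; lra.
  - intros x. destruct (step_bounds (/ d * x + (2 - x0 / d))), (step_bounds (- / d * x + (2 + x0 / d))).
    split; [apply Rmult_le_pos; assumption|]. rewrite <- (Rmult_1_l 1). apply Rmult_le_compat; assumption.
Qed.

Definition bump (c d x : R) : R := flat 0 (x - c) * flat 0 (d - x).

Lemma smooth_R_bump c d : smooth_R (bump c d).
Proof.
  apply smooth_R_mult.
  - apply smooth_R_ext with (fun t => flat 0 (1 * t + - c)); [intros; f_equal; ring|].
    apply smooth_R_affine, smooth_R_flat.
  - apply smooth_R_ext with (fun t => flat 0 (-1 * t + d)); [intros; f_equal; ring|].
    apply smooth_R_affine, smooth_R_flat.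
Qed.

Lemma bump_pos c d x : c < x < d -> 0 < bump c d x.
Proof. intros. apply Rmult_lt_0_compat; apply flat_pos; lra. Qed.

Lemma bump_zero c d x : x <= c \/ d <= x -> bump c d x = 0.
Proof.
  intros [Hx|Hx]; unfold bump; [rewrite (flat_zero 0 (x - c)) by lra|rewrite (flat_zero 0 (d - x)) by lra]; ring.
Qed.

Lemma bump_nonneg c d x : 0 <= bump c d x.
Proof. apply Rmult_le_pos; apply flat_nonneg. Qed.

Lemma smooth_iff phi : smooth phi <-> smooth_R (fun t => Re (phi t)) /\ smooth_R (fun t => Im (phi t)).
Proof.
  split; [intros HH; split; intros n x; apply HH|].
  intros [H1 H2] n x. split; [apply H1|apply H2].
Qed.

(** * The uniform boundedness principle for test functions on an interval *)

Lemma geometric_cauchy (v : nat -> R) A k : (forall n, (k <= n)%nat -> Rabs (v (S n) - v n) <= A * (/ 2) ^ n) ->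
  forall n j, (k <= n)%nat -> Rabs (v (n + j)%nat - v n) <= 2 * A * (/ 2) ^ n.
Proof.
  intros Hv n j Hn.
  assert (HA : 0 <= A * (/ 2) ^ n) by (eapply Rle_trans; [apply Rabs_pos|apply (Hv n Hn)]).
  assert (HH : Rabs (v (n + j)%nat - v n) <= 2 * A * (/ 2) ^ n * (1 - (/ 2) ^ j)).
  { induction j as [|j IH].
    - rewrite Nat.add_0_r. replace (v n - v n) with 0 by ring. rewrite Rabs_R0. simpl. lra.
    - replace (n + S j)%nat with (S (n + j)) by lia.
      replace (v (S (n + j)) - v n) with ((v (S (n + j)) - v (n + j)%nat) + (v (n + j)%nat - v n)) by ring.
      eapply Rle_trans; [apply Rabs_triang|].
      specialize (Hv (n + j)%nat ltac:(lia)). rewrite pow_add in Hv. simpl. lra. }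
  eapply Rle_trans; [exact HH|].
  assert (0 < (/ 2) ^ j) by (apply pow_lt; lra).
  assert (0 <= A * (/ 2) ^ n * (/ 2) ^ j) by (apply Rmult_le_pos; lra). lra.
Qed.

Lemma smooth_geometric_limit (u : nat -> R -> R) A : (forall n, smooth_R (u n)) ->
  (forall k n x, (k <= n)%nat -> Rabs (Derive_n (u (S n)) k x - Derive_n (u n) k x) <= A * (/ 2) ^ n) ->
  smooth_R (fun x => Lim_seq (fun n => u n x)) /\
  forall x, is_lim_seq (fun n => u n x) (real (Lim_seq (fun n => u n x))).
Proof.
  intros Hs Hc.
  assert (HA : 0 <= A).
  { generalize (Hc 0%nat 0%nat 0 (le_n _)) (Rabs_pos (Derive_n (u 1%nat) 0 0 - Derive_n (u 0%nat) 0 0)). simpl. lra. }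
  assert (HU : forall k, CVU_dom (fun n => Derive_n (u n) k) (fun _ => True)).
  { intros k. apply CVU_dom_cauchy. intros e.
    destruct (pow_lt_1_zero (/ 2)) with (y := e / (4 * A + 1)) as [N HN].
    { rewrite Rabs_right; lra. }
    { apply Rdiv_lt_0_compat; [apply cond_pos|lra]. }
    exists (max N k). intros n m x _ Hn Hm.
    assert (HN' := HN (max N k) ltac:(lia)).
    assert (Hp : 0 < (/ 2) ^ max N k) by (apply pow_lt; lra).
    rewrite Rabs_right in HN' by lra.
    assert (G := geometric_cauchy (fun n => Derive_n (u n) k x) A k (fun n Hn => Hc k n x Hn) (max N k)).
    assert (G1 := G (n - max N k)%nat ltac:(lia)). assert (G2 := G (m - max N k)%nat ltac:(lia)).
    replace (max N k + (n - max N k))%nat with n in G1 by lia.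
    replace (max N k + (m - max N k))%nat with m in G2 by lia.
    cbv beta in G1, G2.
    set (z := Derive_n (u (max N k)) k x) in *.
    replace (Derive_n (u n) k x - Derive_n (u m) k x) with
      ((Derive_n (u n) k x - z) + - (Derive_n (u m) k x - z)) by ring.
    eapply Rle_lt_trans; [apply Rabs_triang|]. rewrite Rabs_Ropp.
    assert (4 * A * (/ 2) ^ max N k < e).
    { apply Rlt_le_trans with ((4 * A + 1) * (/ 2) ^ max N k); [lra|].
      left. apply Rlt_div_r in HN'; lra. }
    lra. }
  set (U := fun k x => real (Lim_seq (fun n => Derive_n (u n) k x))).
  assert (HD : forall k x, is_derive (U k) x (U (S k) x)).
  { intros k x. apply (CVU_Derive (fun n => Derive_n (u n) k) (fun _ => True)); trivial.
    - apply open_true.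
    - intros a b c _ _ _. exact I.
    - intros n y _. apply (Hs n (S k) y).
    - intros n y _. apply continuity_pt_filterlim.
      apply (ex_derive_continuous (V := R_NormedModule)). apply (Hs n (S (S k)) y).
    - apply (HU (S k)). }
  assert (HDn : forall k x, Derive_n (U 0%nat) k x = U k x).
  { induction k as [|k IH]; intros x; [reflexivity|].
    simpl. rewrite (Derive_ext _ (U k)) by exact IH. apply is_derive_unique, HD. }
  split.
  - intros n x. destruct n as [|n]; [exact I|]. simpl.
    apply ex_derive_ext with (U n); [intros t; symmetry; apply HDn|].
    exists (U (S n) x). apply HD.
  - intros x. apply Lim_seq_correct'. apply (CVU_CVS_dom _ _ (HU 0%nat) x I).
Qed.

Definition test_R (c d : R) (u : R -> R) : Prop :=
  smooth_R u /\ forall x, x < c \/ d < x -> u x = 0.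


Section Hump.
Context {Y : Type}.
Variable T : Y -> (R -> R) -> C.
Variables c d : R.
Hypothesis T_plus : forall y u v, test_R c d u -> test_R c d v -> T y (fun x => u x + v x) = (T y u + T y v)%C.
Hypothesis T_scal : forall y k u, test_R c d u -> T y (fun x => k * u x) = (RtoC k * T y u)%C.
Hypothesis T_sup : forall y, exists K, forall u m, test_R c d u -> (forall x, Rabs (u x) <= m) -> Cmod (T y u) <= K * m.
Hypothesis T_pointwise : forall u, test_R c d u -> exists B, forall y, Cmod (T y u) <= B.

Lemma test_R_plus u v : test_R c d u -> test_R c d v -> test_R c d (fun x => u x + v x).
Proof.
  intros [H1 H2] [K1 K2]. split; [apply smooth_R_plus; assumption|].
  intros x Hx. rewrite H2, K2 by assumption. ring.
Qed.

Lemma test_R_scal k u : test_R c d u -> test_R c d (fun x => k * u x).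
Proof.
  intros [H1 H2]. split; [apply smooth_R_mult; [apply smooth_R_const|assumption]|].
  intros x Hx. rewrite H2 by assumption. ring.
Qed.

Hypothesis not_equicontinuous : forall N K, 0 <= K -> exists y u m, test_R c d u /\
  (forall k x, (k <= N)%nat -> Rabs (Derive_n u k x) <= m) /\ K * m < Cmod (T y u).

(** The gliding hump: if no seminorm controls all the [T y], then one can add up small smooth humps
    [w n] such that [T (y n)] is large on [w n] and tiny on the later ones; the sum is a test
    function on which the [T y] are not bounded. *)
Lemma hump_exists N eta B : 0 < eta -> 0 <= B -> exists y w, test_R c d w /\
  (forall k x, (k <= N)%nat -> Rabs (Derive_n w k x) <= eta) /\ B < Cmod (T y w).
Proof.
  intros He HB.
  destruct (not_equicontinuous N (B / eta)) as (y & u & m & Hu & Hk & HT).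
  { apply Rmult_le_pos; [assumption|]. left; apply Rinv_0_lt_compat; assumption. }
  assert (Hm0 : 0 <= m) by (eapply Rle_trans; [apply Rabs_pos|apply (Hk 0%nat 0); lia]).
  assert (Hm : 0 < m).
  { destruct Hm0 as [|Hm0]; [assumption|]. exfalso. subst m.
    destruct (T_sup y) as [K HK]. specialize (HK u 0 Hu (fun x => Hk 0%nat x (Nat.le_0_l _))). lra. }
  exists y, (fun x => eta / m * u x). split; [apply test_R_scal; assumption|]. split.
  - intros k x Hkx. rewrite Derive_n_scal_l, Rabs_mult, Rabs_right.
    2:{ apply Rle_ge. left. apply Rdiv_lt_0_compat; assumption. }
    replace eta with (eta / m * m) at 2 by (field; lra).
    apply Rmult_le_compat_l; [left; apply Rdiv_lt_0_compat; assumption|]. apply Hk; assumption.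
  - rewrite T_scal by assumption. rewrite Cmod_mult, Cmod_R, Rabs_right.
    2:{ apply Rle_ge. left. apply Rdiv_lt_0_compat; assumption. }
    apply Rmult_lt_compat_l with (r := eta / m) in HT; [|apply Rdiv_lt_0_compat; assumption].
    replace (eta / m * (B / eta * m)) with B in HT by (field; lra). exact HT.
Qed.

Definition hump_state : Type := { s : (R -> R) * R | test_R c d (fst s) /\ 0 < snd s }.

Definition hump_step (n : nat) (s s' : hump_state) : Prop :=
  let Phi := fst (proj1_sig s) in let eta := snd (proj1_sig s) in
  let Phi' := fst (proj1_sig s') in let eta' := snd (proj1_sig s') in
  eta' <= eta / 2 /\ exists y w, test_R c d w /\ (forall x, Phi' x = Phi x + w x) /\
    (forall k x, (k <= n)%nat -> Rabs (Derive_n w k x) <= eta) /\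
    Cmod (T y Phi) + INR n + 1 < Cmod (T y w) /\
    (forall v, test_R c d v -> (forall x, Rabs (v x) <= 2 * eta') -> Cmod (T y v) <= 1).

Lemma hump_step_exists n s : exists s', hump_step n s s'.
Proof.
  destruct s as [[Phi eta] [HP He]]. simpl in HP, He.
  destruct (T_pointwise Phi HP) as [B HB].
  destruct (hump_exists n eta (Rabs B + INR n + 1) He) as (y & w & Hw & Hk & HT).
  { generalize (Rabs_pos B) (pos_INR n). lra. }
  destruct (T_sup y) as [K HK].
  set (eta' := Rmin (eta / 2) (/ (2 * (Rabs K + 1)))).
  assert (HK1 : 0 < 2 * (Rabs K + 1)) by (generalize (Rabs_pos K); lra).
  assert (He' : 0 < eta') by (apply Rmin_pos; [lra|apply Rinv_0_lt_compat; assumption]).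
  exists (exist _ ((fun x => Phi x + w x), eta') (conj (test_R_plus _ _ HP Hw) He')).
  unfold hump_step; simpl. split; [apply Rmin_l|].
  exists y, w. repeat split; trivial; try apply Hw.
  - generalize (HB y) (Rle_abs B). lra.
  - intros v Hv Hv'. eapply Rle_trans; [apply (HK v (2 * eta') Hv Hv')|].
    assert (E := Rmin_r (eta / 2) (/ (2 * (Rabs K + 1)))). fold eta' in E.
    apply Rle_trans with (Rabs K * (2 * / (2 * (Rabs K + 1)))).
    + apply Rmult_le_compat; try lra; [|apply Rle_abs].
      destruct (Rle_lt_dec 0 K); [assumption|].
      exfalso. assert (0 <= K * (2 * eta')).
      { eapply Rle_trans; [apply Cmod_ge_0|]. apply (HK v (2 * eta') Hv Hv'). }
      assert (K * (2 * eta') < 0); [|lra]. rewrite <- (Rmult_0_l (2 * eta')). apply Rmult_lt_compat_r; lra.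
    + generalize (Rabs_pos K); intro. apply Rmult_le_reg_r with (2 * (Rabs K + 1)); [assumption|].
      replace (Rabs K * (2 * / (2 * (Rabs K + 1))) * (2 * (Rabs K + 1))) with (2 * Rabs K) by (field; lra). lra.
Qed.

Lemma gliding_hump : False.
Proof.
  assert (H0 : test_R c d (fun _ => 0)) by (split; [apply smooth_R_const|trivial]).
  set (s0 := exist _ ((fun _ => 0), 1) (conj H0 Rlt_0_1) : hump_state).
  set (next := fun n s => proj1_sig (constructive_indefinite_description _ (hump_step_exists n s))).
  set (sq := fix sq n := match n with O => s0 | S n => next n (sq n) end).
  assert (Hsq : forall n, hump_step n (sq n) (sq (S n))).
  { intros n. simpl. unfold next. apply (proj2_sig (constructive_indefinite_description _ _)). }
  set (Phi := fun n => fst (proj1_sig (sq n))). set (eta := fun n => snd (proj1_sig (sq n))).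
  assert (HP : forall n, test_R c d (Phi n)) by (intros n; apply (proj2_sig (sq n))).
  assert (Heta : forall n, 0 < eta n) by (intros n; apply (proj2_sig (sq n))).
  assert (Hst : forall n, eta (S n) <= eta n / 2 /\ exists y w, test_R c d w /\ (forall x, Phi (S n) x = Phi n x + w x) /\
    (forall k x, (k <= n)%nat -> Rabs (Derive_n w k x) <= eta n) /\
    Cmod (T y (Phi n)) + INR n + 1 < Cmod (T y w) /\
    (forall v, test_R c d v -> (forall x, Rabs (v x) <= 2 * eta (S n)) -> Cmod (T y v) <= 1)) by exact Hsq.
  assert (Hgeo : forall m n, eta (m + n)%nat <= eta m * (/ 2) ^ n).
  { intros m. induction n as [|n IH]; [rewrite Nat.add_0_r; simpl; lra|].
    rewrite Nat.add_succ_r. destruct (Hst (m + n)%nat) as [HE _]. simpl. lra. }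
  assert (HDer : forall k n x, (k <= n)%nat -> Rabs (Derive_n (Phi (S n)) k x - Derive_n (Phi n) k x) <= eta n).
  { intros k n x Hk. destruct (Hst n) as (_ & y & w & Hw & HE & Hb & _).
    rewrite (Derive_n_ext _ _ k x HE).
    rewrite Derive_n_plus.
    - replace (Derive_n (Phi n) k x + Derive_n w k x - Derive_n (Phi n) k x) with (Derive_n w k x) by ring.
      apply Hb; assumption.
    - exists (mkposreal 1 Rlt_0_1). intros; apply (HP n).
    - exists (mkposreal 1 Rlt_0_1). intros; apply Hw. }
  destruct (smooth_geometric_limit Phi 1) as [HS HL].
  { intros n; apply (HP n). }
  { intros k n x Hk. eapply Rle_trans; [apply HDer; assumption|]. apply (Hgeo 0%nat n). }
  set (U := fun x => real (Lim_seq (fun n => Phi n x))) in *.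
  assert (HU : test_R c d U).
  { split; [exact HS|]. intros x Hx. unfold U.
    rewrite (Lim_seq_ext _ (fun _ => 0)), Lim_seq_const; [reflexivity|].
    intros n. apply (HP n). assumption. }
  assert (Htail : forall n x, Rabs (U x - Phi n x) <= 2 * eta n).
  { intros n x.
    assert (G := geometric_cauchy (fun j => Phi (n + j)%nat x) (eta n) 0).
    assert (G1 : forall j, Rabs (Phi (n + j)%nat x - Phi n x) <= 2 * eta n).
    { intros j. replace (2 * eta n) with (2 * eta n * (/ 2) ^ 0) by (simpl; ring).
      generalize (G ltac:(intros i _; cbv beta; rewrite Nat.add_succ_r; eapply Rle_trans; [apply (HDer 0%nat); lia|apply Hgeo]) 0%nat j (le_n _)).
      simpl. rewrite Nat.add_0_r. trivial. }
    assert (GL : is_lim_seq (fun j => Rabs (Phi (j + n)%nat x - Phi n x)) (Rabs (U x - Phi n x))).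
    { apply (is_lim_seq_abs _ (Finite (U x - Phi n x))).
      apply is_lim_seq_minus'; [|apply is_lim_seq_const].
      apply (is_lim_seq_incr_n (fun j => Phi j x) n). apply HL. }
    apply (is_lim_seq_le _ (fun _ => 2 * eta n) _ (Finite (2 * eta n)) (fun j => eq_ind _ (fun i => Rabs (Phi i x - Phi n x) <= _) (G1 j) _ (Nat.add_comm n j)) GL (is_lim_seq_const _)). }
  destruct (T_pointwise U HU) as [B HB].
  destruct (INR_unbounded B) as [n Hn].
  destruct (Hst n) as (_ & y & w & Hw & HE & Hb & Hbig & Hsmall).
  assert (Hr : test_R c d (fun x => U x + -1 * Phi (S n) x)) by (apply test_R_plus, test_R_scal, HP; exact HU).
  assert (E : T y U = (T y w + T y (Phi n) + T y (fun x => U x + -1 * Phi (S n) x)%R)%C).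
  { rewrite (T_plus y U (fun x => -1 * Phi (S n) x)) by (trivial; apply test_R_scal, HP).
    rewrite (T_scal y (-1) (Phi (S n))) by apply HP.
    replace (Phi (S n)) with (fun x => Phi n x + w x).
    2:{ apply FunctionalExtensionality.functional_extensionality. intros; symmetry; apply HE. }
    rewrite T_plus by (trivial; apply HP).
    replace (RtoC (-1)) with (- (1))%C by (unfold RtoC, Copp; simpl; f_equal; ring). ring. }
  assert (H1 : Cmod (T y (fun x => U x + -1 * Phi (S n) x)) <= 1).
  { apply Hsmall; [assumption|]. intros x. replace (U x + -1 * Phi (S n) x) with (U x - Phi (S n) x) by ring. apply Htail. }
  specialize (HB y).
  assert (HT : Cmod (T y w) <= Cmod (T y U) + Cmod (T y (Phi n)) + Cmod (T y (fun x => U x + -1 * Phi (S n) x))).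
  { replace (T y w) with (T y U + - T y (Phi n) + - T y (fun x => (U x + -1 * Phi (S n) x)%R))%C by (rewrite E; ring).
    eapply Rle_trans; [apply Cmod_triangle|]. rewrite Cmod_opp. apply Rplus_le_compat_r.
    eapply Rle_trans; [apply Cmod_triangle|]. rewrite Cmod_opp. lra. }
  lra.
Qed.
End Hump.

Theorem uniform_boundedness {Y : Type} (T : Y -> (R -> R) -> C) c d :
  (forall y u v, test_R c d u -> test_R c d v -> T y (fun x => u x + v x) = (T y u + T y v)%C) ->
  (forall y k u, test_R c d u -> T y (fun x => k * u x) = (RtoC k * T y u)%C) ->
  (forall y, exists K, forall u m, test_R c d u -> (forall x, Rabs (u x) <= m) -> Cmod (T y u) <= K * m) ->
  (forall u, test_R c d u -> exists B, forall y, Cmod (T y u) <= B) ->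
  exists N K, 0 <= K /\ forall y u m, test_R c d u ->
    (forall k x, (k <= N)%nat -> Rabs (Derive_n u k x) <= m) -> Cmod (T y u) <= K * m.
Proof.
  intros H1 H2 H3 H4. apply NNPP. intros Hn.
  apply (gliding_hump T c d H1 H2 H3 H4).
  intros N K HK. apply NNPP. intros Hn'. apply Hn. exists N, K. split; [assumption|].
  intros y u m Hu Hk. apply Rnot_lt_le. intros Hlt. apply Hn'. exists y, u, m. repeat split; trivial; apply Hu.
Qed.

(** * The slices of an analytic function near its boundary *)

Lemma diff_C_complex F z l : @is_derive C_AbsRing C_NormedModule F z l -> diff_C F z l (Ci * l).
Proof.
  intros [_ HF]. specialize (HF z (fun P HP => HP)).
  assert (HE : forall e : posreal, exists dl : posreal, forall w, Cmod (w - z) < dl ->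
     Cmod (F w - F z - (w - z) * l) <= e * Cmod (w - z)).
  { intros e. destruct (HF e) as [dl Hdl]. exists dl. intros w Hw. exact (Hdl w Hw). }
  clear HF. destruct z as [zx zy].
  assert (HG : forall e : posreal, locally_2d (fun u v =>
     Cmod (F (u, v) - F (zx, zy) - ((u, v) - (zx, zy)) * l) <= e * Rmax (Rabs (u - zx)) (Rabs (v - zy))) zx zy).
  { intros e. assert (He2 : 0 < e / 2) by (generalize (cond_pos e); lra).
    destruct (HE (mkposreal _ He2)) as [dl Hdl].
    assert (Hd2 : 0 < dl / 2) by (generalize (cond_pos dl); lra).
    exists (mkposreal _ Hd2). simpl. intros u v Hu Hv.
    assert (Hc : Cmod ((u, v) - (zx, zy)) <= Rabs (u - zx) + Rabs (v - zy)) by apply (Cmod_le_Rabs ((u, v) - (zx, zy))).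
    eapply Rle_trans; [apply Hdl; lra|]. simpl.
    assert (M1 := Rmax_l (Rabs (u - zx)) (Rabs (v - zy))). assert (M2 := Rmax_r (Rabs (u - zx)) (Rabs (v - zy))).
    apply Rle_trans with (e / 2 * (2 * Rmax (Rabs (u - zx)) (Rabs (v - zy)))); [|right; field].
    apply Rmult_le_compat_l; lra. }
  split; intros e; destruct (HG e) as [dl Hdl]; exists dl; intros u v Hu Hv; simpl in *;
  (eapply Rle_trans; [|apply (Hdl u v Hu Hv)]).
  - eapply Rle_trans; [|apply re_le_Cmod]. right. f_equal. simpl. unfold Re, Im. ring.
  - eapply Rle_trans; [|apply im_le_Cmod]. right. f_equal. simpl. unfold Re, Im. ring.
Qed.

Lemma bounded_on_rect (f : R -> R -> R) x1 x2 y1 y2 :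
  (forall x y, x1 <= x <= x2 -> y1 <= y <= y2 -> continuity_2d_pt f x y) ->
  exists K, forall x y, x1 <= x <= x2 -> y1 <= y <= y2 -> Rabs (f x y) <= K.
Proof.
  intros Hf. destruct (uniform_continuity_2d f x1 x2 y1 y2 Hf (mkposreal 1 Rlt_0_1)) as [dl Hdl].
  simpl in Hdl.
  destruct (INR_unbounded ((Rabs (x2 - x1) + Rabs (y2 - y1)) / dl)) as [n Hn].
  assert (Hd := cond_pos dl).
  exists (Rabs (f x1 y1) + INR n). intros x y Hx Hy.
  assert (Hn0 : 0 < INR n).
  { eapply Rle_lt_trans; [|exact Hn]. apply Rmult_le_pos; [|left; apply Rinv_0_lt_compat; assumption].
    generalize (Rabs_pos (x2 - x1)) (Rabs_pos (y2 - y1)); lra. }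
  assert (Hn' : Rabs (x2 - x1) + Rabs (y2 - y1) < INR n * dl).
  { apply Rmult_lt_reg_r with (/ dl); [apply Rinv_0_lt_compat; assumption|].
    replace (INR n * dl * / dl) with (INR n) by (field; lra). exact Hn. }
  rewrite !Rabs_right in Hn' by lra.
  set (p := fun j => x1 + INR j / INR n * (x - x1)). set (q := fun j => y1 + INR j / INR n * (y - y1)).
  assert (Hr : forall j, (j <= n)%nat -> 0 <= INR j / INR n <= 1).
  { intros j Hj. apply le_INR in Hj. assert (H0 := pos_INR j). split.
    - apply Rmult_le_pos; [assumption|]. left; apply Rinv_0_lt_compat; assumption.
    - apply Rmult_le_reg_r with (INR n); [assumption|]. replace (INR j / INR n * INR n) with (INR j) by (field; lra). lra. }
  assert (Hind : forall j, (j <= n)%nat -> Rabs (f (p j) (q j)) <= Rabs (f x1 y1) + INR j).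
  { induction j as [|j IH]; intros Hj.
    - unfold p, q. simpl. replace (x1 + 0 / INR n * (x - x1)) with x1 by (field; lra).
      replace (y1 + 0 / INR n * (y - y1)) with y1 by (field; lra). lra.
    - specialize (IH ltac:(lia)). rewrite S_INR.
      replace (f (p (S j)) (q (S j))) with (f (p j) (q j) + (f (p (S j)) (q (S j)) - f (p j) (q j))) by ring.
      eapply Rle_trans; [apply Rabs_triang|].
      assert (Rabs (f (p (S j)) (q (S j)) - f (p j) (q j)) < 1); [|lra].
      assert (R1 := Hr j ltac:(lia)). assert (R2 := Hr (S j) Hj).
      apply Hdl; unfold p, q; try nra.
      + replace (x1 + INR (S j) / INR n * (x - x1) - (x1 + INR j / INR n * (x - x1))) with ((x - x1) * / INR n)
          by (rewrite S_INR; field; lra).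
        rewrite Rabs_right; [|apply Rle_ge, Rmult_le_pos; [lra|left; apply Rinv_0_lt_compat; assumption]].
        apply Rmult_lt_reg_r with (INR n); [assumption|]. rewrite Rmult_assoc, Rinv_l by lra. lra.
      + replace (y1 + INR (S j) / INR n * (y - y1) - (y1 + INR j / INR n * (y - y1))) with ((y - y1) * / INR n)
          by (rewrite S_INR; field; lra).
        rewrite Rabs_right; [|apply Rle_ge, Rmult_le_pos; [lra|left; apply Rinv_0_lt_compat; assumption]].
        apply Rmult_lt_reg_r with (INR n); [assumption|]. rewrite Rmult_assoc, Rinv_l by lra. lra. }
  specialize (Hind n (le_n n)). unfold p, q in Hind.
  replace (x1 + INR n / INR n * (x - x1)) with x in Hind by (field; lra).
  replace (y1 + INR n / INR n * (y - y1)) with y in Hind by (field; lra). exact Hind.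
Qed.

Lemma bounded_C_on_rect (F : C -> C) x1 x2 y1 y2 :
  (forall x y, x1 <= x <= x2 -> y1 <= y <= y2 -> cont_C F (x, y)) ->
  exists K, 0 <= K /\ forall x y, x1 <= x <= x2 -> y1 <= y <= y2 -> Cmod (F (x, y)) <= K.
Proof.
  intros HF.
  destruct (bounded_on_rect (fun x y => Re (F (x, y))) x1 x2 y1 y2) as [K1 H1]; [intros; apply HF; assumption|].
  destruct (bounded_on_rect (fun x y => Im (F (x, y))) x1 x2 y1 y2) as [K2 H2]; [intros; apply HF; assumption|].
  exists (Rmax 0 (K1 + K2)). split; [apply Rmax_l|]. intros x y Hx Hy.
  eapply Rle_trans; [apply Cmod_le_Rabs|]. eapply Rle_trans; [|apply Rmax_r].
  apply Rplus_le_compat; auto.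
Qed.

Lemma CRInt_support (h : R -> C) a b c d : a <= c -> c <= d -> d <= b ->
  (forall x, a < x < c \/ d < x < b -> h x = 0%C) -> ex_CRInt h c d ->
  ex_CRInt h a b /\ CRInt h a b = CRInt h c d.
Proof.
  intros H1 H2 H3 H0 He.
  destruct (CRInt_zero h a c H1) as [Ha Za]; [auto|]. destruct (CRInt_zero h d b H3) as [Hb Zb]; [auto|].
  assert (Hac : ex_CRInt h a d) by (eapply ex_CRInt_cat; eassumption).
  split; [eapply ex_CRInt_cat; eassumption|].
  rewrite (CRInt_cat h a d b), (CRInt_cat h a c d) by assumption. rewrite Za, Zb. ring.
Qed.

Lemma test_R_Derive_n_out c d u k x : test_R c d u -> x < c \/ d < x -> Derive_n u k x = 0.
Proof.
  intros [_ Hu] Hx.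
  assert (HL : locally x (fun t => (fun _ => 0) t = u t)).
  { destruct Hx as [Hx|Hx].
    - apply locally_R with (c - x); [lra|]. intros y Hy. apply Rabs_def2 in Hy. symmetry; apply Hu; lra.
    - apply locally_R with (x - d); [lra|]. intros y Hy. apply Rabs_def2 in Hy. symmetry; apply Hu; lra. }
  rewrite <- (Derive_n_ext_loc _ _ k x HL). destruct k; [reflexivity|]. apply Derive_n_const.
Qed.

Lemma test_R_test_function (a b : R) c d u : a < c -> d < b -> test_R c d u ->
  test_function a b (fun x => RtoC (u x)).
Proof.
  intros Ha Hb [H1 H2]. split.
  - apply smooth_iff. split; [exact H1|exact (smooth_R_const 0)].
  - exists c, d. repeat split; trivial. intros x Hx. rewrite H2 by assumption. reflexivity.
Qed.

Lemma cont_C_of_R (u : R -> R) x y : continuous u x -> cont_C (fun w => RtoC (u (Re w))) (x, y).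
Proof. intros Hu. apply (cont_C_Re (fun w => w) (x, y)); [exact Hu|apply cont_C_id]. Qed.

Lemma ball_C_Cmod (l z : C) (e : posreal) : Cmod (z - l) < e -> ball l e z.
Proof.
  intros He. split; unfold ball; simpl; unfold AbsRing_ball, abs, minus, plus, opp; simpl.
  - eapply Rle_lt_trans; [apply (re_le_Cmod (z - l))|exact He].
  - eapply Rle_lt_trans; [apply (im_le_Cmod (z - l))|exact He].
Qed.

Lemma Cmod_ball_C (l z : C) (e : posreal) : ball l e z -> Cmod (z - l) < 2 * e.
Proof.
  intros [H1 H2]. unfold ball in H1, H2; simpl in H1, H2. unfold AbsRing_ball, abs, minus, plus, opp in H1, H2; simpl in H1, H2.
  eapply Rle_lt_trans; [apply Cmod_le_Rabs|]. unfold Re, Im; simpl. lra.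
Qed.

Lemma filterlim_C_eps {T : Type} (F : (T -> Prop) -> Prop) {FF : Filter F} (g : T -> C) (l : C) :
  filterlim g F (locally l) <-> forall e, 0 < e -> F (fun t => Cmod (g t - l) < e).
Proof.
  split.
  - intros HH e He. assert (He2 : 0 < e / 2) by lra.
    specialize (HH (ball l (mkposreal _ He2)) (locally_ball _ _)). unfold filtermap in HH.
    revert HH. apply filter_imp. intros t Ht. apply Cmod_ball_C in Ht. simpl in Ht. lra.
  - intros HH P [e He]. unfold filtermap. generalize (HH e (cond_pos e)). apply filter_imp.
    intros t Ht. apply He, ball_C_Cmod, Ht.
Qed.

Lemma at_right_0 (P : R -> Prop) : at_right 0 P <-> exists d, 0 < d /\ forall y, 0 < y < d -> P y.
Proof.
  split.
  - intros [d Hd]. exists d. split; [apply cond_pos|]. intros y Hy. apply Hd; [|lra].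
    unfold ball; simpl; unfold AbsRing_ball, abs, minus, plus, opp; simpl. rewrite Rabs_right; lra.
  - intros (d & Hd & HP). exists (mkposreal d Hd). intros y Hy H0. apply HP.
    unfold ball in Hy; simpl in Hy; unfold AbsRing_ball, abs, minus, plus, opp in Hy; simpl in Hy.
    apply Rabs_def2 in Hy. lra.
Qed.

Lemma filterlim_at_right_0 (g : R -> C) (l : C) :
  filterlim g (at_right 0) (locally l) <->
  forall e, 0 < e -> exists d, 0 < d /\ forall y, 0 < y < d -> Cmod (g y - l) < e.
Proof.
  rewrite (filterlim_C_eps (at_right 0) g l). split; intros HH e He; apply at_right_0, HH, He.
Qed.

Section Slices.
Variables (a b r : R) (F : C -> C) (f : (R -> C) -> C).
Hypothesis HF : analytic_on_rect a b r F.
Hypothesis Hf : boundary_value a b F f.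

Lemma analytic_diff x y : a < x < b -> 0 < y < r -> exists l, diff_C F (x, y) l (Ci * l).
Proof.
  intros Hx Hy. destruct (HF (x, y) Hx Hy) as [l Hl]. exists l. apply diff_C_complex. exact Hl.
Qed.

Lemma analytic_cont : rect_cont a b 0 r F.
Proof. intros x y Hx Hy. destruct (analytic_diff x y Hx Hy) as [l Hl]. exact (diff_C_cont _ _ _ _ Hl). Qed.

(** The functional [f] is the limit of the slices at the heights [y] tending to 0. *)
Definition slice (y : R) (u : R -> R) : C := CRInt (fun x => F (x, y) * RtoC (u x))%C a b.

Lemma slice_ex c d y u : a < c -> c <= d -> d < b -> 0 < y < r -> test_R c d u ->
  ex_CRInt (fun x => F (x, y) * RtoC (u x))%C c d /\
  ex_CRInt (fun x => F (x, y) * RtoC (u x))%C a b /\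
  slice y u = CRInt (fun x => F (x, y) * RtoC (u x))%C c d.
Proof.
  intros Ha Hcd Hb Hy [Hu1 Hu2].
  assert (E : ex_CRInt (fun x => F (x, y) * RtoC (u x))%C c d).
  { apply (ex_CRInt_hor (fun w => F w * RtoC (u (Re w)))%C); [assumption|].
    intros x Hx. apply cont_C_mult; [apply analytic_cont; lra|].
    apply cont_C_of_R, smooth_R_continuous, Hu1. }
  split; [exact E|]. apply CRInt_support; try lra; trivial.
  intros x Hx. rewrite Hu2 by lra. apply Cmult_0_r.
Qed.

Lemma slice_bound c d y u K m : a < c -> c <= d -> d < b -> 0 < y < r -> test_R c d u -> 0 <= K -> 
  (forall x, c <= x <= d -> Cmod (F (x, y)) <= K) -> (forall x, Rabs (u x) <= m) ->
  Cmod (slice y u) <= 2 * (d - c) * (K * m).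
Proof.
  intros Ha Hcd Hb Hy Hu HK0 HK Hm. destruct (slice_ex c d y u) as (E1 & E2 & ->); trivial.
  apply CRInt_bound; trivial. intros x Hx. rewrite Cmod_mult, Cmod_R.
  apply Rmult_le_compat; try apply Cmod_ge_0; try apply Rabs_pos; auto. apply HK; lra.
Qed.

(** The slices converge at each test function as [y] tends to 0, so they are bounded there; the
    uniform boundedness principle gives one seminorm for all of them.  This is the only control of
    [F] near the real axis away from [x0]. *)
Theorem slices_equicontinuous c d Y : a < c -> c < d -> d < b -> 0 < Y < r ->
  exists N K, 0 <= K /\ forall y u m, 0 < y <= Y -> test_R c d u ->
    (forall k x, (k <= N)%nat -> c <= x <= d -> Rabs (Derive_n u k x) <= m) -> Cmod (slice y u) <= K * m.
Proof.
  intros Ha Hcd Hb HY.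
  set (I := { y : R | 0 < y <= Y }).
  destruct (uniform_boundedness (fun y : I => slice (proj1_sig y)) c d) as (N & K & HK & HH).
  - intros [y Hy] u v Hu Hv; simpl.
    destruct (slice_ex c d y u) as (_ & E1 & _); trivial; try lra.
    destruct (slice_ex c d y v) as (_ & E2 & _); trivial; try lra.
    unfold slice. rewrite <- CRInt_plus by assumption. apply CRInt_ext; [lra|].
    intros x _. rewrite RtoC_plus. ring.
  - intros [y Hy] k u Hu; simpl.
    destruct (slice_ex c d y u) as (_ & E1 & _); trivial; try lra.
    unfold slice. rewrite <- CRInt_scal by assumption. apply CRInt_ext; [lra|].
    intros x _. rewrite RtoC_mult. ring.
  - intros [y Hy]; simpl.
    destruct (bounded_C_on_rect F c d y y) as (K & HK0 & HK).
    { intros x y' Hx Hy'. apply analytic_cont; lra. }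
    exists (2 * (d - c) * K). intros u m Hu Hm. rewrite Rmult_assoc.
    apply slice_bound; trivial; try lra. intros x Hx. apply HK; lra.
  - intros u Hu.
    assert (Htf : test_function a b (fun x => RtoC (u x))) by (apply (test_R_test_function a b c d); assumption).
    assert (HL : exists y0, 0 < y0 /\ forall y, 0 < y < y0 -> Cmod (slice y u) <= Cmod (f (fun x => RtoC (u x))) + 2).
    { destruct (proj1 (filterlim_at_right_0 _ _) (Hf _ Htf) 2 ltac:(lra)) as (y0 & Hy0 & HB).
      exists y0. split; [assumption|]. intros y Hy. specialize (HB y Hy).
      assert (HT := Cmod_triangle (f (fun x => RtoC (u x))) (slice y u - f (fun x => RtoC (u x)))).
      replace (f (fun x => RtoC (u x)) + (slice y u - f (fun x => RtoC (u x))))%C with (slice y u) in HT by ring.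
      unfold slice at 2 in HT. lra. }
    destruct HL as (y0 & Hy0 & HL).
    destruct (bounded_C_on_rect F c d (Rmin y0 Y) Y) as (K & HK0 & HK).
    { intros x y Hx Hy. apply analytic_cont; [lra|].
      assert (0 < Rmin y0 Y) by (apply Rmin_pos; lra). lra. }
    destruct (bounded_on_segment u c d) as [m Hm].
    { intros; apply smooth_R_continuous, Hu. }
    assert (Hm' : forall x, Rabs (u x) <= Rmax 0 m).
    { intros x. destruct (classic (c <= x <= d)) as [Hx|Hx].
      - eapply Rle_trans; [apply Hm, Hx|apply Rmax_r].
      - rewrite (proj2 Hu) by lra. rewrite Rabs_R0. apply Rmax_l. }
    exists (Rmax (Cmod (f (fun x => RtoC (u x))) + 2) (2 * (d - c) * (K * Rmax 0 m))).
    intros [y Hy]; simpl. destruct (Rlt_le_dec y y0) as [Hlt|Hge].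
    + eapply Rle_trans; [apply HL; lra|apply Rmax_l].
    + eapply Rle_trans; [|apply Rmax_r]. apply slice_bound; trivial; try lra.
      intros x Hx. apply HK; [assumption|]. split; [|lra]. eapply Rle_trans; [apply Rmin_l|]; lra.
  - exists N, K. split; [assumption|]. intros y u m Hy Hu Hk.
    apply (HH (exist _ y Hy) u m Hu). intros k x Hkn.
    destruct (classic (c <= x <= d)) as [Hx|Hx]; [apply Hk; assumption|].
    rewrite (test_R_Derive_n_out c d u k x Hu) by lra. rewrite Rabs_R0.
    eapply Rle_trans; [apply Rabs_pos|apply (Hk k c Hkn)]. lra.
Qed.
End Slices.

(** * Integrability of a bounded function with one discontinuity *)

Lemma ex_RInt_sandwich (f : R -> R) a b : a <= b ->
  (forall e, 0 < e -> exists g q, ex_RInt g a b /\ ex_RInt q a b /\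
     (forall x, a <= x <= b -> Rabs (f x - g x) <= q x) /\ RInt q a b < e) ->
  ex_RInt f a b.
Proof.
  intros Hab HE.
  assert (HC : exists l, filterlim (fun ptd => Riemann_sum f ptd : R) (Riemann_fine a b) (locally l)).
  { apply (filterlim_locally_cauchy (U := R_CompleteSpace)). intros e.
    assert (He : 0 < e / 6) by (generalize (cond_pos e); lra).
    destruct (HE _ He) as (g & q & [Ig Hg] & Hq & Hfg & Hqe).
    destruct (RInt_correct q a b Hq (ball (RInt q a b) (mkposreal _ He)) (locally_ball _ _)) as [d1 Hd1].
    destruct (Hg (ball Ig (mkposreal _ He)) (locally_ball _ _)) as [d2 Hd2].
    exists (fun ptd => (pointed_subdiv ptd /\ SF_h ptd = Rmin a b /\ seq.last (SF_h ptd) (SF_lx ptd) = Rmax a b) /\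
      (b = a \/ (Rabs (Riemann_sum q ptd - RInt q a b) < e / 6 /\ Rabs (Riemann_sum g ptd - Ig) < e / 6))).
    split.
    - exists (mkposreal _ (Rmin_pos _ _ (cond_pos d1) (cond_pos d2))). intros ptd Hs Hp. split; [exact Hp|].
      destruct (Req_dec b a) as [|Hne]; [left; assumption|right].
      assert (Hsg : sign (b - a) = 1) by (apply sign_eq_1; lra). simpl in Hs.
      split.
      + generalize (Hd1 ptd (Rlt_le_trans _ _ _ Hs (Rmin_l _ _)) Hp). rewrite Hsg.
        unfold ball; simpl; unfold AbsRing_ball, abs, minus, plus, opp, scal, mult; simpl; unfold mult; simpl.
        rewrite Rmult_1_l. trivial.
      + generalize (Hd2 ptd (Rlt_le_trans _ _ _ Hs (Rmin_r _ _)) Hp). rewrite Hsg.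
        unfold ball; simpl; unfold AbsRing_ball, abs, minus, plus, opp, scal, mult; simpl; unfold mult; simpl.
        rewrite Rmult_1_l. trivial.
    - assert (Hz : forall ptd, pointed_subdiv ptd -> SF_h ptd = Rmin a b -> seq.last (SF_h ptd) (SF_lx ptd) = Rmax a b ->
        Rabs (Riemann_sum f ptd - Riemann_sum g ptd) <= Riemann_sum q ptd).
      { intros ptd H1 H2 H3.
        assert (E := Riemann_sum_minus (V := R_ModuleSpace) f g ptd).
        change (Rabs (minus (Riemann_sum (V := R_ModuleSpace) f ptd) (Riemann_sum (V := R_ModuleSpace) g ptd)) <= Riemann_sum q ptd).
        rewrite <- E. apply (Riemann_sum_norm (V := R_NormedModule)); [assumption|].
        rewrite H3, H2, Rmin_left, Rmax_right by assumption. exact Hfg. }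
      intros u v ((U1 & U2 & U3) & HU) ((V1 & V2 & V3) & HV).
      unfold ball; simpl; unfold AbsRing_ball, abs, minus, plus, opp; simpl.
      destruct (Req_dec b a) as [Heq|Hne].
      + assert (Z : forall ptd, pointed_subdiv ptd -> SF_h ptd = Rmin a b -> seq.last (SF_h ptd) (SF_lx ptd) = Rmax a b ->
          Riemann_sum f ptd = 0).
        { intros ptd H1 H2 H3. apply (Riemann_sum_zero (V := R_ModuleSpace)).
          - apply ptd_sort; assumption.
          - rewrite H3, H2, Heq, Rmin_left, Rmax_left; lra. }
        rewrite (Z u), (Z v) by assumption. rewrite Ropp_0, Rplus_0_l, Rabs_R0. apply cond_pos.
      + destruct HU as [|[HU1 HU2]]; [lra|]. destruct HV as [|[HV1 HV2]]; [lra|].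
        assert (Zu := Hz u U1 U2 U3). assert (Zv := Hz v V1 V2 V3).
        apply Rabs_def2 in HU1, HU2, HV1, HV2. apply Rabs_le_between in Zu, Zv.
        apply Rabs_def1; lra. }
  destruct HC as [l Hl].
  destruct (Req_dec b a) as [->|Hne]; [apply ex_RInt_point|].
  exists l. unfold is_RInt. replace (sign (b - a)) with 1 by (symmetry; apply sign_eq_1; lra).
  intros P HP. destruct (Hl P HP) as [d Hd]. exists d. intros ptd Hs Hp.
  assert (HPt := Hd ptd Hs Hp).
  match goal with |- P ?z => replace z with (Riemann_sum (V := R_ModuleSpace) f ptd) end; [exact HPt|].
  symmetry. exact (Rmult_1_l _).
Qed.

(** Near the exceptional point the function is cut off; this costs at most the bound [M] times the
    integral of the cutoff, which is as small as wanted. *)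
Lemma ex_RInt_except_point (f : R -> R) a b c M : a < c < b ->
  (forall x, a <= x <= b -> Rabs (f x) <= M) ->
  (forall x, a <= x <= b -> x <> c -> continuous f x) -> ex_RInt f a b.
Proof.
  intros Hc HM Hf. apply ex_RInt_sandwich; [lra|]. intros e He.
  assert (HM0 : 0 <= M) by (eapply Rle_trans; [apply Rabs_pos|apply (HM c); lra]).
  set (h := Rmin (Rmin ((c - a) / 2) ((b - c) / 2)) (e / (4 * M + 1) / 2)).
  assert (H0 : 0 < e / (4 * M + 1) / 2) by (unfold Rdiv; repeat apply Rmult_lt_0_compat; try apply Rinv_0_lt_compat; lra).
  assert (Hh : 0 < h) by (repeat apply Rmin_pos; lra).
  assert (h1 : h <= (c - a) / 2) by (eapply Rle_trans; [apply Rmin_l|apply Rmin_l]).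
  assert (h2 : h <= (b - c) / 2) by (eapply Rle_trans; [apply Rmin_l|apply Rmin_r]).
  assert (h3 : h <= e / (4 * M + 1) / 2) by apply Rmin_r.
  destruct (smooth_cutoff c h Hh) as (chi & Hs & H1 & H2 & H3).
  assert (Hq : forall u v, ex_RInt (fun x => M * chi x) u v).
  { intros. apply (ex_RInt_continuous (V := R_CompleteNormedModule)). intros z _. apply smooth_R_continuous, smooth_R_mult; [apply smooth_R_const|assumption]. }
  exists (fun x => f x * (1 - chi x)), (fun x => M * chi x). repeat split.
  - apply ex_RInt_cont; [lra|]. intros x Hx. destruct (Req_dec x c) as [->|Hne].
    + apply continuous_ext_loc with (fun _ => 0); [|apply continuous_const].
      apply locally_R with h; [assumption|]. intros y Hy. change (0 = f y * (1 - chi y)). rewrite H1 by lra. ring.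
    + apply (continuous_mult (K := R_AbsRing)); [apply Hf; assumption|].
      apply smooth_R_continuous, smooth_R_minus; [apply smooth_R_const|assumption].
  - apply Hq.
  - intros x Hx. replace (f x - f x * (1 - chi x)) with (f x * chi x) by ring.
    rewrite Rabs_mult, (Rabs_right (chi x)) by (apply Rle_ge, H3).
    apply Rmult_le_compat_r; [apply H3|]. apply HM; assumption.
  - rewrite (RInt_cat _ a (c - 2 * h) b), (RInt_cat _ (c - 2 * h) (c + 2 * h) b) by apply Hq.
    rewrite (RInt_ext _ (fun _ => 0) a).
    2:{ rewrite Rmin_left, Rmax_right by lra. intros x Hx. change (M * chi x = 0). rewrite H2; [ring|]. rewrite Rabs_left1; lra. }
    rewrite (RInt_ext _ (fun _ => 0) (c + 2 * h)).
    2:{ rewrite Rmin_left, Rmax_right by lra. intros x Hx. change (M * chi x = 0). rewrite H2; [ring|]. rewrite Rabs_right; lra. }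
    rewrite !RInt_const. unfold scal; simpl; unfold mult; simpl.
    assert (E : Rabs (RInt (fun x => M * chi x) (c - 2 * h) (c + 2 * h)) <= (c + 2 * h - (c - 2 * h)) * M).
    { apply abs_RInt_le_const; [lra|apply Hq|]. intros t _. rewrite Rabs_mult, !Rabs_right; try (apply Rle_ge; trivial; apply H3).
      rewrite <- (Rmult_1_r M) at 2. apply Rmult_le_compat_l; [assumption|apply H3]. }
    assert (E2 := Rle_abs (RInt (fun x => M * chi x) (c - 2 * h) (c + 2 * h))).
    assert (4 * h * M < e); [|lra].
    assert (h * (4 * M + 1) <= e / 2).
    { replace (e / 2) with (e / (4 * M + 1) / 2 * (4 * M + 1)) by (field; lra). apply Rmult_le_compat_r; lra. }
    lra.
Qed.

(** * The Euler operator and the Poisson kernel *)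

(** Up to the factor [zy / PI] this is the Poisson kernel of the point [zx + i zy]. *)
Definition pker (zx zy x : R) : R := / ((x - zx) ^ 2 + zy ^ 2).

Lemma pker_den_pos zx zy x : 0 < zy -> 0 < (x - zx) ^ 2 + zy ^ 2.
Proof. intros Hz. generalize (pow2_ge_0 (x - zx)) (pow2_gt_0 zy ltac:(lra)); lra. Qed.

Lemma pker_pos zx zy x : 0 < zy -> 0 < pker zx zy x.
Proof. intros Hz. apply Rinv_0_lt_compat, pker_den_pos, Hz. Qed.

Lemma smooth_R_sub_sq zx : smooth_R (fun x => (x - zx) ^ 2).
Proof.
  assert (H1 : smooth_R (fun x => x - zx)) by (apply smooth_R_minus; [apply smooth_R_id|apply smooth_R_const]).
  apply smooth_R_ext with (fun x => (x - zx) * (x - zx)); [intros; ring|]. apply smooth_R_mult; assumption.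
Qed.

Lemma smooth_R_pker zx zy : 0 < zy -> smooth_R (pker zx zy).
Proof.
  intros Hz. apply smooth_R_inv.
  - apply smooth_R_plus; [apply smooth_R_sub_sq|apply smooth_R_const].
  - intros x. apply Rgt_not_eq, pker_den_pos, Hz.
Qed.

Lemma pker_derive zx zy x : 0 < zy -> is_derive (pker zx zy) x (- (2 * (x - zx) * pker zx zy x * pker zx zy x)).
Proof.
  intros Hz. assert (Hd := pker_den_pos zx zy x Hz). unfold pker.
  auto_derive; [simpl in Hd; lra|]. simpl in Hd. simpl. field. lra.
Qed.

Lemma pker_integral zx zy u v : 0 < zy -> u <= v -> zy * RInt (pker zx zy) u v <= PI.
Proof.
  intros Hz Huv.
  assert (E : is_RInt (pker zx zy) u v (minus ((fun x => / zy * atan ((x - zx) / zy)) v) ((fun x => / zy * atan ((x - zx) / zy)) u))).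
  { apply (is_RInt_derive (fun x => / zy * atan ((x - zx) / zy)) (pker zx zy)).
    - intros x _. assert (Hd := pker_den_pos zx zy x Hz). unfold pker. auto_derive; [trivial|].
      apply Rgt_not_eq in Hd. field. repeat split; try lra; intro E0; apply Hd; rewrite <- E0; ring.
    - intros x _. apply smooth_R_continuous, smooth_R_pker, Hz. }
  rewrite (is_RInt_unique (V := R_CompleteNormedModule) _ _ _ _ E). unfold minus, plus, opp; simpl.
  generalize (atan_bound ((v - zx) / zy)) (atan_bound ((u - zx) / zy)). intros A1 A2.
  replace (zy * (/ zy * atan ((v - zx) / zy) + - (/ zy * atan ((u - zx) / zy)))) with
    (atan ((v - zx) / zy) - atan ((u - zx) / zy)) by (field; lra). lra.
Qed.

(** The transpose of [partial_at x0], up to sign. *)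
Definition euler (x0 : R) (u : R -> R) : R -> R := fun x => (x - x0) * Derive u x.

(** The index type of the family of Poisson kernels. *)
Definition half_plane : Type := { z : R * R | 0 < snd z }.
Definition zre (z : half_plane) : R := fst (proj1_sig z).
Definition zim (z : half_plane) : R := snd (proj1_sig z).

Lemma zim_pos z : 0 < zim z.
Proof. exact (proj2_sig z). Qed.

Section Euler.
Variable x0 : R.
Variables c d : R.
Let X := fun x => c <= x <= d.

(** The sine of the angle at [x0] between the real axis and [z]. *)
Definition sine (z : half_plane) : R := zim z / sqrt ((zre z - x0) ^ 2 + zim z ^ 2).

Lemma sine_den z : 0 < (zre z - x0) ^ 2 + zim z ^ 2.
Proof. generalize (pow2_ge_0 (zre z - x0)) (pow2_gt_0 (zim z) (Rgt_not_eq _ _ (zim_pos z))); lra. Qed.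

Lemma sine_pos z : 0 < sine z.
Proof. apply Rdiv_lt_0_compat; [apply zim_pos|apply sqrt_lt_R0, sine_den]. Qed.

Lemma sine_sq z : sine z ^ 2 * ((zre z - x0) ^ 2 + zim z ^ 2) = zim z ^ 2.
Proof.
  unfold sine, Rdiv. rewrite Rpow_mult_distr, pow_inv, pow2_sqrt by (left; apply sine_den).
  field. apply Rgt_not_eq, sine_den.
Qed.

Lemma sine_le_1 z : sine z <= 1.
Proof.
  assert (H1 := sine_sq z). assert (H2 := sine_pos z). assert (H3 := sine_den z).
  assert (H4 := pow2_ge_0 (zre z - x0)).
  destruct (Rle_lt_dec (sine z) 1) as [|Hlt]; [assumption|exfalso].
  assert (1 < sine z ^ 2) by nra. nra.
Qed.

(** The distance from [x] to the line through [x0] and [z] is [sine z] times [|x - x0|]. *)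
Lemma sine_dist z x : sine z ^ 2 * (x - x0) ^ 2 <= (x - zre z) ^ 2 + zim z ^ 2.
Proof.
  assert (H1 := sine_sq z). assert (H3 := sine_den z).
  apply Rmult_le_reg_r with ((zre z - x0) ^ 2 + zim z ^ 2); [assumption|].
  replace (sine z ^ 2 * (x - x0) ^ 2 * ((zre z - x0) ^ 2 + zim z ^ 2))
    with ((sine z ^ 2 * ((zre z - x0) ^ 2 + zim z ^ 2)) * (x - x0) ^ 2) by ring.
  rewrite H1.
  assert (E : ((x - zre z) ^ 2 + zim z ^ 2) * ((zre z - x0) ^ 2 + zim z ^ 2) =
    zim z ^ 2 * (x - x0) ^ 2 + ((zre z - x0) * (x - zre z) - zim z ^ 2) ^ 2) by ring.
  rewrite E. generalize (pow2_ge_0 ((zre z - x0) * (x - zre z) - zim z ^ 2)). lra.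
Qed.

(** With [mE d/dx] written as D, the kernel satisfies [D kE = - tE kE], and [D tE], [D sE] are
    polynomials in [sine], [tE] and [sE]; all three are bounded by 2 on the whole half-plane. *)
Definition mE (z : half_plane) (x : R) : R := sine z * (x - x0).
Definition kE (z : half_plane) (x : R) : R := pker (zre z) (zim z) x.
Definition tE (z : half_plane) (x : R) : R := 2 * sine z * (x - x0) * (x - zre z) * kE z x.
Definition sE (z : half_plane) (x : R) : R := 2 * sine z ^ 2 * (x - x0) ^ 2 * kE z x.

Lemma mul_kE_le_2 z x q : 0 <= q -> q <= 2 * ((x - zre z) ^ 2 + zim z ^ 2) -> q * kE z x <= 2.
Proof.
  intros H0 Hq. assert (Hd := pker_den_pos (zre z) (zim z) x (zim_pos z)). unfold kE, pker.
  apply Rmult_le_reg_r with ((x - zre z) ^ 2 + zim z ^ 2); [assumption|].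
  rewrite Rmult_assoc, Rinv_l; lra.
Qed.

Lemma sE_bound z x : Rabs (sE z x) <= 2.
Proof.
  assert (Hp := pker_pos (zre z) (zim z) x (zim_pos z)).
  assert (H0 : 0 <= 2 * sine z ^ 2 * (x - x0) ^ 2).
  { generalize (pow2_ge_0 (sine z)) (pow2_ge_0 (x - x0)). intros. apply Rmult_le_pos; lra. }
  unfold sE. rewrite Rabs_right by (apply Rle_ge, Rmult_le_pos; [assumption|left; exact Hp]).
  apply mul_kE_le_2; [assumption|]. generalize (sine_dist z x). lra.
Qed.

Lemma tE_bound z x : Rabs (tE z x) <= 2.
Proof.
  assert (Hp := pker_pos (zre z) (zim z) x (zim_pos z)).
  unfold tE. rewrite Rabs_mult, (Rabs_right (kE z x)) by (left; exact Hp).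
  apply mul_kE_le_2; [apply Rabs_pos|].
  assert (H1 := sine_dist z x). assert (H2 := pow2_ge_0 (zim z)).
  apply Rabs_le. split.
  - generalize (pow2_ge_0 (sine z * (x - x0) + (x - zre z))). nra.
  - generalize (pow2_ge_0 (sine z * (x - x0) - (x - zre z))). nra.
Qed.

Lemma sine_family_bounded : exists K, forall z, Rabs (sine z) <= K.
Proof. exists 1. intros z. rewrite Rabs_right by (left; apply sine_pos). apply sine_le_1. Qed.

Lemma ubd_tE_sE k : ubd X mE k tE /\ ubd X mE k sE.
Proof.
  induction k as [|k [IHt IHs]].
  - split; split; trivial; exists 2; intros; [apply tE_bound|apply sE_bound].
  - assert (Hs : ubd X mE k (fun z _ => sine z)) by (apply ubd_const, sine_family_bounded).
    split.
    + apply ubd_step with (fun z x => 2 * sine z * ((x - x0) + (x - zre z)) * kE z x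
        + 2 * sine z * (x - x0) * (x - zre z) * (- (2 * (x - zre z) * kE z x * kE z x))).
      * exists 2; intros; apply tE_bound.
      * intros z x. apply (is_derive_mult (K := R_AbsRing) (fun x => 2 * sine z * (x - x0) * (x - zre z)) (kE z)).
        -- auto_derive; trivial. ring.
        -- apply pker_derive, zim_pos.
        -- intros; apply Rmult_comm.
      * apply ubd_ext with (fun z x => (sine z * tE z x + sE z x) + - (tE z x * tE z x)).
        -- intros z x. unfold mE, tE, sE. ring.
        -- apply ubd_plus; [apply ubd_plus; [apply ubd_mult|]|apply ubd_opp, ubd_mult]; assumption.
    + apply ubd_step with (fun z x => 4 * sine z ^ 2 * (x - x0) * kE z x
        + 2 * sine z ^ 2 * (x - x0) ^ 2 * (- (2 * (x - zre z) * kE z x * kE z x))).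
      * exists 2; intros; apply sE_bound.
      * intros z x. apply (is_derive_mult (K := R_AbsRing) (fun x => 2 * sine z ^ 2 * (x - x0) ^ 2) (kE z)).
        -- auto_derive; trivial. simpl. ring.
        -- apply pker_derive, zim_pos.
        -- intros; apply Rmult_comm.
      * apply ubd_ext with (fun z x => ((fun (_ : half_plane) (_ : R) => 2) z x * (sine z * sE z x)) + - (tE z x * sE z x)).
        -- intros z x. unfold mE, tE, sE. simpl. ring.
        -- apply ubd_plus; [apply ubd_mult; [|apply ubd_mult]|apply ubd_opp, ubd_mult]; try assumption.
           apply ubd_const. exists 2. intros _. rewrite Rabs_right; lra.
Qed.

(** The Euler operator commutes with dilations about [x0], so its powers cost only powers of
    [1 / sine z] and not of [1 / zim z]: the integral of the result stays under control however
    close [z] is to [x0]. *)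
Lemma euler_bound n (chi : R -> R) : smooth_R chi ->
  exists K, 0 <= K /\ forall z x, X x ->
    Rabs (sine z ^ n * Nat.iter n (euler x0) (fun x => chi x * kE z x) x) <= K * kE z x.
Proof.
  intros Hchi.
  assert (Hm : forall k, ubd X (fun (_ : half_plane) _ => 1) k mE).
  { intros k. apply ubd_mult; [apply ubd_const, sine_family_bounded|].
    apply (smooth_R_ubd c d k (fun x => x - x0)). apply smooth_R_minus; [apply smooth_R_id|apply smooth_R_const]. }
  assert (HC : exists g : half_plane -> R -> R, (forall k, ubd X mE k g) /\
     forall z x, sine z ^ n * Nat.iter n (euler x0) (fun x => chi x * kE z x) x = g z x * kE z x).
  { clear - Hchi Hm. induction n as [|n (g & Hg & HE)].
    - exists (fun _ => chi). split; [|intros; simpl; ring].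
      intros k. apply ubd_change; [exact Hm|]. apply smooth_R_ubd, Hchi.
    - exists (fun z x => mE z x * Derive (g z) x + - (tE z x * g z x)). split.
      + intros k. apply ubd_plus; [apply (Hg (S k))|]. apply ubd_opp, ubd_mult; [apply ubd_tE_sE|apply Hg].
      + intros z x. simpl Nat.iter. unfold euler at 1.
        set (w := Nat.iter n (euler x0) (fun x1 => chi x1 * kE z x1)) in *.
        replace (sine z ^ S n * ((x - x0) * Derive w x)) with (mE z x * (sine z ^ n * Derive w x)) by (unfold mE; simpl; ring).
        rewrite <- Derive_scal.
        rewrite (Derive_ext _ (fun x => g z x * kE z x)) by (intros; apply HE).
        rewrite (is_derive_unique _ x (Derive (g z) x * kE z x + g z x * (- (2 * (x - zre z) * kE z x * kE z x)))).
        * unfold mE, tE. ring.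
        * apply (is_derive_mult (K := R_AbsRing) (g z) (kE z)).
          -- apply (ubd_derive X mE 0 g z x (Hg 1%nat)).
          -- apply pker_derive, zim_pos.
          -- intros; apply Rmult_comm. }
  destruct HC as (g & Hg & HE).
  destruct (ubd_bound X mE 0 g (Hg 0%nat)) as (K & HK & HB).
  exists K. split; [assumption|]. intros z x Hx. rewrite HE, Rabs_mult.
  assert (Hp := pker_pos (zre z) (zim z) x (zim_pos z)).
  rewrite (Rabs_right (kE z x)) by (left; exact Hp).
  apply Rmult_le_compat_r; [left; exact Hp|]. apply HB, Hx.
Qed.
End Euler.

Lemma smooth_R_euler_iter x0 n u : smooth_R u -> smooth_R (Nat.iter n (euler x0) u).
Proof.
  intros Hu. induction n as [|n IH]; [assumption|]. simpl. apply smooth_R_mult.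
  - apply smooth_R_minus; [apply smooth_R_id|apply smooth_R_const].
  - apply smooth_R_Derive, IH.
Qed.

Lemma test_R_euler_iter c d x0 n u : test_R c d u -> test_R c d (Nat.iter n (euler x0) u).
Proof.
  intros Hu. induction n as [|n IH]; [assumption|]. split; [apply (smooth_R_euler_iter x0 (S n)), Hu|].
  intros x Hx. rewrite Nat.iter_succ. unfold euler at 1.
  assert (E : Derive (Nat.iter n (euler x0) u) x = 0) by exact (test_R_Derive_n_out c d _ 1 x IH Hx).
  rewrite E. apply Rmult_0_r.
Qed.

Lemma partial_iter x0 n : forall (T : (R -> C) -> C) (u : R -> R),
  Cmod (Nat.iter n (partial_at x0) T (fun x => RtoC (u x))) =
  Cmod (T (fun x => RtoC (Nat.iter n (euler x0) u x))).
Proof.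
  induction n as [|n IH]; intros T u; [reflexivity|].
  rewrite Nat.iter_succ. unfold partial_at at 1, dist_deriv, dist_mult. rewrite Cmod_opp.
  replace (fun x => (RtoC (x - x0) * CDerive_n (fun x => RtoC (u x)) 1 x)%C) with (fun x => RtoC (euler x0 u x)).
  - rewrite IH. rewrite Nat.iter_succ_r. reflexivity.
  - apply functional_extensionality. intros x. unfold CDerive_n, euler. simpl.
    rewrite Derive_const. unfold RtoC, Cmult; simpl.
    change (fun x1 : R => u x1) with u. f_equal; ring.
Qed.

(** * The contribution of the cutoff to Cauchy's formula *)

(** The analytic continuation of [pker zx zy]; its pole in the upper half-plane is [zx + i zy]. *)
Definition pker_C (zx zy : R) (w : C) : C := (/ ((w - (zx, zy)) * (w - (zx, - zy)%R)))%C.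

Lemma pker_C_real zx zy x : 0 < zy -> pker_C zx zy (x, 0) = RtoC (pker zx zy x).
Proof.
  intros Hz. unfold pker_C.
  replace (((x, 0) - (zx, zy)) * ((x, 0) - (zx, (- zy)%R)))%C with (RtoC ((x - zx) ^ 2 + zy ^ 2)).
  - unfold pker. rewrite RtoC_inv; [reflexivity|]. apply Rgt_not_eq, pker_den_pos, Hz.
  - unfold RtoC, Cmult, Cminus, Cplus, Copp; simpl. f_equal; ring.
Qed.

Section Side.
Variables (x0 del Y : R) (dchi : R -> R).
Hypothesis Hdel : 0 < del.
Hypothesis Hs : smooth_R dchi.
Hypothesis Hz : forall x, Rabs (x - x0) < del -> dchi x = 0.

(** The points [zx + i zy] of the kernel and the heights [s] at which it is used.  The functions
    below are the real and imaginary parts of [dchi x * pker_C zx zy (x, s)]; the zero of the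
    denominator lies where [dchi] vanishes, and a bump supported there removes it. *)
Definition side_index : Type :=
  { p : R * R * R | Rabs (fst (fst p) - x0) <= del / 2 /\ 0 <= snd (fst p) <= Y /\ 0 <= snd p <= Y }.
Definition si_x (i : side_index) := fst (fst (proj1_sig i)).
Definition si_y (i : side_index) := snd (fst (proj1_sig i)).
Definition si_s (i : side_index) := snd (proj1_sig i).

Definition side_q (i : side_index) (x : R) : R := (x - si_x i) ^ 2 - si_s i ^ 2 + si_y i ^ 2.
Definition side_p (i : side_index) (x : R) : R := 2 * (x - si_x i) * si_s i.
Definition side_V (i : side_index) (x : R) : R :=
  side_q i x ^ 2 + side_p i x ^ 2 + bump (x0 - del) (x0 + del) x.

Lemma side_V_lower : exists m, 0 < m /\ forall i x, m <= side_V i x.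
Proof.
  destruct (continuity_ab_min (bump (x0 - del) (x0 + del)) (x0 - 3 * del / 4) (x0 + 3 * del / 4)) as (xm & Hm & Hxm); [lra| |].
  { intros y _. apply continuity_pt_filterlim. apply smooth_R_continuous, smooth_R_bump. }
  assert (Hb : 0 < bump (x0 - del) (x0 + del) xm) by (apply bump_pos; lra).
  assert (Hd4 : 0 < (del / 4) ^ 4) by (apply pow_lt; lra).
  exists (Rmin (bump (x0 - del) (x0 + del) xm) ((del / 4) ^ 4)). split; [apply Rmin_pos; assumption|].
  intros i x. destruct (Rle_lt_dec (Rabs (x - x0)) (3 * del / 4)) as [Hx|Hx].
  - eapply Rle_trans; [apply Rmin_l|]. apply Rabs_le_between in Hx. specialize (Hm x ltac:(lra)).
    unfold side_V. generalize (pow2_ge_0 (side_q i x)) (pow2_ge_0 (side_p i x)). lra.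
  - eapply Rle_trans; [apply Rmin_r|]. destruct i as [[[zx zy] s] (H1 & H2 & H3)]; simpl in H1, H2, H3.
    unfold side_V, side_q, side_p, si_x, si_y, si_s; simpl proj1_sig; cbn [fst snd].
    set (u := x - zx).
    assert (Hu : (del / 4) ^ 2 <= u ^ 2).
    { rewrite <- (pow2_abs u). apply pow_incr. split; [lra|].
      unfold u. replace (x - zx) with ((x - x0) - (zx - x0)) by ring.
      eapply Rle_trans; [|apply Rabs_triang_inv]. lra. }
    replace ((u ^ 2 - s ^ 2 + zy ^ 2) ^ 2 + (2 * u * s) ^ 2)
      with ((u ^ 2 + (s - zy) ^ 2) * (u ^ 2 + (s + zy) ^ 2)) by ring.
    assert (G := bump_nonneg (x0 - del) (x0 + del) x).
    assert (A1 := pow2_ge_0 (s - zy)). assert (A2 := pow2_ge_0 (s + zy)).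
    assert (A7 : (del / 4) ^ 4 <= (u ^ 2 + (s - zy) ^ 2) * (u ^ 2 + (s + zy) ^ 2)); [|lra].
    replace ((del / 4) ^ 4) with ((del / 4) ^ 2 * (del / 4) ^ 2) by ring.
    apply Rmult_le_compat; try apply pow2_ge_0; lra.
Qed.

Definition side_re (i : side_index) (x : R) : R := dchi x * (side_q i x * / side_V i x).
Definition side_im (i : side_index) (x : R) : R := dchi x * (- side_p i x * / side_V i x).

Lemma side_ubd c d k : ubd (fun x => c <= x <= d) (fun _ _ => 1) k side_re /\
  ubd (fun x => c <= x <= d) (fun _ _ => 1) k side_im.
Proof.
  set (X := fun x => c <= x <= d).
  assert (B1 : exists K, forall i, Rabs (si_x i) <= K).
  { exists (Rabs x0 + del). intros [[[zx zy] s] (H1 & H2 & H3)]; unfold si_x; simpl in *.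
    replace zx with (x0 + (zx - x0)) by ring. eapply Rle_trans; [apply Rabs_triang|]. lra. }
  assert (B2 : exists K, forall i, Rabs (si_y i) <= K).
  { exists Y. intros [[[zx zy] s] (H1 & H2 & H3)]; unfold si_y; simpl in *. rewrite Rabs_right; lra. }
  assert (B3 : exists K, forall i, Rabs (si_s i) <= K).
  { exists Y. intros [[[zx zy] s] (H1 & H2 & H3)]; unfold si_s; simpl in *. rewrite Rabs_right; lra. }
  assert (C1 : forall k, ubd X (fun (_ : side_index) _ => 1) k (fun i x => x + - si_x i)).
  { intros j. apply ubd_plus; [apply (smooth_R_ubd c d j (fun x => x)), smooth_R_id|]. apply ubd_opp, ubd_const, B1. }
  assert (C2 : forall k, ubd X (fun (_ : side_index) _ => 1) k (fun i x => si_y i)) by (intros; apply ubd_const, B2).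
  assert (C3 : forall k, ubd X (fun (_ : side_index) _ => 1) k (fun i x => si_s i)) by (intros; apply ubd_const, B3).
  assert (Q : forall k, ubd X (fun (_ : side_index) _ => 1) k side_q).
  { intros j. apply ubd_ext with (fun i x => (x + - si_x i) * (x + - si_x i) + - (si_s i * si_s i) + si_y i * si_y i).
    - intros; unfold side_q; ring.
    - apply ubd_plus; [apply ubd_plus; [|apply ubd_opp]|]; apply ubd_mult; auto. }
  assert (P : forall k, ubd X (fun (_ : side_index) _ => 1) k side_p).
  { intros j. apply ubd_ext with (fun i x => (x + - si_x i) * si_s i + (x + - si_x i) * si_s i).
    - intros; unfold side_p; ring.
    - apply ubd_plus; apply ubd_mult; auto. }
  assert (V : forall k, ubd X (fun (_ : side_index) _ => 1) k side_V).
  { intros j. apply ubd_ext with (fun i x => side_q i x * side_q i x + side_p i x * side_p i x + bump (x0 - del) (x0 + del) x).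
    - intros; unfold side_V; ring.
    - apply ubd_plus; [apply ubd_plus; apply ubd_mult; auto|]. apply smooth_R_ubd, smooth_R_bump. }
  destruct side_V_lower as (m & Hm & Hlow).
  assert (VI : forall k, ubd X (fun (_ : side_index) _ => 1) k (fun i x => / side_V i x)).
  { intros j. apply ubd_inv with m; auto; intros i x; generalize (Hlow i x); [lra|].
    intros Hl _. rewrite Rabs_right; lra. }
  split; (apply ubd_mult; [apply smooth_R_ubd, Hs|]); apply ubd_mult; auto. apply ubd_opp; auto.
Qed.

Lemma side_eq i x : (RtoC (dchi x) * pker_C (si_x i) (si_y i) (x, si_s i))%C = (side_re i x, side_im i x).
Proof.
  unfold side_re, side_im. destruct (Rlt_le_dec (Rabs (x - x0)) del) as [Hx|Hx].
  - rewrite Hz by assumption. rewrite !Rmult_0_l. apply Cmult_0_l.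
  - assert (HV : side_V i x = side_q i x ^ 2 + side_p i x ^ 2).
    { unfold side_V. rewrite bump_zero; [ring|]. unfold Rabs in Hx; destruct Rcase_abs; lra. }
    rewrite HV. unfold pker_C.
    replace (((x, si_s i) - (si_x i, si_y i)) * ((x, si_s i) - (si_x i, (- si_y i)%R)))%C with (side_q i x, side_p i x).
    + rewrite Cinv_pair. unfold RtoC, Cmult; simpl. f_equal; unfold Rdiv; ring.
    + unfold side_q, side_p, Cmult, Cminus, Cplus, Copp; simpl. f_equal; ring.
Qed.
End Side.

(** * Polynomial growth of [F] at the point [x0] *)

Section BoundaryPairing.
Variables (a b : R) (f : (R -> C) -> C) (x0 : R).
Variables (n : nat) (fn : (R -> C) -> C) (e : R) (g : R -> C) (M : R).
Hypothesis Heq : dist_eq a b f (Nat.iter n (partial_at x0) fn).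
Hypothesis He : 0 < e.
Hypothesis Hea : a <= x0 - e.
Hypothesis Heb : x0 + e <= b.
Hypothesis Hg : forall x, x0 - e < x < x0 + e -> x <> x0 -> continuous g x /\ Cmod (g x) <= M.
Hypothesis Hfn : dist_eq (x0 - e) (x0 + e) fn
        (fun phi => CRInt (fun x => g x * phi x)%C (x0 - e) (x0 + e)).

Let del := e / 4.
Let c := x0 - 2 * del.
Let d := x0 + 2 * del.


Lemma bounded_integrable (u : R -> R) : test_R c d u ->
  ex_CRInt (fun x => g x * RtoC (u x))%C c d.
Proof.
  intros Hu.
  destruct (bounded_on_segment u c d) as [K HK].
  { intros; apply smooth_R_continuous, Hu. }
  assert (HC : forall x, c <= x <= d -> x <> x0 -> continuous (fun t => Re (g t * RtoC (u t))) x /\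
     continuous (fun t => Im (g t * RtoC (u t))) x).
  { intros x Hx Hne. destruct (Hg x) as [Hgc _]; [unfold c, d, del in *; lra|assumption|].
    assert (Huc := smooth_R_continuous u x (proj1 Hu)).
    assert (Hre : continuous (fun t => Re (g t)) x) by (apply (continuous_comp g (fst : C -> R)); [exact Hgc|apply continuous_fst]).
    assert (Him : continuous (fun t => Im (g t)) x) by (apply (continuous_comp g (snd : C -> R)); [exact Hgc|apply continuous_snd]).
    split.
    - apply continuous_ext with (fun t => Re (g t) * u t).
      + intros t. unfold RtoC, Cmult, Re, Im; simpl. ring.
      + apply (continuous_mult (K := R_AbsRing)); assumption.
    - apply continuous_ext with (fun t => Im (g t) * u t).
      + intros t. unfold RtoC, Cmult, Re, Im; simpl. ring.
      + apply (continuous_mult (K := R_AbsRing)); assumption. }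
  assert (HB : exists B, forall x, c <= x <= d -> Cmod (g x * RtoC (u x)) <= B).
  { exists (Rmax (M * K) (Cmod (g x0 * RtoC (u x0)))). intros x Hx.
    destruct (Req_dec x x0) as [->|Hne]; [apply Rmax_r|].
    eapply Rle_trans; [|apply Rmax_l]. rewrite Cmod_mult, Cmod_R.
    apply Rmult_le_compat; [apply Cmod_ge_0|apply Rabs_pos| |apply HK, Hx].
    apply Hg; [unfold c, d, del in *; lra|assumption]. }
  destruct HB as [B HB].
  split; apply (ex_RInt_except_point _ c d x0 B); try (unfold c, d, del; lra).
  - intros x Hx. eapply Rle_trans; [apply re_le_Cmod|]. apply HB, Hx.
  - intros x Hx Hne. exact (proj1 (HC x Hx Hne)).
  - intros x Hx. eapply Rle_trans; [apply im_le_Cmod|]. apply HB, Hx.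
  - intros x Hx Hne. exact (proj2 (HC x Hx Hne)).
Qed.

(** The powers of the Euler operator are moved from [fn] to the Poisson kernel, on which
    [euler_bound] applies; the integral of the kernel is at most [PI / zim z]. *)
Lemma boundary_pairing_bound chi : test_R c d chi -> exists K, 0 <= K /\ forall z : half_plane,
  sine x0 z ^ n * Cmod (f (fun x => RtoC (chi x * pker (zre z) (zim z) x))) <= K * / zim z.
Proof.
  intros Hchi.
  assert (HM : 0 <= M).
  { destruct (Hg (x0 + e / 2)) as [_ HM]; try lra. eapply Rle_trans; [apply Cmod_ge_0|exact HM]. }
  destruct (euler_bound x0 c d n chi (proj1 Hchi)) as (K & HK & HE).
  assert (HP := PI_RGT_0).
  exists (2 * (M * K * PI)). split.
  { apply Rmult_le_pos; [lra|]. apply Rmult_le_pos; [apply Rmult_le_pos; assumption|lra]. }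
  intros z. set (u := fun x => chi x * pker (zre z) (zim z) x).
  assert (Hu : test_R c d u).
  { split; [apply smooth_R_mult; [apply Hchi|apply smooth_R_pker, zim_pos]|].
    intros x Hx. unfold u. rewrite (proj2 Hchi) by assumption. ring. }
  set (v := Nat.iter n (euler x0) u).
  assert (Hv : test_R c d v) by (apply test_R_euler_iter, Hu).
  change (sine x0 z ^ n * Cmod (f (fun x => RtoC (u x))) <= 2 * (M * K * PI) * / zim z).
  rewrite (Heq _ (test_R_test_function a b c d u ltac:(unfold c, del; lra) ltac:(unfold d, del; lra) Hu)).
  rewrite partial_iter. fold v.
  rewrite (Hfn _ (test_R_test_function (x0 - e) (x0 + e) c d v ltac:(unfold c, del; lra) ltac:(unfold d, del; lra) Hv)).
  assert (Hex := bounded_integrable v Hv).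
  rewrite (proj2 (CRInt_support (fun x => g x * RtoC (v x))%C (x0 - e) (x0 + e) c d ltac:(unfold c, del; lra)
    ltac:(unfold c, d, del; lra) ltac:(unfold d, del; lra)
    ltac:(intros x Hx; cbv beta; rewrite (proj2 Hv x) by lra; apply Cmult_0_r) Hex)).
  assert (Hs := sine_pos x0 z). assert (Hsn : 0 <= sine x0 z ^ n) by (apply pow_le; lra).
  rewrite <- (Rabs_right (sine x0 z ^ n)) by (apply Rle_ge, Hsn).
  rewrite <- Cmod_R, <- Cmod_mult, <- CRInt_scal by exact Hex.
  set (m := fun x => (M * K) * pker (zre z) (zim z) x).
  assert (Hkc : forall p q, p <= q -> ex_RInt (pker (zre z) (zim z)) p q).
  { intros p q Hpq. apply ex_RInt_cont; [assumption|]. intros; apply smooth_R_continuous, smooth_R_pker, zim_pos. }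
  assert (Hm : forall p q, p <= q -> ex_RInt m p q) by (intros; apply (ex_RInt_scal (V := R_NormedModule)), Hkc; assumption).
  assert (Hcx : c <= x0 <= d) by (unfold c, d, del; lra).
  apply Rle_trans with (2 * RInt m c d).
  - (* [g x0] itself is not controlled: the interval is split at [x0] *)
    set (h := fun x => (RtoC (sine x0 z ^ n) * (g x * RtoC (v x)))%C).
    assert (Hh : ex_CRInt h c d) by (apply ex_CRInt_scal, Hex).
    assert (H1 : ex_CRInt h c x0) by (apply (ex_CRInt_sub h c c x0 d); trivial; lra).
    assert (H2 : ex_CRInt h x0 d) by (apply (ex_CRInt_sub h c x0 d d); trivial; lra).
    assert (Hle : forall x, c < x < d -> x <> x0 -> Cmod (h x) <= m x).
    { intros x Hx Hne. unfold h, m.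
      replace (RtoC (sine x0 z ^ n) * (g x * RtoC (v x)))%C with (g x * RtoC (sine x0 z ^ n * v x))%C by (rewrite RtoC_mult; ring).
      rewrite Cmod_mult, Cmod_R, Rmult_assoc.
      apply Rmult_le_compat; [apply Cmod_ge_0|apply Rabs_pos| |apply (HE z x); lra].
      apply Hg; [unfold c, d, del in *; lra|assumption]. }
    rewrite (CRInt_cat h c x0 d H1 H2), (RInt_cat m c x0 d), Rmult_plus_distr_l by (apply Hm; lra).
    eapply Rle_trans; [apply Cmod_triangle|].
    apply Rplus_le_compat; (apply CRInt_le; [lra|assumption|apply Hm; lra|]); intros x Hx; apply Hle; lra.
  - unfold m. rewrite RInt_Rscal by (apply Hkc; lra).
    assert (HI := pker_integral (zre z) (zim z) c d (zim_pos z) ltac:(lra)).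
    assert (Hz := zim_pos z).
    apply Rmult_le_reg_l with (zim z); [assumption|].
    replace (zim z * (2 * (M * K * PI) * / zim z)) with (2 * (M * K) * PI) by (field; lra).
    replace (zim z * (2 * (M * K * RInt (pker (zre z) (zim z)) c d))) with
      (2 * (M * K) * (zim z * RInt (pker (zre z) (zim z)) c d)) by ring.
    apply Rmult_le_compat_l; [|assumption]. apply Rmult_le_pos; [lra|]. apply Rmult_le_pos; assumption.
Qed.
End BoundaryPairing.

Section Localization.
Variables (a b r : R) (F : C -> C) (f : (R -> C) -> C) (x0 del : R).
Hypothesis Hr : 0 < r.
Hypothesis HF : analytic_on_rect a b r F.
Hypothesis Hf : boundary_value a b F f.
Hypothesis Hdel : 0 < del.
Let c := x0 - 2 * del.
Let d := x0 + 2 * del.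
Hypothesis Ha : a < c.
Hypothesis Hb : d < b.
Let Y := r / 2.

Variable chi : R -> R.
Hypothesis Hchi : smooth_R chi.
Hypothesis Hchi1 : forall x, Rabs (x - x0) <= del -> chi x = 1.
Hypothesis Hchi0 : forall x, 2 * del <= Rabs (x - x0) -> chi x = 0.
Hypothesis Hchi01 : forall x, 0 <= chi x <= 1.

Let HFc := analytic_cont a b r F HF.

Lemma chi_test : test_R c d chi.
Proof.
  split; [exact Hchi|]. intros x Hx. apply Hchi0. unfold c, d in Hx.
  destruct Hx; [rewrite Rabs_left|rewrite Rabs_right]; lra.
Qed.

Lemma dchi_zero x : Rabs (x - x0) < del -> Derive chi x = 0.
Proof.
  intros Hx. apply is_derive_unique. apply is_derive_ext_loc with (fun _ => 1).
  - apply locally_R with (del - Rabs (x - x0)); [lra|]. intros y Hy. symmetry. apply Hchi1.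
    replace (y - x0) with ((y - x) + (x - x0)) by ring. eapply Rle_trans; [apply Rabs_triang|]. lra.
  - apply (is_derive_const (K := R_AbsRing) (V := R_NormedModule)).
Qed.

Lemma dchi_test : test_R c d (Derive chi).
Proof.
  split; [apply smooth_R_Derive, Hchi|]. intros x Hx. exact (test_R_Derive_n_out c d chi 1 x chi_test Hx).
Qed.

Section Pole.
Variables zx zy y1 : R.
Hypothesis Hzx : Rabs (zx - x0) <= del / 2.
Hypothesis Hzy : 0 < zy < Y / 4.
Hypothesis Hy1 : 0 < y1 < zy.

Let p : C := (zx, zy + y1).
Let q : C := (zx, y1 - zy).
Let h (w : C) : C := (RtoC (chi (Re w)) * F w * / (w - q))%C.
Let D (w : C) : C := (Ci * (F w * (RtoC (Derive chi (Re w)) * pker_C zx zy (w - (0, y1)))))%C.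

Lemma pker_C_shift w : pker_C zx zy (w - (0, y1)) = (/ ((w - p) * (w - q)))%C.
Proof.
  unfold pker_C. f_equal.
  replace (w - (0, y1) - (zx, zy))%C with (w - p)%C.
  - replace (w - (0, y1) - (zx, (- zy)%R))%C with (w - q)%C; [reflexivity|].
    unfold q, Cminus, Cplus, Copp; simpl; f_equal; ring.
  - unfold p, Cminus, Cplus, Copp; simpl; f_equal; ring.
Qed.

Lemma h_cont : rect_cont a b 0 r h.
Proof.
  intros x y Hx Hy. apply cont_C_mult; [apply cont_C_mult|].
  - apply cont_C_of_R, smooth_R_continuous, Hchi.
  - apply HFc; assumption.
  - apply cont_C_inv_sub. intros E; injection E; intros; lra.
Qed.

Lemma D_cont : rect_cont a b 0 r D.
Proof.
  intros x y Hx Hy. destruct (Rlt_le_dec (Rabs (x - x0)) del) as [Hn|Hn].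
  - apply cont_C_ext_loc with (fun _ => 0%C) (del - Rabs (x - x0)); [lra| |apply cont_C_const].
    intros w Hw _. unfold D. rewrite dchi_zero.
    + ring.
    + replace (Re w - x0) with ((Re w - Re (x, y)) + (x - x0)) by (simpl; ring).
      eapply Rle_lt_trans; [apply Rabs_triang|]. lra.
  - assert (Hne : x <> zx).
    { intros ->. lra. }
    apply cont_C_mult; [apply cont_C_const|]. apply cont_C_mult; [apply HFc; assumption|].
    apply cont_C_mult; [apply cont_C_of_R, smooth_R_continuous, smooth_R_Derive, Hchi|].
    replace (fun w => pker_C zx zy (w - (0, y1))%C) with (fun w => (/ ((w - p) * (w - q)))%C).
    2:{ apply functional_extensionality. intros w. symmetry. apply pker_C_shift. }
    apply cont_C_inv.
    + apply cont_C_mult; (apply cont_C_minus; [apply cont_C_id|apply cont_C_const]).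
    + apply Cmult_neq_0; apply C_sub_neq; left; assumption.
Qed.

(** The kernel is shifted up by [y1] together with the lower side of the rectangle, so that the
    integral over this side is [slice y1] at a test function independent of [y1]. *)
Lemma pole_identity :
  (bd_int (fun w => h w / (w - p)) c d y1 Y - area_int D c d y1 Y = 2 * PI * Ci * h p)%C.
Proof.
  apply (cauchy_pompeiu a b 0 r); try (unfold c, d, Y in *; lra).
  - exact h_cont.
  - exact D_cont.
  - unfold c, d. apply Rabs_le_between in Hzx. lra.
  - intros x y Hx Hy Hne.
    assert (Hin : a < x < b /\ 0 < y < r) by (unfold Y in *; lra). destruct Hin as [Hx' Hy'].
    destruct (analytic_diff a b r F HF x y Hx' Hy') as [l Hl].
    assert (Np : ((x, y) - p)%C <> 0%C) by (apply C_sub_neq; exact Hne).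
    assert (Nq : ((x, y) - q)%C <> 0%C) by (apply C_sub_neq; right; lra).
    eexists; eexists; split.
    + apply diff_C_mult; [apply diff_C_mult; [|exact Hl]|].
      * apply (diff_C_Re chi (x, y)). apply Derive_correct, smooth_R_derivable, Hchi.
      * apply diff_C_inv; [|exact Nq]. apply diff_C_minus; [apply diff_C_id|apply diff_C_const].
    + unfold D. rewrite pker_C_shift. cbv beta. simpl Re. fold p. change (zx, zy + y1) with p.
      set (P := ((x, y) - p)%C) in *. set (Q := ((x, y) - q)%C) in *. 
      field. split; assumption.
Qed.

Variables (Ks Mt : R).
Hypothesis HMt : forall x, c <= x <= d -> Cmod (F (x, Y)) <= Mt.
Hypothesis HKs : forall y, y1 < y < Y ->
  Cmod (CRInt (fun x => (F (x, y) * (RtoC (Derive chi x) * pker_C zx zy (x, (y - y1)%R)))%C) c d) <= Ks.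

(** The residue of the kernel at [p] is [1 / (2 i zy)], whence the factor [PI / zy]. *)
Lemma pole_bound : PI / zy * Cmod (F p) <=
   Cmod (slice a b F y1 (fun x => chi x * pker zx zy x)) + 8 * (d - c) * Mt / Y ^ 2 + 2 * Y * Ks.
Proof.
  assert (HY : 0 < Y) by (unfold Y; lra).
  assert (Hcd : c <= d) by (unfold c, d; lra).
  assert (HMt0 : 0 <= Mt) by (eapply Rle_trans; [apply Cmod_ge_0|apply (HMt c)]; lra).
  assert (E := pole_identity). unfold bd_int in E.
  assert (Vz : forall x, 2 * del <= Rabs (x - x0) -> CRInt (fun y => h (x, y) / ((x, y) - p))%C y1 Y = 0%C).
  { intros x Hx. apply CRInt_zero; [lra|]. intros y _. unfold h. simpl Re. rewrite Hchi0 by assumption. unfold Cdiv. ring. }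
  rewrite (Vz c), (Vz d) in E by (unfold c, d; first [rewrite Rabs_right by lra|rewrite Rabs_left by lra]; lra).
  assert (Hu : test_R c d (fun x => chi x * pker zx zy x)).
  { split; [apply smooth_R_mult; [exact Hchi|apply smooth_R_pker; lra]|].
    intros x Hx. rewrite (proj2 chi_test) by assumption. ring. }
  assert (Hk : forall x, (/ ((x, y1) - q) / ((x, y1) - p))%C = pker_C zx zy ((x, y1) - (0, y1))%C).
  { intros x. rewrite pker_C_shift. field. split; apply C_sub_neq; right; lra. }
  assert (Bot : CRInt (fun x => h (x, y1) / ((x, y1) - p))%C c d = slice a b F y1 (fun x => chi x * pker zx zy x)).
  { destruct (slice_ex a b r F HF c d y1 _ Ha Hcd Hb ltac:(unfold Y in *; lra) Hu) as (_ & _ & ->).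
    apply CRInt_ext; [assumption|]. intros x _.
    assert (K := Hk x).
    unfold h. simpl Re. replace ((x, y1) - (0, y1))%C with (x, 0)%C in K by (unfold Cminus, Cplus, Copp; simpl; f_equal; ring).
    rewrite pker_C_real in K by lra. rewrite RtoC_mult, <- K. unfold Cdiv. ring. }
  assert (Top : Cmod (CRInt (fun x => h (x, Y) / ((x, Y) - p))%C c d) <= 2 * (d - c) * (4 * Mt / Y ^ 2)).
  { apply CRInt_bound; [assumption| |].
    - apply (ex_CRInt_hor (fun w => h w / (w - p))%C); [assumption|]. intros x Hx.
      apply cont_C_mult; [apply h_cont; unfold Y in *; lra|].
      apply cont_C_inv_sub. intros E0; injection E0; intros; unfold Y in *; lra.
    - intros x Hx. unfold h. simpl Re. unfold Cdiv.
      assert (Np : Y / 2 <= Cmod ((x, Y) - p)).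
      { eapply Rle_trans; [|apply (Cmod_ge_Im x Y zx (zy + y1) (Y - (zy + y1))); rewrite Rabs_right; lra]. lra. }
      assert (Nq : Y / 2 <= Cmod ((x, Y) - q)).
      { eapply Rle_trans; [|apply (Cmod_ge_Im x Y zx (y1 - zy) (Y - (y1 - zy))); rewrite Rabs_right; lra]. lra. }
      rewrite !Cmod_mult, Cmod_R, !Cmod_inv.
      2,3: apply Cmod_gt_0; lra.
      replace (4 * Mt / Y ^ 2) with (1 * Mt * / (Y / 2) * / (Y / 2)) by (field; lra).
      assert (I0 : 0 < / (Y / 2)) by (apply Rinv_0_lt_compat; lra).
      assert (Ip : 0 < / Cmod ((x, Y) - p)) by (apply Rinv_0_lt_compat; lra).
      assert (Iq : 0 < / Cmod ((x, Y) - q)) by (apply Rinv_0_lt_compat; lra).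
      assert (P0 : 0 <= Rabs (chi x) * Cmod (F (x, Y))) by (apply Rmult_le_pos; [apply Rabs_pos|apply Cmod_ge_0]).
      apply Rmult_le_compat; [apply Rmult_le_pos; lra|lra| |apply Rinv_le_contravar; lra].
      apply Rmult_le_compat; [assumption|lra| |apply Rinv_le_contravar; lra].
      apply Rmult_le_compat; [apply Rabs_pos|apply Cmod_ge_0| |apply HMt; lra].
      destruct (Hchi01 x). rewrite Rabs_right; lra. }
  assert (Area : Cmod (area_int D c d y1 Y) <= 2 * (Y - y1) * Ks).
  { unfold area_int. apply CRInt_bound; [lra|apply (ex_CRInt_area a b 0 r); try exact D_cont; unfold Y in *; lra|].
    intros y Hy. unfold D.
    rewrite (CRInt_ext _ (fun x => Ci * (F (x, y) * (RtoC (Derive chi x) * pker_C zx zy (x, (y - y1)%R))))%C); [|assumption|].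
    2:{ intros x _. simpl Re. replace ((x, y) - (0, y1))%C with (x, (y - y1)%R); [reflexivity|].
        unfold Cminus, Cplus, Copp; simpl. f_equal; ring. }
    rewrite CRInt_scal.
    - rewrite Cmod_mult, Cmod_Ci, Rmult_1_l. apply HKs, Hy.
    - apply ex_CRInt_ext with (fun x => (- Ci) * D (x, y))%C; [assumption| |].
      + intros x _. unfold D. simpl Re. replace ((x, y) - (0, y1))%C with (x, (y - y1)%R).
        * transitivity ((- (Ci * Ci)) * (F (x, y) * (RtoC (Derive chi x) * pker_C zx zy (x, (y - y1)%R))))%C; [ring|].
          replace (- (Ci * Ci))%C with (RtoC 1); [apply Cmult_1_l|].
          unfold Ci, Cmult, Copp, RtoC; simpl. f_equal; ring.
        * unfold Cminus, Cplus, Copp; simpl. f_equal; ring.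
      + apply ex_CRInt_scal. apply (ex_CRInt_hor D); [assumption|]. intros x Hx. apply D_cont; unfold Y in *; lra. }
  rewrite Bot in E.
  assert (Ep : (2 * PI * Ci * h p)%C = (RtoC (PI / zy) * F p)%C).
  { unfold h. simpl Re. rewrite Hchi1 by lra.
    replace (p - q)%C with (2 * Ci * RtoC zy)%C.
    - unfold Rdiv. rewrite RtoC_mult, RtoC_inv by lra. field. split; [|apply Ci_nz].
      intros E0; apply RtoC_inj in E0; lra.
    - unfold p, q, Ci, RtoC, Cmult, Cminus, Cplus, Copp; simpl. f_equal; ring. }
  rewrite Ep in E.
  replace (PI / zy) with (Rabs (PI / zy)).
  2:{ apply Rabs_right. left. apply Rdiv_lt_0_compat; [apply PI_RGT_0|lra]. }
  rewrite <- Cmod_R, <- Cmod_mult, <- E.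
  set (S0 := slice a b F y1 _) in *. set (T0 := CRInt _ c d) in *. set (U0 := area_int D c d y1 Y) in *.
  replace (S0 + Ci * RtoC 0 - T0 - Ci * RtoC 0 - U0)%C with (S0 + - T0 + - U0)%C by ring.
  eapply Rle_trans; [apply Cmod_triangle|]. rewrite Cmod_opp.
  assert (HKs0 : 0 <= Ks) by (eapply Rle_trans; [apply Cmod_ge_0|apply (HKs ((y1 + Y) / 2)); lra]).
  apply Rplus_le_compat.
  - eapply Rle_trans; [apply Cmod_triangle|]. rewrite Cmod_opp. apply Rplus_le_compat_l.
    eapply Rle_trans; [exact Top|]. right. field. lra.
  - eapply Rle_trans; [exact Area|]. apply Rmult_le_compat_r; lra.
Qed.
End Pole.
End Localization.

(** A power of [1 / sin (arg (z - x0))], written without division. *)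
Definition grows_at (F : C -> C) (x0 : R) (n : nat) (K del : R) : Prop :=
  forall x y, Rabs (x - x0) <= del -> 0 < y <= del ->
    Cmod (F (x, y)) * y ^ n <= K * (Rabs (x - x0) + y) ^ n.

(** As [y1] tends to 0 in [pole_bound], [F (zx, zy)] becomes [zy / PI] times the pairing of [f] with
    the cut-off Poisson kernel, up to a bounded error.  The error is uniform in the point because
    the functions that the cutoff produces are bounded in every seminorm. *)
Theorem polynomial_growth a b r F f x0 : 0 < r -> analytic_on_rect a b r F -> boundary_value a b F f ->
  dist_bounded_at a b f x0 ->
  exists n K del, 0 <= K /\ 0 < del /\ a < x0 - del /\ x0 + del < b /\ del < r /\
    grows_at F x0 n K del.
Proof.
  intros Hr HF Hf (n & fn & _ & Heq & e & g & M & He & Hea & Heb & Hg & Hfn).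
  set (del := e / 4). assert (Hdel : 0 < del) by (unfold del; lra).
  set (c := x0 - 2 * del). set (d := x0 + 2 * del). set (Y := r / 2).
  assert (Hac : a < c) by (unfold c, del; lra). assert (Hdb : d < b) by (unfold d, del; lra).
  assert (Hcd : c < d) by (unfold c, d; lra). assert (HY : 0 < Y < r) by (unfold Y; lra).
  destruct (smooth_cutoff x0 del Hdel) as (chi & Hs & H1 & H0 & H01).
  assert (Hchi := chi_test x0 del Hdel chi Hs H0). fold c d in Hchi.
  assert (Hdchi := dchi_test x0 del Hdel chi Hs H0). fold c d in Hdchi.
  destruct (boundary_pairing_bound a b f x0 n fn e g M Heq He Hea Heb Hg Hfn chi Hchi) as (K1 & HK1 & HP).
  destruct (slices_equicontinuous a b r F f HF Hf c d Y Hac Hcd Hdb HY) as (N & K2 & HK2 & HS).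
  assert (Hdz := fun x => dchi_zero x0 del chi H1 x).
  assert (HU := side_ubd x0 del Y (Derive chi) Hdel (smooth_R_Derive _ Hs) c d).
  destruct (ubd_derivs_bound _ _ (fun k => proj1 (HU k)) N) as (K3 & HK3 & HB3).
  destruct (ubd_derivs_bound _ _ (fun k => proj2 (HU k)) N) as (K4 & HK4 & HB4).
  destruct (bounded_C_on_rect F c d Y Y) as (Mt & HMt0 & HMt).
  { intros x y Hx Hy. apply (analytic_cont a b r F HF); lra. }
  set (Ks := K2 * K3 + K2 * K4).
  set (Bb := 8 * (d - c) * Mt / Y ^ 2 + 2 * Y * Ks).
  assert (HKs : forall zx zy y1 y, Rabs (zx - x0) <= del / 2 -> 0 < zy < Y / 4 -> 0 < y1 < zy -> y1 < y < Y ->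
    Cmod (CRInt (fun x => (F (x, y) * (RtoC (Derive chi x) * pker_C zx zy (x, (y - y1)%R)))%C) c d) <= Ks).
  { intros zx zy y1 y Hzx Hzy Hy1 Hy.
    assert (Hi : Rabs (fst (fst (zx, zy, y - y1)) - x0) <= del / 2 /\ 0 <= snd (fst (zx, zy, y - y1)) <= Y /\ 0 <= snd (zx, zy, y - y1) <= Y)
      by (simpl; lra).
    set (i := exist _ (zx, zy, y - y1) Hi : side_index x0 del Y).
    assert (Tre : test_R c d (side_re x0 del Y (Derive chi) i)).
    { split; [apply (ubd_smooth_R _ _ i (fun k => proj1 (HU k)))|].
      intros x Hx. unfold side_re. rewrite (proj2 Hdchi) by assumption. ring. }
    assert (Tim : test_R c d (side_im x0 del Y (Derive chi) i)).
    { split; [apply (ubd_smooth_R _ _ i (fun k => proj2 (HU k)))|].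
      intros x Hx. unfold side_im. rewrite (proj2 Hdchi) by assumption. ring. }
    assert (Bre := HS y _ K3 ltac:(lra) Tre (fun k x Hk Hx => HB3 i k x Hk Hx)).
    assert (Bim := HS y _ K4 ltac:(lra) Tim (fun k x Hk Hx => HB4 i k x Hk Hx)).
    destruct (slice_ex a b r F HF c d y _ Hac (Rlt_le _ _ Hcd) Hdb ltac:(lra) Tre) as (Ere & _ & Sre).
    destruct (slice_ex a b r F HF c d y _ Hac (Rlt_le _ _ Hcd) Hdb ltac:(lra) Tim) as (Eim & _ & Sim).
    rewrite Sre in Bre. rewrite Sim in Bim.
    rewrite (CRInt_ext _ (fun x => F (x, y) * RtoC (side_re x0 del Y (Derive chi) i x) +
       Ci * (F (x, y) * RtoC (side_im x0 del Y (Derive chi) i x)))%C); [|lra|].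
    - rewrite (CRInt_plus (fun x => F (x, y) * RtoC (side_re x0 del Y (Derive chi) i x))%C
        (fun x => Ci * (F (x, y) * RtoC (side_im x0 del Y (Derive chi) i x)))%C _ _ Ere (ex_CRInt_scal Ci _ _ _ Eim)).
      rewrite (CRInt_scal Ci _ _ _ Eim).
      eapply Rle_trans; [apply Cmod_triangle|]. rewrite Cmod_mult, Cmod_Ci. unfold Ks. lra.
    - intros x _.
      assert (E := side_eq x0 del Y (Derive chi) Hdz i x).
      unfold si_x, si_y, si_s in E. simpl proj1_sig in E. cbn [fst snd] in E. rewrite E.
      replace (side_re x0 del Y (Derive chi) i x, side_im x0 del Y (Derive chi) i x)
        with (RtoC (side_re x0 del Y (Derive chi) i x) + Ci * RtoC (side_im x0 del Y (Derive chi) i x))%C.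
      + ring.
      + unfold RtoC, Ci, Cplus, Cmult; simpl. f_equal; ring. }
  assert (HKs0 : 0 <= Ks) by (unfold Ks; apply Rplus_le_le_0_compat; apply Rmult_le_pos; assumption).
  assert (HBb : 0 <= Bb).
  { unfold Bb. apply Rplus_le_le_0_compat; [|apply Rmult_le_pos; lra].
    apply Rmult_le_pos; [apply Rmult_le_pos; lra|]. left. apply Rinv_0_lt_compat, pow_lt; lra. }
  assert (HPI := PI_RGT_0).
  set (del' := Rmin (del / 2) (Y / 8)).
  assert (D1 : del' <= del / 2) by apply Rmin_l. assert (D2 : del' <= Y / 8) by apply Rmin_r.
  assert (D0 : 0 < del') by (apply Rmin_pos; lra).
  exists n, ((K1 + Bb * Y) / PI), del'.
  split; [apply Rmult_le_pos; [|left; apply Rinv_0_lt_compat; assumption]; apply Rplus_le_le_0_compat; [assumption|apply Rmult_le_pos; lra]|].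
  split; [assumption|]. split; [unfold c in *; lra|]. split; [unfold d in *; lra|]. split; [lra|].
  intros zx zy Hzx Hzy.
  assert (Hpole : PI / zy * Cmod (F (zx, zy)) <= Cmod (f (fun x => RtoC (chi x * pker zx zy x))) + Bb).
  { apply le_epsilon. intros eta Heta.
    assert (Hpz : 0 < PI / zy) by (apply Rdiv_lt_0_compat; lra).
    set (eta1 := eta / 2 / (PI / zy)).
    assert (He1 : 0 < eta1) by (unfold eta1; apply Rdiv_lt_0_compat; lra).
    assert (Hu : test_R c d (fun x => chi x * pker zx zy x)).
    { split; [apply smooth_R_mult; [exact Hs|apply smooth_R_pker; lra]|].
      intros x Hx. rewrite (proj2 Hchi) by assumption. ring. }
    destruct (proj1 (filterlim_at_right_0 _ _) (Hf _ (test_R_test_function a b c d _ Hac Hdb Hu)) (eta / 2) ltac:(lra)) as (y0 & Hy0 & HL).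
    destruct (cont_C_eps F (zx, zy) (analytic_cont a b r F HF zx zy ltac:(apply Rabs_le_between in Hzx; unfold c, d in *; lra) ltac:(lra)) eta1 He1)
      as (dd & Hdd & HC).
    set (y1 := Rmin (Rmin y0 dd) zy / 2).
    assert (Q0 : 0 < Rmin (Rmin y0 dd) zy) by (apply Rmin_pos; [apply Rmin_pos|]; lra).
    assert (Q1 : Rmin (Rmin y0 dd) zy <= y0) by (eapply Rle_trans; apply Rmin_l).
    assert (Q2 : Rmin (Rmin y0 dd) zy <= dd) by (eapply Rle_trans; [apply Rmin_l|apply Rmin_r]).
    assert (Q3 : Rmin (Rmin y0 dd) zy <= zy) by apply Rmin_r.
    assert (Hy1 : 0 < y1 < zy) by (unfold y1; lra).
    assert (PB := pole_bound a b r F x0 del Hr HF Hdel Hac Hdb chi Hs H1 H0 H01 zx zy y1 ltac:(lra) ltac:(unfold Y in *; lra) Hy1 Ks Mt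
      ltac:(intros x Hx; apply HMt; [exact Hx|unfold Y; lra])
      ltac:(intros y Hy; apply HKs; try lra; unfold Y in *; lra)).
    fold c d Y in PB. fold Y in PB.
    specialize (HL y1 ltac:(unfold y1; lra)). fold (slice a b F y1 (fun x => chi x * pker zx zy x)) in HL.
    specialize (HC (zx, zy + y1)). simpl in HC.
    assert (HC' : Cmod (F (zx, zy + y1) - F (zx, zy)) < eta1).
    { apply HC; [rewrite Rminus_diag, Rabs_R0; assumption|].
      replace (zy + y1 - zy) with y1 by ring. rewrite Rabs_right; unfold y1; lra. }
    assert (T1 : Cmod (F (zx, zy)) <= Cmod (F (zx, (zy + y1)%R)) + eta1).
    { replace (F (zx, zy)) with (F (zx, (zy + y1)%R) + - (F (zx, (zy + y1)%R) - F (zx, zy)))%C by ring.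
      eapply Rle_trans; [apply Cmod_triangle|]. rewrite Cmod_opp. lra. }
    assert (T2 : Cmod (slice a b F y1 (fun x => chi x * pker zx zy x)) <= Cmod (f (fun x => RtoC (chi x * pker zx zy x))) + eta / 2).
    { set (S0 := slice a b F y1 _) in *. set (f0 := f _) in *.
      replace S0 with (f0 + (S0 - f0))%C by ring. eapply Rle_trans; [apply Cmod_triangle|]. lra. }
    apply Rle_trans with (PI / zy * (Cmod (F (zx, (zy + y1)%R)) + eta1)); [apply Rmult_le_compat_l; lra|].
    rewrite Rmult_plus_distr_l. replace (PI / zy * eta1) with (eta / 2) by (unfold eta1; field; lra).
    unfold Bb. lra. }
  set (z := exist _ (zx, zy) (proj1 Hzy) : half_plane).
  specialize (HP z). change (zre z) with zx in HP. change (zim z) with zy in HP.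
  assert (Hsp := sine_pos x0 z). assert (Hsn : 0 < sine x0 z ^ n) by (apply pow_lt; assumption).
  assert (Hs1 : sine x0 z ^ n <= 1).
  { rewrite <- (pow1 n). apply pow_incr. split; [lra|apply sine_le_1]. }
  assert (E1 : sine x0 z ^ n * Cmod (F (zx, zy)) <= (K1 + Bb * Y) / PI).
  { apply Rmult_le_reg_l with (PI / zy); [apply Rdiv_lt_0_compat; lra|].
    replace (PI / zy * ((K1 + Bb * Y) / PI)) with (K1 * / zy + Bb * (Y / zy)) by (field; lra).
    replace (PI / zy * (sine x0 z ^ n * Cmod (F (zx, zy)))) with (sine x0 z ^ n * (PI / zy * Cmod (F (zx, zy)))) by ring.
    apply Rle_trans with (sine x0 z ^ n * (Cmod (f (fun x => RtoC (chi x * pker zx zy x))) + Bb)).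
    - apply Rmult_le_compat_l; lra.
    - rewrite Rmult_plus_distr_l. apply Rplus_le_compat; [exact HP|].
      rewrite Rmult_comm. apply Rmult_le_compat_l; [assumption|].
      apply Rle_trans with 1; [assumption|]. apply Rmult_le_reg_r with zy; [lra|].
      unfold Rdiv. rewrite Rmult_assoc, Rinv_l; lra. }
  set (R0 := Rabs (zx - x0) + zy) in *.
  assert (HR0 : 0 < R0) by (unfold R0; generalize (Rabs_pos (zx - x0)); lra).
  assert (E2 : (zy / R0) ^ n <= sine x0 z ^ n).
  { apply pow_incr. split; [left; apply Rdiv_lt_0_compat; lra|].
    unfold sine. change (zre z) with zx. change (zim z) with zy.
    apply Rmult_le_compat_l; [lra|]. apply Rinv_le_contravar.
    - apply sqrt_lt_R0. apply (sine_den x0 z).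
    - rewrite <- (sqrt_pow2 R0) by lra. apply sqrt_le_1_alt.
      rewrite <- (pow2_abs (zx - x0)). unfold R0.
      generalize (Rmult_le_pos _ _ (Rabs_pos (zx - x0)) (Rlt_le _ _ (proj1 Hzy))). simpl. lra. }
  apply Rmult_le_reg_r with ((/ R0) ^ n); [apply pow_lt, Rinv_0_lt_compat, HR0|].
  replace (Cmod (F (zx, zy)) * zy ^ n * (/ R0) ^ n) with ((zy / R0) ^ n * Cmod (F (zx, zy)))
    by (unfold Rdiv; rewrite Rpow_mult_distr; ring).
  replace ((K1 + Bb * Y) / PI * R0 ^ n * (/ R0) ^ n) with ((K1 + Bb * Y) / PI).
  - eapply Rle_trans; [|exact E1]. apply Rmult_le_compat_r; [apply Cmod_ge_0|exact E2].
  - rewrite Rmult_assoc, <- Rpow_mult_distr, Rinv_r, pow1 by lra. ring.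
Qed.

(** * Consequences of Cauchy's formula *)

Definition holo_rect (a b c d : R) (G : C -> C) : Prop :=
  forall x y, a < x < b -> c < y < d -> exists l, diff_C G (x, y) l (Ci * l).

Lemma holo_rect_cont a b c d G : holo_rect a b c d G -> rect_cont a b c d G.
Proof. intros HG x y Hx Hy. destruct (HG x y Hx Hy) as [l Hl]. exact (diff_C_cont _ _ _ _ Hl). Qed.

Lemma cauchy_formula a b c d G x1 x2 y1 y2 px py : holo_rect a b c d G ->
  a < x1 -> x1 < px < x2 -> x2 < b -> c < y1 -> y1 < py < y2 -> y2 < d ->
  bd_int (fun w => G w / (w - (px, py)))%C x1 x2 y1 y2 = (2 * PI * Ci * G (px, py))%C.
Proof.
  intros HG h1 h2 h3 h4 h5 h6.
  rewrite <- (cauchy_pompeiu a b c d G (fun _ => 0%C) x1 x2 y1 y2 px py); trivial.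
  - assert (E : area_int (fun _ => 0%C) x1 x2 y1 y2 = 0%C).
    { apply Cmod_eq_0. apply Rle_antisym; [|apply Cmod_ge_0].
      apply Rle_trans with (4 * (x2 - x1) * (y2 - y1) * 0); [|lra].
      apply (area_int_bound a b c d); try lra.
      - intros x y _ _. apply cont_C_const.
      - intros x y _ _. rewrite Cmod_0. lra. }
    rewrite E. ring.
  - apply holo_rect_cont, HG.
  - intros x y _ _. apply cont_C_const.
  - intros x y Hx Hy _. destruct (HG x y ltac:(lra) ltac:(lra)) as [l Hl].
    exists l, (Ci * l)%C. split; [exact Hl|]. ring.
Qed.

Lemma Cmod_2PI_Ci z : Cmod z <= Cmod (2 * PI * Ci * z).
Proof.
  rewrite !Cmod_mult, Cmod_Ci, !Cmod_R, !Rabs_right.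
  - generalize (Cmod_ge_0 z) PI2_1. intros. assert (1 <= PI) by lra. nra.
  - generalize PI_RGT_0; lra.
  - lra.
Qed.

Lemma holo_lipschitz a b c d G px py h M : holo_rect a b c d G -> 0 < h ->
  a < px - 2 * h -> px + 2 * h < b -> c < py - 2 * h -> py + 2 * h < d ->
  (forall x y, Rabs (x - px) <= 2 * h -> Rabs (y - py) <= 2 * h -> Cmod (G (x, y)) <= M) ->
  forall u v, Rabs (u - px) <= h -> Rabs (v - py) <= h ->
  Cmod (G (u, v) - G (px, py)) <= 16 * M / h * Cmod ((u, v) - (px, py)).
Proof.
  intros HG Hh h1 h2 h3 h4 HM u v Hu Hv.
  assert (Hu' := proj1 (Rabs_le_between _ _) Hu). assert (Hv' := proj1 (Rabs_le_between _ _) Hv).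
  set (p := (px, py) : C). set (q := (u, v) : C).
  set (x1 := px - 2 * h). set (x2 := px + 2 * h). set (y1 := py - 2 * h). set (y2 := py + 2 * h).
  assert (Hb : forall x y, on_boundary x1 x2 y1 y2 x y -> a < x < b /\ c < y < d /\
     Cmod (G (x, y)) <= M /\ 2 * h <= Cmod ((x, y) - p) /\ h <= Cmod ((x, y) - q)).
  { unfold on_boundary, x1, x2, y1, y2. intros x y (Hx & Hy & Hxy).
    split; [lra|]. split; [lra|]. split; [apply HM; apply Rabs_le; lra|].
    destruct Hxy as [E|[E|[E|E]]]; subst.
    - split; [apply Cmod_ge_Re; rewrite Rabs_left; lra|].
      eapply Rle_trans; [|apply Cmod_ge_Re; reflexivity]. rewrite Rabs_left; lra.
    - split; [apply Cmod_ge_Re; rewrite Rabs_right; lra|].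
      eapply Rle_trans; [|apply Cmod_ge_Re; reflexivity]. rewrite Rabs_right; lra.
    - split; [apply Cmod_ge_Im; rewrite Rabs_left; lra|].
      eapply Rle_trans; [|apply Cmod_ge_Im; reflexivity]. rewrite Rabs_left; lra.
    - split; [apply Cmod_ge_Im; rewrite Rabs_right; lra|].
      eapply Rle_trans; [|apply Cmod_ge_Im; reflexivity]. rewrite Rabs_right; lra. }
  assert (Hne : forall x y, on_boundary x1 x2 y1 y2 x y -> ((x, y) - p)%C <> 0%C /\ ((x, y) - q)%C <> 0%C).
  { intros x y Hxy. destruct (Hb x y Hxy) as (_ & _ & _ & N1 & N2). split; apply Cmod_gt_0; lra. }
  assert (HGc := holo_rect_cont _ _ _ _ _ HG).
  assert (Cp : forall z, (z = p \/ z = q) -> bd_cont (fun w => G w / (w - z))%C x1 x2 y1 y2).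
  { intros z Hz x y Hxy. destruct (Hb x y Hxy) as (Bx & By & _). destruct (Hne x y Hxy) as [N1 N2].
    apply cont_C_mult; [apply HGc; assumption|]. apply cont_C_inv.
    - apply cont_C_minus; [apply cont_C_id|apply cont_C_const].
    - destruct Hz as [-> | ->]; assumption. }
  assert (E1 := cauchy_formula a b c d G x1 x2 y1 y2 px py HG ltac:(unfold x1; lra) ltac:(unfold x1, x2; lra)
    ltac:(unfold x2; lra) ltac:(unfold y1; lra) ltac:(unfold y1, y2; lra) ltac:(unfold y2; lra)).
  assert (E2 := cauchy_formula a b c d G x1 x2 y1 y2 u v HG ltac:(unfold x1; lra) ltac:(unfold x1, x2; lra)
    ltac:(unfold x2; lra) ltac:(unfold y1; lra) ltac:(unfold y1, y2; lra) ltac:(unfold y2; lra)).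
  fold p in E1. fold q in E2.
  eapply Rle_trans; [apply Cmod_2PI_Ci|].
  replace (2 * PI * Ci * (G q - G p))%C with (2 * PI * Ci * G q + (- (1)) * (2 * PI * Ci * G p))%C by ring.
  rewrite <- E1, <- E2.
  assert (Hx12 : x1 <= x2) by (unfold x1, x2; lra). assert (Hy12 : y1 <= y2) by (unfold y1, y2; lra).
  rewrite <- (bd_int_scal (- (1)) (fun w => G w / (w - p))%C _ _ _ _ Hx12 Hy12 (Cp p (or_introl eq_refl))).
  assert (Cm : bd_cont (fun w => - (1) * (G w / (w - p)))%C x1 x2 y1 y2).
  { intros x y Hxy. apply cont_C_mult; [apply cont_C_const|]. apply (Cp p (or_introl eq_refl) x y Hxy). }
  rewrite <- (bd_int_plus (fun w => G w / (w - q))%C (fun w => - (1) * (G w / (w - p)))%C _ _ _ _ Hx12 Hy12 (Cp q (or_intror eq_refl)) Cm).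
  replace (16 * M / h * Cmod (q - p)) with (4 * ((x2 - x1) + (y2 - y1)) * (M * Cmod (q - p) * / (2 * h) * / h))
    by (unfold x1, x2, y1, y2; field; lra).
  apply bd_int_bound; trivial.
  - intros x y Hxy. apply cont_C_plus; [apply (Cp q (or_intror eq_refl) x y Hxy)|apply (Cm x y Hxy)].
  - intros x y Hxy. destruct (Hb x y Hxy) as (Bx & By & HGM & N1 & N2). destruct (Hne x y Hxy) as [Z1 Z2].
    replace (G (x, y) / ((x, y) - q) + - (1) * (G (x, y) / ((x, y) - p)))%C
      with (G (x, y) * (q - p) * / ((x, y) - p) * / ((x, y) - q))%C by (field; split; assumption).
    rewrite !Cmod_mult, !Cmod_inv by assumption.
    assert (I1 : 0 < / Cmod ((x, y) - p)) by (apply Rinv_0_lt_compat; lra).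
    assert (I2 : 0 < / Cmod ((x, y) - q)) by (apply Rinv_0_lt_compat; lra).
    assert (P0 : 0 <= Cmod (G (x, y)) * Cmod (q - p)) by (apply Rmult_le_pos; apply Cmod_ge_0).
    apply Rmult_le_compat; [apply Rmult_le_pos; lra|lra| |apply Rinv_le_contravar; lra].
    apply Rmult_le_compat; [assumption|lra| |apply Rinv_le_contravar; lra].
    apply Rmult_le_compat_r; [apply Cmod_ge_0|assumption].
Qed.

Lemma holo_pow (u : C -> C) w l N : diff_C u w l (Ci * l) ->
  exists l', diff_C (fun z => u z ^ N)%C w l' (Ci * l').
Proof.
  intros Hu. induction N as [|N [l' IH]].
  - exists (RtoC 0). simpl. apply diff_C_ext with (fun _ => RtoC 1) (RtoC 0) (RtoC 0); trivial; [ring|apply diff_C_const].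
  - exists (u w ^ N * l + u w * l')%C. simpl.
    apply diff_C_ext with (fun z => u z * u z ^ N)%C (u w ^ N * l + u w * l')%C (u w ^ N * (Ci * l) + u w * (Ci * l'))%C; trivial; [ring|].
    apply (diff_C_mult u (fun z => u z ^ N)%C); assumption.
Qed.

(** Carleman's device: in Cauchy's formula for [G w / (w - c0) ^ N] the far sides of the rectangle,
    which lie outside the disc of radius [rho], lose a factor [(rho1 / rho) ^ N] against the value at
    a point of the disc of radius [rho1].  A large [N] makes them negligible, and then a small
    [m] the left side. *)
Lemma carleman a b c d G V rho rho1 M m px py N :
  holo_rect a b c d G -> 1 < rho -> rho1 < rho -> 0 < rho1 -> 0 <= M -> 0 <= m ->
  -1 < a < 0 -> rho - 1 < b -> c < V - rho -> V + rho < d ->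
  (forall x y, 0 <= x <= rho - 1 -> V - rho <= y <= V + rho -> Cmod (G (x, y)) <= M) ->
  (forall y, V - rho <= y <= V + rho -> Cmod (G (0, y)) <= m) ->
  0 < px -> (px + 1) ^ 2 + (py - V) ^ 2 <= rho1 ^ 2 ->
  Cmod (G (px, py)) <= 8 * rho * (rho1 ^ N * m / px + (rho1 / rho) ^ N * M / (rho - rho1)).
Proof.
  intros HG Hrho H1 H10 HM0 Hm0 Ha Hb Hc Hd HM Hm Hpx Hp.
  set (c0 := (-1, V) : C). set (p := (px, py) : C).
  assert (Hpx1 : px + 1 <= rho1) by (generalize (pow2_ge_0 (py - V)); nra).
  assert (Hpy1 : - rho1 <= py - V <= rho1) by (generalize (pow2_ge_0 (px + 1)); intro; split; nra).
  set (h := (fun w => G w * (/ (w - c0)) ^ N)%C).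
  assert (Hnc : forall x y, a < x -> ((x, y) - c0)%C <> 0%C) by (intros; apply C_sub_neq; left; lra).
  assert (Hh : holo_rect a b c d h).
  { intros x y Hx Hy. destruct (HG x y Hx Hy) as [l Hl].
    assert (Hi : exists li, diff_C (fun w => / (w - c0))%C (x, y) li (Ci * li)).
    { eexists. eapply diff_C_ext; [| | |apply diff_C_inv; [apply diff_C_minus; [apply diff_C_id|apply (diff_C_const c0)]|apply (Hnc x y); lra]].
      - reflexivity.
      - reflexivity.
      - cbv beta. field. apply (Hnc x y); lra. }
    destruct Hi as [li Hi]. destruct (holo_pow _ _ _ N Hi) as [l' Hl'].
    eexists. eapply diff_C_ext; [| | |apply (diff_C_mult _ _ _ _ _ _ _ Hl Hl')]; [reflexivity|reflexivity|]. cbv beta. ring. }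
  assert (E := cauchy_formula a b c d h 0 (rho - 1) (V - rho) (V + rho) px py Hh ltac:(lra) ltac:(lra) ltac:(lra) ltac:(lra) ltac:(lra) ltac:(lra)).
  fold p in E.
  assert (Hpc : 0 < Cmod (p - c0) <= rho1).
  { split; [apply Cmod_gt_0, Hnc; lra|].
    unfold p, c0, Cmod; simpl fst; simpl snd. rewrite <- (sqrt_pow2 rho1) by lra. apply sqrt_le_1_alt.
    replace (px + - -1) with (px + 1) by ring. replace (py + - V) with (py - V) by ring. exact Hp. }
  assert (Far : forall x y, 0 <= x <= rho - 1 -> V - rho <= y <= V + rho -> (x = rho - 1 \/ y = V - rho \/ y = V + rho) ->
    Cmod (h (x, y) / ((x, y) - p)) <= M * (/ rho) ^ N * / (rho - rho1)).
  { intros x y Hx Hy Hxy.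
    assert (D1 : rho <= Cmod ((x, y) - c0)).
    { destruct Hxy as [->|[->| ->]].
      - apply Cmod_ge_Re. rewrite Rabs_right; lra.
      - apply Cmod_ge_Im. rewrite Rabs_left; lra.
      - apply Cmod_ge_Im. rewrite Rabs_right; lra. }
    assert (D2 : rho - rho1 <= Cmod ((x, y) - p)).
    { replace ((x, y) - c0)%C with (((x, y) - p) + (p - c0))%C in D1 by ring.
      assert (T := Cmod_triangle ((x, y) - p) (p - c0)). lra. }
    unfold h. unfold Cdiv. rewrite !Cmod_mult, Cmod_pow, !Cmod_inv by (apply Cmod_gt_0; lra).
    assert (I1 : 0 < / Cmod ((x, y) - p)) by (apply Rinv_0_lt_compat; lra).
    assert (I2 : 0 < / Cmod ((x, y) - c0)) by (apply Rinv_0_lt_compat; lra).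
    apply Rmult_le_compat; [|lra| |apply Rinv_le_contravar; lra].
    - apply Rmult_le_pos; [apply Cmod_ge_0|apply pow_le; lra].
    - apply Rmult_le_compat; [apply Cmod_ge_0|apply pow_le; lra|apply HM; assumption|].
      apply pow_incr. split; [lra|]. apply Rinv_le_contravar; lra. }
  assert (Near : forall y, V - rho <= y <= V + rho -> Cmod (h (0, y)%R / ((0, y)%R - p)) <= m * 1 * / px).
  { intros y Hy.
    assert (D1 : 1 <= Cmod ((0, y)%R - c0)) by (apply Cmod_ge_Re; rewrite Rabs_right; lra).
    assert (D2 : px <= Cmod ((0, y)%R - p)) by (apply Cmod_ge_Re; rewrite Rabs_left; lra).
    unfold h. unfold Cdiv. rewrite !Cmod_mult, Cmod_pow, !Cmod_inv by (apply Cmod_gt_0; lra).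
    assert (I1 : 0 < / Cmod ((0, y)%R - p)) by (apply Rinv_0_lt_compat; lra).
    assert (I2 : 0 < / Cmod ((0, y)%R - c0)) by (apply Rinv_0_lt_compat; lra).
    apply Rmult_le_compat; [|lra| |apply Rinv_le_contravar; lra].
    - apply Rmult_le_pos; [apply Cmod_ge_0|apply pow_le; lra].
    - apply Rmult_le_compat; [apply Cmod_ge_0|apply pow_le; lra|apply Hm; assumption|].
      rewrite <- (pow1 N). apply pow_incr. split; [lra|]. rewrite <- Rinv_1. apply Rinv_le_contravar; lra. }
  assert (Hcont : bd_cont (fun w => h w / (w - p))%C 0 (rho - 1) (V - rho) (V + rho)).
  { intros x y (Hx & Hy & Hxy). apply cont_C_mult; [apply (holo_rect_cont _ _ _ _ _ Hh); lra|].
    apply cont_C_inv_sub. intros E0; injection E0; intros; lra. }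
  destruct (bd_cont_ex _ 0 (rho - 1) (V - rho) (V + rho) ltac:(lra) ltac:(lra) Hcont) as (X1 & X2 & X3 & X4).
  set (Bf := M * (/ rho) ^ N * / (rho - rho1)) in *. set (Bn := m * 1 * / px) in *.
  assert (HBd : Cmod (bd_int (fun w => h w / (w - p))%C 0 (rho - 1) (V - rho) (V + rho)) <=
    2 * (rho - 1 - 0) * Bf + 2 * (V + rho - (V - rho)) * Bf + 2 * (rho - 1 - 0) * Bf + 2 * (V + rho - (V - rho)) * Bn).
  { unfold bd_int. apply bd_sum_bound; (apply CRInt_bound; [lra|assumption|]).
    - intros x Hx. apply Far; [lra|lra|tauto].
    - intros y Hy. apply Far; [lra|lra|tauto].
    - intros x Hx. apply Far; [lra|lra|tauto].
    - intros y Hy. apply Near; lra. }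
  rewrite E in HBd.
  assert (HB2 := Rle_trans _ _ _ (Cmod_2PI_Ci (h p)) HBd).
  assert (HBf : 0 <= Bf).
  { unfold Bf. apply Rmult_le_pos; [apply Rmult_le_pos; [assumption|apply pow_le; left; apply Rinv_0_lt_compat; lra]|left; apply Rinv_0_lt_compat; lra]. }
  assert (HBn : 0 <= Bn).
  { unfold Bn. rewrite Rmult_1_r. apply Rmult_le_pos; [assumption|left; apply Rinv_0_lt_compat; lra]. }
  assert (HB3 : Cmod (h p) <= 8 * rho * (Bf + Bn)) by nra.
  assert (EG : Cmod (G p) <= rho1 ^ N * Cmod (h p)).
  { replace (G p) with ((p - c0) ^ N * h p)%C.
    - rewrite Cmod_mult, Cmod_pow. apply Rmult_le_compat_r; [apply Cmod_ge_0|]. apply pow_incr. lra.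
    - unfold h. transitivity (G p * ((p - c0) * / (p - c0)) ^ N)%C.
      + rewrite Cpow_mult_l. ring.
      + rewrite Cinv_r by (apply Cmod_gt_0; lra). rewrite Cpow_1_l. ring. }
  eapply Rle_trans; [exact EG|].
  apply Rle_trans with (rho1 ^ N * (8 * rho * (Bf + Bn))).
  - apply Rmult_le_compat_l; [apply pow_le; lra|exact HB3].
  - right. unfold Bf, Bn, Rdiv. rewrite Rpow_mult_distr. ring.
Qed.

(** * From the imaginary axis to sectors *)

Lemma holo_rect_sub a b c d a' b' c' d' G : a <= a' -> b' <= b -> c <= c' -> d' <= d ->
  holo_rect a b c d G -> holo_rect a' b' c' d' G.
Proof. intros h1 h2 h3 h4 HG x y Hx Hy. apply HG; lra. Qed.

(** Dilation about [x0]; the sectors at [x0] become the sectors at 0, and the point 1 of the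
    imaginary axis stands for all its points. *)
Definition zoom (F : C -> C) (x0 : R) (gamma : C) (eps : R) (w : C) : C :=
  (F (x0 + eps * Re w, eps * Im w)%R - gamma)%C.

(** Reflection in the imaginary axis, conjugated so as to stay holomorphic. *)
Definition mirror (G : C -> C) (w : C) : C := Cconj (G (- Re w, Im w)%R).

Lemma diff_C_affine G p l m x y A B : diff_C G (p + l * x, m * y) A B ->
  diff_C (fun w => G (p + l * Re w, m * Im w)%R) (x, y) (RtoC l * A) (RtoC m * B).
Proof.
  intros [H1 H2].
  assert (A1 := differentiable_pt_lim_affine p l 0 x y).
  assert (A2 := differentiable_pt_lim_affine 0 0 m x y).
  assert (E1 : p + l * x = p + l * x + 0 * y) by ring.
  assert (E2 : m * y = 0 + 0 * x + m * y) by ring.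
  cbn [Re Im fst snd] in H1, H2. rewrite E1, E2 in H1, H2.
  assert (D1 := differentiable_pt_lim_comp _ (fun u v => p + l * u + 0 * v) (fun u v => 0 + 0 * u + m * v) x y _ _ _ _ _ _ H1 A1 A2).
  assert (D2 := differentiable_pt_lim_comp _ (fun u v => p + l * u + 0 * v) (fun u v => 0 + 0 * u + m * v) x y _ _ _ _ _ _ H2 A1 A2).
  split; [revert D1|revert D2]; apply differentiable_pt_lim_ext_eq;
  try (intros u v; cbn [Re Im fst snd]; do 3 f_equal; ring); unfold Re, Im; simpl; ring.
Qed.

Lemma diff_C_conj G w A B : diff_C G w A B -> diff_C (fun z => Cconj (G z)) w (Cconj A) (Cconj B).
Proof.
  intros [H1 H2]. split; [exact H1|].
  generalize (differentiable_pt_lim_lin (-1) 0 _ _ _ _ _ _ _ _ H2 H2).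
  apply differentiable_pt_lim_ext_eq; intros; unfold Re, Im; simpl; ring.
Qed.

Lemma zoom_holo a b r F x0 gamma eps L : analytic_on_rect a b r F -> 0 < eps ->
  a <= x0 - eps * L -> x0 + eps * L <= b -> eps * L <= r ->
  holo_rect (- L) L 0 L (zoom F x0 gamma eps).
Proof.
  intros HF He Ha Hb Hr x y Hx Hy.
  assert (- (eps * L) < eps * x < eps * L) by nra. assert (0 < eps * y < eps * L) by nra.
  destruct (analytic_diff a b r F HF (x0 + eps * x) (eps * y) ltac:(lra) ltac:(lra)) as [l Hl].
  exists (RtoC eps * l)%C.
  eapply diff_C_ext; [| | |apply (diff_C_minus _ _ _ _ _ _ _ (diff_C_affine F x0 eps eps x y _ _ Hl) (diff_C_const gamma (x, y)))];
  [reflexivity|ring|ring].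
Qed.

Lemma mirror_holo L c d G : holo_rect (- L) L c d G -> holo_rect (- L) L c d (mirror G).
Proof.
  intros HG x y Hx Hy. destruct (HG (- x) y ltac:(lra) Hy) as [l Hl].
  exists (- Cconj l)%C.
  assert (Hl' : diff_C G (0 + -1 * x, 1 * y) l (Ci * l)).
  { replace (0 + -1 * x) with (- x) by ring. rewrite Rmult_1_l. exact Hl. }
  eapply diff_C_ext; [| | |apply (diff_C_conj _ _ _ _ (diff_C_affine G 0 (-1) 1 x y _ _ Hl'))].
  - intros w. unfold mirror. do 3 f_equal; ring.
  - unfold Cconj, RtoC, Copp, Cmult; simpl. f_equal; ring.
  - unfold Cconj, RtoC, Ci, Copp, Cmult; simpl. f_equal; ring.
Qed.

(** The families are indexed by the scale, and only small scales matter. *)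
Definition locally_bounded_family (G : R -> C -> C) : Prop :=
  forall L y0, 0 < L -> 0 < y0 -> exists M e0, 0 <= M /\ 0 < e0 /\ forall e, 0 < e < e0 ->
    holo_rect (- L) L 0 L (G e) /\
    forall x y, Rabs x <= L -> y0 <= y <= L -> Cmod (G e (x, y)) <= M.

Definition vanishes_on_axis (G : R -> C -> C) : Prop :=
  forall v0 v1 eta, 0 < v0 -> 0 < eta -> exists e0, 0 < e0 /\ forall e, 0 < e < e0 ->
    forall v, v0 <= v <= v1 -> Cmod (G e (0, v)) <= eta.

Lemma family_lipschitz G : locally_bounded_family G -> exists Lam e0, 0 <= Lam /\ 0 < e0 /\ forall e, 0 < e < e0 ->
  forall x y, Rabs x <= 1 / 4 -> Rabs (y - 1) <= 1 / 4 ->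
    Cmod (G e (x, y) - G e (0, 1)) <= Lam * (Rabs x + Rabs (y - 1)).
Proof.
  intros HB. destruct (HB 2 (1 / 2) ltac:(lra) ltac:(lra)) as (M & e0 & HM & He0 & HG).
  exists (16 * M / (1 / 4)), e0. split; [lra|]. split; [assumption|]. intros e He x y Hx Hy.
  destruct (HG e He) as [Hh Hb].
  eapply Rle_trans; [apply (holo_lipschitz (-2) 2 0 2 (G e) 0 1 (1 / 4) M Hh); try lra|].
  - intros u v Hu Hv. rewrite Rminus_0_r in Hu. apply Rabs_le_between in Hv. apply Hb; lra.
  - rewrite Rminus_0_r. assumption.
  - apply Rmult_le_compat_l; [lra|].
    eapply Rle_trans; [apply Cmod_le_Rabs|]. cbn [Re Im fst snd Cminus Cplus Copp].
    replace (x + - 0) with x by ring. unfold Rminus. lra.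
Qed.

Lemma pow_small q B eta : 0 <= q < 1 -> 0 <= B -> 0 < eta -> exists N, q ^ N * B <= eta.
Proof.
  intros Hq HB He. destruct (pow_lt_1_zero q) with (y := eta / (B + 1)) as [N HN].
  - rewrite Rabs_right; lra.
  - apply Rdiv_lt_0_compat; lra.
  - exists N. specialize (HN N (le_n N)). rewrite Rabs_right in HN by (apply Rle_ge, pow_le; lra).
    apply Rle_trans with (eta / (B + 1) * B); [apply Rmult_le_compat_r; lra|].
    apply Rmult_le_reg_r with (B + 1); [lra|]. replace (eta / (B + 1) * B * (B + 1)) with (eta * B) by (field; lra). nra.
Qed.

Lemma Cmod_triangle_sub (x y : C) : Cmod x <= Cmod y + Cmod (x - y).
Proof. replace x with (y + (x - y))%C at 1 by ring. apply Cmod_triangle. Qed.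

(** Close to the imaginary axis the Lipschitz bound applies.  Elsewhere a disc with centre
    [-1 + i V], [V = 4 / s0], contains the given arc and lies in the upper half-plane; in the part of
    the circumscribed rectangle to the right of the axis, the weight of [carleman] is smaller on
    the far sides than inside the disc, by a factor [rho1 / rho]. *)
Lemma right_sector_limit G s0 eta : locally_bounded_family G -> vanishes_on_axis G -> 0 < s0 <= 1 -> 0 < eta ->
  exists e0, 0 < e0 /\ forall e, 0 < e < e0 -> forall px py, 0 <= px -> s0 <= py -> px ^ 2 + py ^ 2 = 1 ->
    Cmod (G e (px, py)) <= eta.
Proof.
  intros HB HV Hs Heta.
  destruct (family_lipschitz G HB) as (Lam & e2 & HLam & He2 & HG2).
  set (kap := Rmin (1 / 8) (eta / (4 * (Lam + 1)))).
  assert (Hkap : 0 < kap) by (apply Rmin_pos; [lra|apply Rdiv_lt_0_compat; lra]).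
  assert (Hkap1 : kap <= 1 / 8) by apply Rmin_l.
  assert (Hkap2 : Lam * (2 * kap) <= eta / 2).
  { assert (kap <= eta / (4 * (Lam + 1))) by apply Rmin_r.
    assert ((Lam + 1) * kap <= eta / 4).
    { replace (eta / 4) with ((Lam + 1) * (eta / (4 * (Lam + 1)))) by (field; lra). apply Rmult_le_compat_l; lra. }
    lra. }
  set (V := 4 / s0).
  assert (HVs : V * s0 = 4) by (unfold V; field; lra).
  assert (HV4 : 4 <= V) by nra.
  set (rho := sqrt (V ^ 2 - 2)). set (rho1 := sqrt (V ^ 2 - 4)).
  assert (Hr2 : rho ^ 2 = V ^ 2 - 2) by (apply pow2_sqrt; nra).
  assert (Hr12 : rho1 ^ 2 = V ^ 2 - 4) by (apply pow2_sqrt; nra).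
  assert (Hr1 : 0 < rho1) by (apply sqrt_lt_R0; nra).
  assert (Hrr : rho1 < rho) by (apply sqrt_lt_1_alt; nra).
  assert (HrV : rho < V) by nra.
  assert (Hr : 1 < rho) by nra.
  destruct (HB (2 * V + 2) (V - rho) ltac:(lra) ltac:(lra)) as (M & e1 & HM & He1 & HG1).
  destruct (pow_small (rho1 / rho) (8 * rho * M / (rho - rho1)) (eta / 2)) as [N HN]; [| |lra|].
  { split; [left; apply Rdiv_lt_0_compat; lra|]. apply Rmult_lt_reg_r with rho; [lra|].
    unfold Rdiv; rewrite Rmult_assoc, Rinv_l; lra. }
  { apply Rmult_le_pos; [apply Rmult_le_pos; lra|left; apply Rinv_0_lt_compat; lra]. }
  assert (Hp1 : 0 < rho1 ^ N) by (apply pow_lt; assumption).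
  set (m := eta / 2 * kap / (8 * rho * rho1 ^ N)).
  assert (Hden : 0 < 8 * rho * rho1 ^ N) by (apply Rmult_lt_0_compat; lra).
  assert (Hm : 0 < m) by (unfold m; apply Rdiv_lt_0_compat; [apply Rmult_lt_0_compat; lra|assumption]).
  destruct (HV (V - rho) (V + rho) m ltac:(lra) Hm) as (e3 & He3 & HG3).
  destruct (HV 1 1 (eta / 2) ltac:(lra) ltac:(lra)) as (e4 & He4 & HG4).
  destruct (common_lower_bound e1 e2 e3 e4 He1 He2 He3 He4) as (e0 & He0 & q1 & q2 & q3 & q4).
  exists e0. split; [assumption|]. intros e He px py Hpx Hpy Hp.
  destruct (HG1 e ltac:(lra)) as [Hh1 Hb1]. assert (HL := HG2 e ltac:(lra)).
  specialize (HG3 e ltac:(lra)). specialize (HG4 e ltac:(lra)).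
  destruct (Rle_lt_dec px kap) as [Hk|Hk].
  - assert (Hpy1 : py <= 1) by nra.
    assert (H1py : 1 - py <= px ^ 2).
    { replace (px ^ 2) with ((1 - py) * (1 + py)) by lra. rewrite <- (Rmult_1_r (1 - py)) at 1.
      apply Rmult_le_compat_l; lra. }
    assert (Hpxx : px ^ 2 <= px) by (apply Rle_trans with (1 * px); [simpl; rewrite Rmult_1_r; apply Rmult_le_compat_r|]; lra).
    specialize (HL px py ltac:(rewrite Rabs_right; lra) ltac:(apply Rabs_le; lra)).
    rewrite (Rabs_right px), (Rabs_left1 (py - 1)) in HL by lra.
    specialize (HG4 1 ltac:(lra)).
    assert (T := Cmod_triangle_sub (G e (px, py)) (G e (0, 1))).
    assert (Lam * (px + - (py - 1)) <= Lam * (2 * kap)) by (apply Rmult_le_compat_l; lra).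
    lra.
  - assert (Hcar := carleman (- (1 / 2)) (2 * V + 2) 0 (2 * V + 2) (G e) V rho rho1 M m px py N).
    eapply Rle_trans; [apply Hcar; try lra|].
    + apply (holo_rect_sub (- (2 * V + 2)) (2 * V + 2) 0 (2 * V + 2)); trivial; lra.
    + intros x y Hx Hy. apply Hb1; [apply Rabs_le; lra|lra].
    + exact HG3.
    + assert (px <= 1) by nra. assert (V * s0 <= V * py) by (apply Rmult_le_compat_l; lra). nra.
    + rewrite Rmult_plus_distr_l.
      assert (T1 : 8 * rho * (rho1 ^ N * m / px) <= eta / 2).
      { apply Rle_trans with (8 * rho * (rho1 ^ N * m / kap)).
        - apply Rmult_le_compat_l; [lra|]. apply Rmult_le_compat_l; [apply Rmult_le_pos; lra|].
          apply Rinv_le_contravar; lra.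
        - right. unfold m. field. repeat split; lra. }
      assert (T2 : 8 * rho * ((rho1 / rho) ^ N * M / (rho - rho1)) <= eta / 2).
      { eapply Rle_trans; [|exact HN]. right. unfold Rdiv. ring. }
      lra.
Qed.

Lemma sector_limit G s0 eta : locally_bounded_family G -> vanishes_on_axis G -> 0 < s0 <= 1 -> 0 < eta ->
  exists e0, 0 < e0 /\ forall e, 0 < e < e0 -> forall px py, s0 <= py -> px ^ 2 + py ^ 2 = 1 ->
    Cmod (G e (px, py)) <= eta.
Proof.
  intros HB HV Hs Heta.
  assert (HB' : locally_bounded_family (fun e => mirror (G e))).
  { intros L y0 HL Hy0. destruct (HB L y0 HL Hy0) as (M & e0 & HM & He0 & HH). exists M, e0.
    split; [assumption|]. split; [assumption|]. intros e He. destruct (HH e He) as [H1 H2].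
    split; [apply mirror_holo, H1|]. intros x y Hx Hy. unfold mirror. rewrite Cmod_conj. simpl.
    apply H2; [rewrite Rabs_Ropp; assumption|assumption]. }
  assert (HV' : vanishes_on_axis (fun e => mirror (G e))).
  { intros v0 v1 et Hv0 Het. destruct (HV v0 v1 et Hv0 Het) as (e0 & He0 & HH). exists e0.
    split; [assumption|]. intros e He v Hv. unfold mirror. rewrite Cmod_conj. simpl. rewrite Ropp_0.
    apply HH; assumption. }
  destruct (right_sector_limit G s0 eta HB HV Hs Heta) as (e1 & He1 & H1).
  destruct (right_sector_limit _ s0 eta HB' HV' Hs Heta) as (e2 & He2 & H2).
  exists (Rmin e1 e2). split; [apply Rmin_pos; assumption|]. intros e He px py Hpy Hp.
  assert (q1 := Rmin_l e1 e2). assert (q2 := Rmin_r e1 e2).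
  destruct (Rle_lt_dec 0 px) as [Hpx|Hpx]; [apply H1; trivial; lra|].
  specialize (H2 e ltac:(lra) (- px) py ltac:(lra) Hpy ltac:(lra)).
  unfold mirror in H2. rewrite Cmod_conj in H2. simpl in H2. rewrite Ropp_involutive in H2. exact H2.
Qed.

(** * The angular limit *)

(** The bound is homogeneous of degree 0 about [x0], hence uniform in the scale. *)
Lemma zoom_growth F x0 gamma n K del e x y : grows_at F x0 n K del -> 0 < e -> e * Rabs x <= del -> 0 < y -> e * y <= del ->
  Cmod (zoom F x0 gamma e (x, y)) * y ^ n <= K * (Rabs x + y) ^ n + Cmod gamma * y ^ n.
Proof.
  intros HG He Hx Hy Hey. unfold zoom. cbn [Re Im fst snd].
  assert (G := HG (x0 + e * x) (e * y)). replace (x0 + e * x - x0) with (e * x) in G by ring.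
  rewrite Rabs_mult, (Rabs_right e) in G by lra.
  specialize (G Hx ltac:(split; [apply Rmult_lt_0_compat|]; assumption)).
  rewrite <- Rmult_plus_distr_l, !Rpow_mult_distr in G.
  assert (Hen : 0 < e ^ n) by (apply pow_lt; lra).
  apply Rle_trans with ((Cmod (F ((x0 + e * x)%R, (e * y)%R)) + Cmod gamma) * y ^ n).
  - apply Rmult_le_compat_r; [apply pow_le; lra|]. rewrite <- (Cmod_opp gamma). apply Cmod_triangle.
  - rewrite Rmult_plus_distr_r. apply Rplus_le_compat_r. apply Rmult_le_reg_l with (e ^ n); [assumption|]. lra.
Qed.

Lemma zoom_locally_bounded a b r F x0 gamma n K del : analytic_on_rect a b r F -> 0 <= K -> 0 < del ->
  a < x0 - del -> x0 + del < b -> del < r -> grows_at F x0 n K del -> locally_bounded_family (zoom F x0 gamma).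
Proof.
  intros HF HK Hdel Hda Hdb Hdr HG L y0 HL Hy0.
  exists (K * (2 * L / y0) ^ n + Cmod gamma), (del / L).
  assert (Hq : 0 < 2 * L / y0) by (apply Rdiv_lt_0_compat; lra).
  split; [apply Rplus_le_le_0_compat; [apply Rmult_le_pos; [assumption|apply pow_le; lra]|apply Cmod_ge_0]|].
  split; [apply Rdiv_lt_0_compat; assumption|]. intros e [He0 He]. apply Rlt_div_r in He; [|assumption].
  split; [apply (zoom_holo a b r); trivial; lra|].
  intros x y Hx Hy.
  assert (HZ := zoom_growth F x0 gamma n K del e x y HG He0).
  apply Rmult_le_reg_r with (y ^ n); [apply pow_lt; lra|].
  eapply Rle_trans; [apply HZ; [|lra|]|].
  - apply Rle_trans with (e * L); [apply Rmult_le_compat_l|]; lra.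
  - apply Rle_trans with (e * L); [apply Rmult_le_compat_l|]; lra.
  - rewrite Rmult_plus_distr_r, (Rmult_assoc K), <- Rpow_mult_distr. apply Rplus_le_compat_r, Rmult_le_compat_l; [assumption|].
    apply pow_incr. split; [generalize (Rabs_pos x); lra|].
    apply Rle_trans with (2 * L / y0 * y0); [replace (2 * L / y0 * y0) with (2 * L) by (field; lra)|apply Rmult_le_compat_l]; lra.
Qed.

Lemma RInt_gen_support (f : R -> R) (Fa Fb : (R -> Prop) -> Prop) {FFa : ProperFilter Fa} {FFb : ProperFilter Fb} c d :
  c <= d -> Fa (fun x => x <= c) -> Fb (fun x => d <= x) ->
  (forall x, x < c \/ d < x -> f x = 0) -> ex_RInt f c d -> RInt_gen f Fa Fb = RInt f c d.
Proof.
  intros Hcd Ha Hb H0 He.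
  assert (HI : is_RInt_gen f Fa Fb (RInt f c d)).
  { intros P HP. unfold filtermapi.
    apply Filter_prod with (Q := fun x => x <= c) (R := fun x => d <= x); trivial.
    intros u v Hu Hv. exists (RInt f c d). split; [|apply (locally_singleton _ _ HP)]. simpl.
    assert (HC := CRInt_support (fun x => RtoC (f x)) u v c d Hu Hcd Hv).
    destruct HC as [HC1 HC2].
    - intros x Hx. rewrite H0 by lra. reflexivity.
    - split; [exact He|exact (ex_RInt_const (V := R_NormedModule) c d 0)].
    - assert (E : RInt f u v = RInt f c d) by exact (f_equal fst HC2). rewrite <- E.
      apply (RInt_correct (V := R_CompleteNormedModule)). exact (proj1 HC1). }
  apply is_RInt_gen_unique. exact HI.
Qed.

Lemma CRInt_gen_support (h : R -> C) (Fa Fb : (R -> Prop) -> Prop) {FFa : ProperFilter Fa} {FFb : ProperFilter Fb} c d :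
  c <= d -> Fa (fun x => x <= c) -> Fb (fun x => d <= x) ->
  (forall x, x < c \/ d < x -> h x = 0%C) -> ex_CRInt h c d -> CRInt_gen h Fa Fb = CRInt h c d.
Proof.
  intros Hcd Ha Hb H0 [H1 H2]. unfold CRInt_gen, CRInt. f_equal; apply RInt_gen_support; trivial;
  intros x Hx; rewrite H0 by assumption; reflexivity.
Qed.

Lemma at_right_0_le c : 0 < c -> at_right 0 (fun x => x <= c).
Proof. intros Hc. apply at_right_0. exists c. split; [assumption|]. intros; lra. Qed.

Lemma p_infty_ge d : Rbar_locally p_infty (fun x => d <= x).
Proof. exists d. intros; lra. Qed.

Lemma m_infty_le c : Rbar_locally m_infty (fun x => x <= c).
Proof. exists c. intros; lra. Qed.

Section Axis.
Variables (F : C -> C) (x0 : R) (gamma : C).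
Hypothesis HB : locally_bounded_family (zoom F x0 gamma).
Hypothesis Hrad : radial_dist_limit F x0 gamma.

(** The functions [y |-> F (x0, e y)] are equicontinuous near [y = 1], so testing against a narrow
    bump at 1 recovers their value there. *)
Lemma radial_limit eta : 0 < eta -> exists e0, 0 < e0 /\ forall e, 0 < e < e0 -> Cmod (F (x0, e) - gamma) <= eta.
Proof.
  intros Heta.
  destruct (family_lipschitz _ HB) as (Lam & e2 & HLam & He2 & HG2).
  destruct (HB 2 (1 / 2) ltac:(lra) ltac:(lra)) as (M3 & e3 & _ & He3 & HG3).
  set (tau := Rmin (1 / 4) (eta / (4 * (Lam + 1)))).
  assert (Htau : 0 < tau) by (apply Rmin_pos; [lra|apply Rdiv_lt_0_compat; lra]).
  assert (Htau1 : tau <= 1 / 4) by apply Rmin_l.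
  assert (Htau2 : 2 * (Lam * tau) <= eta / 2).
  { assert (tau <= eta / (4 * (Lam + 1))) by apply Rmin_r.
    assert ((Lam + 1) * tau <= eta / 4).
    { replace (eta / 4) with ((Lam + 1) * (eta / (4 * (Lam + 1)))) by (field; lra). apply Rmult_le_compat_l; lra. }
    lra. }
  set (u := bump (1 - tau) (1 + tau)).
  assert (Hu : smooth_R u) by apply smooth_R_bump.
  assert (Hu0 : forall x, x < 1 - tau \/ 1 + tau < x -> u x = 0) by (intros x Hx; apply bump_zero; lra).
  assert (Hui : ex_RInt u (1 - tau) (1 + tau)) by (apply (ex_RInt_continuous (V := R_CompleteNormedModule)); intros; apply smooth_R_continuous, Hu).
  set (ct := RInt u (1 - tau) (1 + tau)).
  assert (Hct : 0 < ct).
  { apply RInt_gt_0; [lra| |].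
    - intros x Hx. apply bump_pos, Hx.
    - intros x _. apply smooth_R_continuous, Hu. }
  assert (Htf : test_function 0 p_infty (fun x => RtoC (u x))).
  { split.
    - apply smooth_iff. split; [exact Hu|exact (smooth_R_const 0)].
    - exists (1 - tau), (1 + tau). split; [simpl; lra|]. split; [exact I|].
      intros x Hx. rewrite Hu0 by assumption. reflexivity. }
  destruct (proj1 (filterlim_at_right_0 _ _) (Hrad _ Htf) (ct * (eta / 2))) as (e1 & He1 & HL); [apply Rmult_lt_0_compat; lra|].
  destruct (common_lower_bound e1 e2 e3 1 He1 He2 He3 Rlt_0_1) as (e0 & He0 & q1 & q2 & q3 & _).
  exists e0. split; [assumption|]. intros e He.
  specialize (HL e ltac:(lra)). assert (HL2 := HG2 e ltac:(lra)). destruct (HG3 e ltac:(lra)) as [Hh2 _].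
  set (Z := zoom F x0 gamma e) in *.
  assert (HZ : forall y, Z (0, y) = (F (x0, (e * y)%R) - gamma)%C).
  { intros y. unfold Z, zoom. simpl Re; simpl Im. rewrite Rmult_0_r, Rplus_0_r. reflexivity. }
  assert (HLip : forall y, Rabs (y - 1) <= tau -> Cmod (Z (0, y) - Z (0, 1)) <= Lam * tau).
  { intros y Hy. eapply Rle_trans; [apply HL2; [rewrite Rabs_R0|]; lra|].
    apply Rmult_le_compat_l; [assumption|]. rewrite Rabs_R0. lra. }
  assert (HZc : forall y, 1 - tau <= y <= 1 + tau -> cont_C Z (0, y)).
  { intros y Hy. apply (holo_rect_cont _ _ _ _ _ Hh2); lra. }
  assert (HZi : ex_CRInt (fun y => Z (0, y) * RtoC (u y))%C (1 - tau) (1 + tau)).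
  { apply (ex_CRInt_ver (fun w => Z w * RtoC (u (Im w)))%C 0); [lra|]. intros y Hy.
    apply cont_C_mult; [apply HZc, Hy|]. split; simpl.
    - apply (continuity_1d_2d_pt_comp u (fun _ y => y)); [|apply continuity_2d_pt_id2].
      apply continuity_pt_filterlim, smooth_R_continuous, Hu.
    - apply continuity_2d_pt_const. }
  assert (Huc : ex_CRInt (fun y => RtoC (u y)) (1 - tau) (1 + tau)) by (split; [exact Hui|exact (ex_RInt_const (V := R_NormedModule) _ _ 0)]).
  assert (HFi : ex_CRInt (fun y => F (x0, (e * y)%R) * RtoC (u y))%C (1 - tau) (1 + tau)).
  { apply ex_CRInt_ext with (fun y => Z (0, y) * RtoC (u y) + gamma * RtoC (u y))%C; [lra| |].
    - intros y _. rewrite HZ. ring.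
    - apply (ex_CRInt_plus (fun y => Z (0, y) * RtoC (u y))%C (fun y => gamma * RtoC (u y))%C); [exact HZi|].
      apply ex_CRInt_scal, Huc. }
  rewrite (CRInt_gen_support (fun y => F (x0, (e * y)%R) * RtoC (u y))%C _ _ (1 - tau) (1 + tau)) in HL;
    [|lra|apply at_right_0_le; lra|apply p_infty_ge|intros x Hx; rewrite Hu0 by assumption; apply Cmult_0_r|exact HFi].
  rewrite (CRInt_gen_support (fun y => RtoC (u y)) _ _ (1 - tau) (1 + tau)) in HL;
    [|lra|apply at_right_0_le; lra|apply p_infty_ge|intros x Hx; rewrite Hu0 by assumption; reflexivity|exact Huc].
  assert (E : (CRInt (fun y => F (x0, (e * y)%R) * RtoC (u y))%C (1 - tau)%R (1 + tau)%R - gamma * CRInt (fun y => RtoC (u y)) (1 - tau)%R (1 + tau)%R)%C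
    = CRInt (fun y => Z (0, y) * RtoC (u y))%C (1 - tau) (1 + tau)).
  { rewrite <- (CRInt_scal gamma _ _ _ Huc), <- (CRInt_minus (fun y => F (x0, (e * y)%R) * RtoC (u y))%C (fun y => gamma * RtoC (u y))%C);
      [|exact HFi|apply ex_CRInt_scal, Huc].
    apply CRInt_ext; [lra|]. intros y _. rewrite HZ. ring. }
  rewrite E in HL.
  assert (HD : Cmod (CRInt (fun y => Z (0, y) * RtoC (u y) - Z (0, 1)%R * RtoC (u y))%C (1 - tau) (1 + tau)) <= 2 * (Lam * tau * ct)).
  { unfold ct. rewrite <- RInt_Rscal by exact Hui. apply CRInt_le; [lra| | |].
    - apply (ex_CRInt_minus (fun y => Z (0, y) * RtoC (u y))%C (fun y => Z (0, 1)%R * RtoC (u y))%C); [exact HZi|apply ex_CRInt_scal, Huc].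
    - apply (ex_RInt_scal (V := R_NormedModule)), Hui.
    - intros y Hy. replace (Z (0, y)%R * RtoC (u y) - Z (0, 1)%R * RtoC (u y))%C with ((Z (0, y)%R - Z (0, 1)%R) * RtoC (u y))%C by ring.
      rewrite Cmod_mult, Cmod_R, (Rabs_right (u y)) by (apply Rle_ge, bump_nonneg).
      apply Rmult_le_compat_r; [apply bump_nonneg|]. apply HLip. apply Rabs_le; lra. }
  rewrite (CRInt_minus (fun y => Z (0, y) * RtoC (u y))%C (fun y => Z (0, 1)%R * RtoC (u y))%C) in HD; [|exact HZi|apply ex_CRInt_scal, Huc].
  rewrite CRInt_scal in HD by exact Huc. rewrite CRInt_RtoC in HD. fold ct in HD.
  assert (HZ1 : Z (0, 1)%R = (F (x0, e) - gamma)%C) by (rewrite HZ, Rmult_1_r; reflexivity).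
  rewrite <- HZ1.
  set (I0 := CRInt (fun y => Z (0, y) * RtoC (u y))%C (1 - tau) (1 + tau)) in *.
  assert (T : Cmod (Z (0, 1)%R * RtoC ct) <= Cmod I0 + Cmod (I0 - Z (0, 1)%R * RtoC ct)).
  { replace (Z (0, 1)%R * RtoC ct)%C with (I0 + - (I0 - Z (0, 1)%R * RtoC ct))%C at 1 by ring.
    eapply Rle_trans; [apply Cmod_triangle|]. rewrite Cmod_opp. lra. }
  rewrite Cmod_mult, Cmod_R, (Rabs_right ct) in T by lra.
  apply Rmult_le_reg_r with ct; [assumption|].
  assert (2 * (Lam * tau) * ct <= eta / 2 * ct) by (apply Rmult_le_compat_r; lra). lra.
Qed.

Lemma zoom_vanishes_on_axis : vanishes_on_axis (zoom F x0 gamma).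
Proof.
  intros v0 v1 eta Hv0 Heta. destruct (radial_limit eta Heta) as (e1 & He1 & HH).
  assert (Hv : 0 < Rabs v1 + 1) by (generalize (Rabs_pos v1); lra).
  exists (e1 / (Rabs v1 + 1)). split; [apply Rdiv_lt_0_compat; assumption|].
  intros e [He0 He] v Hvv. unfold zoom. simpl Re; simpl Im. rewrite Rmult_0_r, Rplus_0_r. apply HH.
  split; [apply Rmult_lt_0_compat; lra|]. apply Rlt_div_r in He; [|assumption].
  apply Rle_lt_trans with (e * (Rabs v1 + 1)); [|assumption].
  apply Rmult_le_compat_l; [lra|]. generalize (Rle_abs v1); lra.
Qed.

Theorem angular_limit_of_radial : angular_limit F x0 gamma.
Proof.
  intros theta Hth. apply filterlim_C_eps; [apply within_filter, locally_filter|]. intros eta Heta.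
  assert (Hs : 0 < sin theta <= 1) by (split; [apply sin_gt_0; generalize PI_RGT_0; lra|apply SIN_bound]).
  destruct (sector_limit (zoom F x0 gamma) (sin theta) (eta / 2) HB zoom_vanishes_on_axis Hs ltac:(lra)) as (e0 & He0 & HH).
  assert (He2 : 0 < e0 / 2) by lra.
  exists (mkposreal _ He2). intros z [Hz1 Hz2] (rho & t & Hrho & Ht & ->).
  unfold ball in Hz1, Hz2; simpl in Hz1, Hz2. unfold AbsRing_ball, abs, minus, plus, opp in Hz1, Hz2; simpl in Hz1, Hz2.
  replace (x0 + rho * cos t + - x0) with (rho * cos t) in Hz1 by ring.
  replace (rho * sin t + - 0) with (rho * sin t) in Hz2 by ring.
  assert (Hsc := sin2_cos2 t). unfold Rsqr in Hsc.
  assert (Hst : sin theta <= sin t).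
  { destruct (Rle_lt_dec t (PI / 2)) as [Ht2|Ht2].
    - apply sin_incr_1; generalize PI_RGT_0; lra.
    - rewrite <- (sin_PI_x t). apply sin_incr_1; generalize PI_RGT_0; lra. }
  assert (Hrho0 : rho < e0).
  { rewrite Rabs_mult, (Rabs_right rho) in Hz1, Hz2 by lra.
    assert (1 <= Rabs (cos t) + Rabs (sin t)).
    { assert (C1 := Rabs_pos (cos t)). assert (C2 := Rabs_pos (sin t)).
      assert (C3 := pow2_abs (cos t)). assert (C4 := pow2_abs (sin t)). nra. }
    nra. }
  specialize (HH rho ltac:(lra) (cos t) (sin t) Hst ltac:(lra)). unfold zoom in HH. simpl Re in HH; simpl Im in HH.
  eapply Rle_lt_trans; [exact HH|]. lra.
Qed.
End Axis.

(** * The point value *)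

Lemma CRInt_comp_lin (h : R -> C) u v a b : ex_CRInt h (u * a + v) (u * b + v) ->
  CRInt (fun y => RtoC u * h (u * y + v)%R)%C a b = CRInt h (u * a + v) (u * b + v).
Proof.
  intros [H1 H2]. unfold CRInt. f_equal.
  - rewrite <- (RInt_comp_lin (fun t => Re (h t)) u v a b H1). apply RInt_ext. intros x _.
    unfold scal, RtoC, Cmult, Re; simpl; unfold mult; simpl. ring.
  - rewrite <- (RInt_comp_lin (fun t => Im (h t)) u v a b H2). apply RInt_ext. intros x _.
    unfold scal, RtoC, Cmult, Im; simpl; unfold mult; simpl. ring.
Qed.

Lemma cont_C_of_C (phi : R -> C) x y : continuous (fun t => Re (phi t)) x -> continuous (fun t => Im (phi t)) x ->
  cont_C (fun w => phi (Re w)) (x, y).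
Proof.
  intros H1 H2. split; simpl.
  - apply (continuity_1d_2d_pt_comp (fun t => Re (phi t)) (fun x y => x)); [|apply continuity_2d_pt_id1].
    apply continuity_pt_filterlim, H1.
  - apply (continuity_1d_2d_pt_comp (fun t => Im (phi t)) (fun x y => x)); [|apply continuity_2d_pt_id1].
    apply continuity_pt_filterlim, H2.
Qed.

Section Taylor.
Variable phi : R -> C.
Hypothesis Hphi : smooth phi.
Variable s1 : R.

(** An almost analytic extension of [phi] off the line [Im w = s1]: its Taylor polynomial in the
    imaginary direction, as if [phi] were analytic. *)
Fixpoint taylor_mon (k : nat) (w : C) : C :=
  match k with
  | O => 1
  | S k => taylor_mon k w * (Ci * RtoC (Im w - s1)) * RtoC (/ INR (S k))
  end%C.

Fixpoint taylor_ext (N : nat) (w : C) : C :=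
  match N with
  | O => phi (Re w)
  | S k => taylor_ext k w + CDerive_n phi (S k) (Re w) * taylor_mon (S k) w
  end%C.

Lemma CDerive_n_diff k w : diff_C (fun z => CDerive_n phi k (Re z)) w (CDerive_n phi (S k) (Re w)) 0.
Proof.
  split; simpl; apply differentiable_pt_lim_proj1_0, is_derive_Reals, Derive_correct; apply (Hphi (S k)).
Qed.

Lemma CDerive_n_cont k x y : cont_C (fun z => CDerive_n phi k (Re z)) (x, y).
Proof. exact (diff_C_cont _ _ _ _ (CDerive_n_diff k (x, y))). Qed.

Lemma taylor_mon_diff k w : diff_C (taylor_mon (S k)) w 0 (Ci * taylor_mon k w).
Proof.
  assert (HT : diff_C (fun z => Ci * RtoC (Im z - s1))%C w 0 Ci).
  { split; simpl.
    - generalize (differentiable_pt_lim_const 0 (Re w) (Im w)).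
      apply differentiable_pt_lim_ext_eq; trivial. intros; ring.
    - generalize (differentiable_pt_lim_affine (- s1) 0 1 (Re w) (Im w)).
      apply differentiable_pt_lim_ext_eq; trivial. intros; ring. }
  induction k as [|k IH].
  - apply diff_C_ext with (fun z => Ci * RtoC (Im z - s1))%C (RtoC 0) Ci; trivial.
    + intros z. simpl. rewrite Rinv_1. ring.
    + simpl. ring.
  - assert (HM := diff_C_mult _ _ _ _ _ _ _ (diff_C_mult _ _ _ _ _ _ _ IH HT) (diff_C_const (RtoC (/ INR (S (S k)))) w)).
    eapply diff_C_ext; [| | |exact HM].
    + intros z. reflexivity.
    + cbv beta. ring.
    + cbv beta. change (taylor_mon (S k) w) with (taylor_mon k w * (Ci * RtoC (Im w - s1)) * RtoC (/ INR (S k)))%C.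
      set (t := (Ci * RtoC (Im w - s1))%C). set (m := taylor_mon k w).
      assert (E : RtoC (/ INR (S (S k))) = (/ (RtoC (INR (S k)) + 1))%C).
      { rewrite RtoC_inv by (apply not_0_INR; lia). rewrite (S_INR (S k)), RtoC_plus. reflexivity. }
      assert (E' : RtoC (/ INR (S k)) = (/ RtoC (INR (S k)))%C) by (apply RtoC_inv, not_0_INR; lia).
      rewrite E, E'.
      assert (N1 : RtoC (INR (S k)) <> 0%C) by (intros E0; apply RtoC_inj in E0; revert E0; apply not_0_INR; lia).
      assert (N2 : (RtoC (INR (S k)) + 1)%C <> 0%C).
      { rewrite <- RtoC_plus, <- S_INR. intros E0; apply RtoC_inj in E0; revert E0; apply not_0_INR; lia. }
      field. split; assumption.
Qed.

(** The sum telescopes: the Cauchy-Riemann derivative is a single term of order [N] in the distance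
    to the line. *)
Lemma taylor_ext_diff N w : exists A B, diff_C (taylor_ext N) w A B /\
  (Ci * A - B = Ci * (CDerive_n phi (S N) (Re w) * taylor_mon N w))%C.
Proof.
  induction N as [|N (A & B & HD & HE)].
  - exists (CDerive_n phi 1 (Re w)), (RtoC 0). split.
    + apply diff_C_ext with (fun z => CDerive_n phi 0 (Re z)) (CDerive_n phi 1 (Re w)) (RtoC 0); trivial.
      * intros z. apply injective_projections; reflexivity.
      * apply CDerive_n_diff.
    + simpl. ring.
  - assert (HM := diff_C_plus _ _ _ _ _ _ _ HD (diff_C_mult _ _ _ _ _ _ _ (CDerive_n_diff (S N) w) (taylor_mon_diff N w))).
    eexists; eexists. split; [exact HM|].
    match goal with |- ?l = ?r => transitivity ((Ci * A - B) + Ci * (taylor_mon (S N) w * CDerive_n phi (S (S N)) (Re w)) - CDerive_n phi (S N) (Re w) * (Ci * taylor_mon N w))%C end.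
    + ring.
    + rewrite HE. ring.
Qed.

Lemma taylor_mon_bound k w : s1 <= Im w -> Cmod (taylor_mon k w) <= (Im w - s1) ^ k.
Proof.
  intros Hw. induction k as [|k IH]; [simpl; rewrite Cmod_1; lra|].
  change (taylor_mon (S k) w) with (taylor_mon k w * (Ci * RtoC (Im w - s1)) * RtoC (/ INR (S k)))%C.
  rewrite !Cmod_mult, Cmod_Ci, !Cmod_R, Rmult_1_l, (Rabs_right (Im w - s1)) by lra.
  assert (H1 : 1 <= INR (S k)) by (rewrite S_INR; generalize (pos_INR k); lra).
  rewrite Rabs_right by (left; apply Rinv_0_lt_compat; lra).
  assert (H2 : / INR (S k) <= 1) by (rewrite <- Rinv_1; apply Rinv_le_contravar; lra).
  assert (H3 := Cmod_ge_0 (taylor_mon k w)).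
  assert (H0 : 0 < / INR (S k)) by (apply Rinv_0_lt_compat; lra).
  rewrite <- (Rmult_1_r ((Im w - s1) ^ S k)).
  apply Rmult_le_compat; [apply Rmult_le_pos; lra|lra| |assumption].
  simpl. rewrite Rmult_comm. apply Rmult_le_compat_l; lra.
Qed.

Lemma taylor_ext_on_line N x : taylor_ext N (x, s1) = phi x.
Proof.
  induction N as [|N IH]; [reflexivity|]. simpl taylor_ext. rewrite IH.
  rewrite Rminus_diag. ring.
Qed.

Lemma taylor_ext_bound Kp N w : (forall k, (k <= N)%nat -> Cmod (CDerive_n phi k (Re w)) <= Kp) -> s1 <= Im w <= s1 + 1 ->
  Cmod (taylor_ext N w) <= INR (S N) * Kp.
Proof.
  intros HK Hw. assert (HKp : 0 <= Kp) by (eapply Rle_trans; [apply Cmod_ge_0|apply (HK 0%nat); lia]).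
  induction N as [|N IH].
  - simpl. rewrite Rmult_1_l. eapply Rle_trans; [|apply (HK 0%nat (le_n _))]. right. f_equal.
    apply injective_projections; reflexivity.
  - change (taylor_ext (S N) w) with (taylor_ext N w + CDerive_n phi (S N) (Re w) * taylor_mon (S N) w)%C.
    eapply Rle_trans; [apply Cmod_triangle|]. rewrite (S_INR (S N)), Rmult_plus_distr_r, Rmult_1_l.
    apply Rplus_le_compat; [apply IH; intros; apply HK; lia|].
    rewrite Cmod_mult, <- (Rmult_1_r Kp). apply Rmult_le_compat; try apply Cmod_ge_0; [apply HK; lia|].
    eapply Rle_trans; [apply taylor_mon_bound; lra|]. rewrite <- (pow1 (S N)). apply pow_incr. lra.
Qed.

Lemma CDerive_n_out c d k x : supported_in c d phi -> x < c \/ d < x -> CDerive_n phi k x = 0%C.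
Proof.
  intros Hs Hx. destruct (proj1 (smooth_iff phi) Hphi) as [H1 H2]. unfold CDerive_n.
  rewrite (test_R_Derive_n_out c d (fun t => Re (phi t)) k x); [|split; [exact H1|]|exact Hx].
  - rewrite (test_R_Derive_n_out c d (fun t => Im (phi t)) k x); [reflexivity| |exact Hx].
    split; [exact H2|]. intros y Hy. rewrite Hs by assumption. reflexivity.
  - intros y Hy. rewrite Hs by assumption. reflexivity.
Qed.

Lemma taylor_ext_out c d N w : supported_in c d phi -> Re w < c \/ d < Re w -> taylor_ext N w = 0%C.
Proof.
  intros Hs Hx. induction N as [|N IH]; [apply Hs, Hx|].
  simpl taylor_ext. rewrite IH, (CDerive_n_out c d) by assumption. ring.
Qed.

Lemma CDerive_n_bounded N c d : exists Kp, 0 <= Kp /\ forall k x, (k <= N)%nat -> c <= x <= d -> Cmod (CDerive_n phi k x) <= Kp.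
Proof.
  destruct (proj1 (smooth_iff phi) Hphi) as [H1 H2].
  destruct (ubd_derivs_bound _ (fun (_ : unit) => fun t => Re (phi t)) (fun k => smooth_R_ubd c d k _ H1) N) as (K1 & P1 & B1).
  destruct (ubd_derivs_bound _ (fun (_ : unit) => fun t => Im (phi t)) (fun k => smooth_R_ubd c d k _ H2) N) as (K2 & P2 & B2).
  exists (K1 + K2). split; [lra|]. intros k x Hk Hx. eapply Rle_trans; [apply Cmod_le_Rabs|].
  apply Rplus_le_compat; [apply (B1 tt k x Hk Hx)|apply (B2 tt k x Hk Hx)].
Qed.

(** Moving the line of integration up: the factor [(Im w - s1)^N] of the area term absorbs
    the growth of [G] at the real axis. *)
Lemma line_shift G L h N c d C1 Kp mu : 0 < L -> - L < c -> d < L -> supported_in c d phi ->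
  holo_rect (- (2 * L)) (2 * L) 0 2 G -> 0 < s1 < h -> h <= 1 -> 0 <= C1 ->
  (forall k x, (k <= S N)%nat -> - L <= x <= L -> Cmod (CDerive_n phi k x) <= Kp) ->
  (forall x s, - L <= x <= L -> 0 < s <= 1 -> Cmod (G (x, s)) * s ^ N <= C1) ->
  (forall x, - L <= x <= L -> Cmod (G (x, h)) <= mu) ->
  Cmod (CRInt (fun x => G (x, s1) * phi x)%C (- L) L) <= 4 * L * (mu * (INR (S N) * Kp)) + 8 * L * h * (C1 * Kp).
Proof.
  intros HL Hc Hd Hs HG Hs1 Hh HC1 HKp HGr Hmu.
  assert (HKp0 : 0 <= Kp) by (eapply Rle_trans; [apply Cmod_ge_0|apply (HKp 0%nat 0); [lia|lra]]).
  assert (HGc := holo_rect_cont _ _ _ _ _ HG).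
  set (H := fun w => (G w * taylor_ext N w)%C).
  set (D := fun w => (G w * (Ci * (CDerive_n phi (S N) (Re w) * taylor_mon N w)))%C).
  assert (Hmc : forall w, cont_C (taylor_mon N) w).
  { intros w. destruct N as [|k]; [apply cont_C_const|]. exact (diff_C_cont _ _ _ _ (taylor_mon_diff k w)). }
  assert (HHc : rect_cont (- (2 * L)) (2 * L) 0 2 H).
  { intros x y Hx Hy. apply cont_C_mult; [apply HGc; assumption|].
    destruct (taylor_ext_diff N (x, y)) as (A & B & HD & _). exact (diff_C_cont _ _ _ _ HD). }
  assert (HDc : rect_cont (- (2 * L)) (2 * L) 0 2 D).
  { intros x y Hx Hy. apply cont_C_mult; [apply HGc; assumption|]. apply cont_C_mult; [apply cont_C_const|].
    apply cont_C_mult; [apply CDerive_n_cont|apply Hmc]. }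
  assert (E : bd_int H (- L) L s1 h = area_int D (- L) L s1 h).
  { apply (green_complex (- (2 * L)) (2 * L) 0 2); trivial; try lra.
    intros x y Hx Hy. destruct (HG x y ltac:(lra) ltac:(lra)) as [l Hl].
    destruct (taylor_ext_diff N (x, y)) as (A & B & HD & HE).
    eexists; eexists. split; [apply (diff_C_mult _ _ _ _ _ _ _ Hl HD)|].
    unfold D. rewrite <- HE. ring. }
  assert (Z : forall x, x < c \/ d < x -> CRInt (fun y => H (x, y)) s1 h = 0%C).
  { intros x Hx. rewrite (CRInt_ext _ (fun _ => RtoC 0)); [|lra|].
    - rewrite (CRInt_RtoC (fun _ => 0)), RInt_const. unfold scal; simpl; unfold mult; simpl. rewrite Rmult_0_r. reflexivity.
    - intros y _. unfold H. rewrite (taylor_ext_out c d) by assumption. apply Cmult_0_r. }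
  unfold bd_int in E. rewrite (Z (- L)), (Z L) in E by lra.
  assert (E1 : CRInt (fun x => G (x, s1) * phi x)%C (- L) L = CRInt (fun x => H (x, s1)) (- L) L).
  { apply CRInt_ext; [lra|]. intros x _. unfold H. rewrite taylor_ext_on_line. reflexivity. }
  rewrite E1.
  set (I1 := CRInt (fun x => H (x, s1)) (- L) L) in *. set (I2 := CRInt (fun x => H (x, h)) (- L) L) in *.
  set (A0 := area_int D (- L) L s1 h) in *.
  replace I1 with (I2 + A0)%C by (rewrite <- E; ring).
  eapply Rle_trans; [apply Cmod_triangle|]. apply Rplus_le_compat.
  - unfold I2. replace (4 * L * (mu * (INR (S N) * Kp))) with (2 * (L - - L) * (mu * (INR (S N) * Kp))) by ring.
    apply CRInt_bound; [lra| |].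
    + apply (ex_CRInt_hor H); [lra|]. intros x Hx. apply HHc; lra.
    + intros x Hx. unfold H. rewrite Cmod_mult. apply Rmult_le_compat; try apply Cmod_ge_0; [apply Hmu; lra|].
      apply taylor_ext_bound; [|simpl; lra]. intros k Hk. apply HKp; [lia|simpl; lra].
  - apply Rle_trans with (4 * (L - - L) * (h - s1) * (C1 * Kp)).
    + apply (area_int_bound (- (2 * L)) (2 * L) 0 2); trivial; try lra.
      intros x y Hx Hy. unfold D. rewrite !Cmod_mult, Cmod_Ci, Rmult_1_l.
      assert (T1 := taylor_mon_bound N (x, y) ltac:(simpl; lra)). simpl Im in T1.
      assert (T2 : (y - s1) ^ N <= y ^ N) by (apply pow_incr; lra).
      assert (T3 := HKp (S N) x (le_n _) Hx). assert (T4 := HGr x y Hx ltac:(lra)).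
      simpl Re.
      apply Rle_trans with (Cmod (G (x, y)) * (Kp * y ^ N)).
      * apply Rmult_le_compat_l; [apply Cmod_ge_0|]. apply Rmult_le_compat; try apply Cmod_ge_0; lra.
      * replace (Cmod (G (x, y)) * (Kp * y ^ N)) with ((Cmod (G (x, y)) * y ^ N) * Kp) by ring.
        apply Rmult_le_compat_r; assumption.
    + replace (8 * L * h * (C1 * Kp)) with (4 * (L - - L) * h * (C1 * Kp)) by ring.
      apply Rmult_le_compat_r; [apply Rmult_le_pos; assumption|]. apply Rmult_le_compat_l; lra.
Qed.
End Taylor.

Section PointValue.
Variables (a b r : R) (F : C -> C) (f : (R -> C) -> C) (x0 : R) (gamma : C).
Variables (n : nat) (K del : R).
Hypothesis HF : analytic_on_rect a b r F.
Hypothesis Hf : boundary_value a b F f.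
Hypothesis HK : 0 <= K.
Hypothesis Hdel : 0 < del.
Hypothesis Hda : a < x0 - del.
Hypothesis Hdb : x0 + del < b.
Hypothesis Hdr : del < r.
Hypothesis Hgrowth : grows_at F x0 n K del.
Hypothesis Hsector : forall s0 eta, 0 < s0 <= 1 -> 0 < eta ->
  exists e0, 0 < e0 /\ forall e, 0 < e < e0 -> forall px py, s0 <= py -> px ^ 2 + py ^ 2 = 1 ->
    Cmod (zoom F x0 gamma e (px, py)) <= eta.

(** The points of a horizontal segment lie in one sector, at comparable distances from 0. *)
Lemma zoom_small_on_line L h mu : 0 < L -> 0 < h -> 0 < mu ->
  exists e0, 0 < e0 /\ forall e, 0 < e < e0 -> forall x, - L <= x <= L -> Cmod (zoom F x0 gamma e (x, h)) <= mu.
Proof.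
  intros HL Hh Hmu.
  assert (Hs0 : 0 < h / (L + h) <= 1).
  { split; [apply Rdiv_lt_0_compat; lra|]. apply Rmult_le_reg_r with (L + h); [lra|].
    unfold Rdiv; rewrite Rmult_assoc, Rinv_l; lra. }
  destruct (Hsector (h / (L + h)) mu Hs0 Hmu) as (e0 & He0 & HH).
  exists (e0 / (L + h)). split; [apply Rdiv_lt_0_compat; lra|]. intros e [He1 He] x Hx. apply Rlt_div_r in He; [|lra].
  set (rho := sqrt (x ^ 2 + h ^ 2)).
  assert (Hq : 0 < x ^ 2 + h ^ 2) by (generalize (pow2_ge_0 x) (pow2_gt_0 h ltac:(lra)); lra).
  assert (Hrho : 0 < rho) by (apply sqrt_lt_R0; assumption).
  assert (Hrho2 : rho ^ 2 = x ^ 2 + h ^ 2) by (apply pow2_sqrt; lra).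
  assert (HrhoL : rho <= L + h) by nra.
  assert (Heq : zoom F x0 gamma e (x, h) = zoom F x0 gamma (e * rho) (x / rho, h / rho)).
  { unfold zoom. simpl Re; simpl Im. replace (e * rho * (x / rho)) with (e * x) by (field; lra).
    replace (e * rho * (h / rho)) with (e * h) by (field; lra). reflexivity. }
  rewrite Heq. apply HH.
  - split; [apply Rmult_lt_0_compat; assumption|]. apply Rle_lt_trans with (e * (L + h)); [apply Rmult_le_compat_l; lra|].
    exact He.
  - apply Rmult_le_compat_l; [lra|]. apply Rinv_le_contravar; lra.
  - replace ((x / rho) ^ 2 + (h / rho) ^ 2) with ((x ^ 2 + h ^ 2) / rho ^ 2) by (field; lra).
    rewrite Hrho2. field. lra.
Qed.

Lemma rescaled_pairing phi L e y : smooth phi -> 0 < L -> supported_in (- L) L phi -> 0 < e -> e * L < del -> 0 < y < del ->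
  ex_CRInt (fun x => phi x) (- L) L /\
  ex_CRInt (fun x => zoom F x0 gamma e (x, (y / e)%R) * phi x)%C (- L) L /\
  (RtoC (/ e) * CRInt (fun x => F (x, y) * phi ((x - x0) / e)%R)%C a b - gamma * CRInt phi (- L) L)%C
   = CRInt (fun x => zoom F x0 gamma e (x, (y / e)%R) * phi x)%C (- L) L.
Proof.
  intros Hphi HL Hs He HeL Hy.
  assert (HFc := analytic_cont a b r F HF).
  assert (Hpc : forall x y, cont_C (fun z => phi (Re z)) (x, y)).
  { intros x y'. apply cont_C_of_C.
    - apply (smooth_R_continuous (fun t => Re (phi t))), (proj1 (smooth_iff phi) Hphi).
    - apply (smooth_R_continuous (fun t => Im (phi t))), (proj1 (smooth_iff phi) Hphi). }
  assert (Hph : ex_CRInt (fun x => phi x) (- L) L) by (apply (ex_CRInt_hor (fun z => phi (Re z)) (- L) L 0); [lra|]; intros; apply Hpc).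
  set (hh := fun x => (F (x, y) * phi ((x - x0) / e)%R)%C).
  assert (HeL0 : 0 < e * L) by (apply Rmult_lt_0_compat; assumption).
  assert (Hhe : ex_CRInt hh (e * - L + x0) (e * L + x0)).
  { apply (ex_CRInt_hor (fun w => F w * phi ((Re w - x0) / e)%R)%C); [lra|]. intros x Hx.
    apply cont_C_mult; [apply HFc; lra|].
    apply (cont_C_of_C (fun t => phi ((t - x0) / e))).
    - apply (continuous_comp (fun t => (t - x0) / e) (fun t => Re (phi t))).
      + apply (ex_derive_continuous (fun t => (t - x0) / e)). auto_derive; trivial.
      + apply (smooth_R_continuous (fun t => Re (phi t))), (proj1 (smooth_iff phi) Hphi).
    - apply (continuous_comp (fun t => (t - x0) / e) (fun t => Im (phi t))).
      + apply (ex_derive_continuous (fun t => (t - x0) / e)). auto_derive; trivial.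
      + apply (smooth_R_continuous (fun t => Im (phi t))), (proj1 (smooth_iff phi) Hphi). }
  destruct (CRInt_support hh a b (e * - L + x0) (e * L + x0)) as [_ Esup]; try lra; trivial.
  { intros x Hx. unfold hh. rewrite Hs; [apply Cmult_0_r|].
    destruct Hx as [Hx|Hx]; [left|right]; apply Rmult_lt_reg_r with e; trivial; unfold Rdiv;
    rewrite ?(Rmult_assoc (x - x0)), ?Rinv_l; lra. }
  assert (Hlin := CRInt_comp_lin hh e x0 (- L) L Hhe).
  assert (HZe : ex_CRInt (fun x => zoom F x0 gamma e (x, (y / e)%R) * phi x)%C (- L) L).
  { apply (ex_CRInt_hor (fun w => zoom F x0 gamma e w * phi (Re w))%C); [lra|]. intros x Hx.
    apply cont_C_mult; [|apply Hpc].
    assert (Hed : e * (del / e) = del) by (field; lra).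
    destruct (zoom_holo a b r F x0 gamma e (del / e) HF He ltac:(lra) ltac:(lra) ltac:(lra) x (y / e)) as [l Hl].
    - assert (L < del / e); [|lra]. apply Rmult_lt_reg_l with e; lra.
    - split; [apply Rdiv_lt_0_compat; lra|]. apply Rmult_lt_compat_r; [apply Rinv_0_lt_compat; assumption|lra].
    - exact (diff_C_cont _ _ _ _ Hl). }
  split; [exact Hph|]. split; [exact HZe|].
  assert (Hpt : forall x, (RtoC e * hh (e * x + x0)%R = RtoC e * (zoom F x0 gamma e (x, (y / e)%R) * phi x + gamma * phi x))%C).
  { intros x. unfold hh, zoom. simpl Re; simpl Im.
    replace ((e * x + x0 - x0) / e) with x by (field; lra).
    replace (e * (y / e)) with y by (field; lra). rewrite (Rplus_comm (e * x) x0). ring. }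
  assert (Hee : ex_CRInt (fun x => RtoC e * hh (e * x + x0)%R)%C (- L) L).
  { apply ex_CRInt_ext with (fun x => RtoC e * (zoom F x0 gamma e (x, (y / e)%R) * phi x + gamma * phi x))%C; [lra|intros; symmetry; apply Hpt|].
    apply ex_CRInt_scal. apply (ex_CRInt_plus (fun x => zoom F x0 gamma e (x, (y / e)%R) * phi x)%C (fun x => gamma * phi x)%C);
      [exact HZe|apply ex_CRInt_scal, Hph]. }
  rewrite Esup, <- Hlin, <- (CRInt_scal (RtoC (/ e)) _ _ _ Hee), <- (CRInt_scal gamma phi (- L) L Hph).
  rewrite <- (CRInt_minus (fun x => RtoC (/ e) * (RtoC e * hh (e * x + x0)%R))%C (fun x => gamma * phi x)%C);
    [|apply ex_CRInt_scal, Hee|apply ex_CRInt_scal, Hph].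
  apply CRInt_ext; [lra|]. intros x _. rewrite Hpt, RtoC_inv by lra. field.
  intros E0; apply RtoC_inj in E0; lra.
Qed.

(** The pairing at a low line is compared with the pairing at the height [h].  The difference is of
    order [h] uniformly in the scale, and at the fixed height [h] the rescaled functions tend to 0
    uniformly. *)
Theorem point_value_of_sector_limit : dist_point_value f x0 gamma.
Proof.
  intros phi [Hphi (c0 & d0 & _ & _ & Hs0)].
  set (L := Rabs c0 + Rabs d0 + 1).
  assert (HL : 1 <= L) by (unfold L; generalize (Rabs_pos c0) (Rabs_pos d0); lra).
  assert (Hc0 : - L < c0) by (unfold L; generalize (Rabs_pos d0) (Rle_abs (- c0)); rewrite Rabs_Ropp; lra).
  assert (Hd0 : d0 < L) by (unfold L; generalize (Rabs_pos c0) (Rle_abs d0); lra).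
  assert (Hs : supported_in (- L) L phi) by (intros x Hx; apply Hs0; lra).
  destruct (CDerive_n_bounded phi Hphi (S n) (- L) L) as (Kp & HKp & HKpb).
  apply filterlim_at_right_0. intros eta Heta.
  set (C1 := K * (L + 1) ^ n + Cmod gamma).
  assert (HC1 : 0 <= C1).
  { unfold C1. apply Rplus_le_le_0_compat; [apply Rmult_le_pos; [assumption|apply pow_le; lra]|apply Cmod_ge_0]. }
  (* [h] makes the area term of [line_shift] small, and then [mu] the upper line *)
  set (B1 := 8 * L * (C1 * Kp)). set (B2 := 4 * L * (INR (S n) * Kp)).
  assert (HB1 : 0 <= B1) by (unfold B1; apply Rmult_le_pos; [lra|apply Rmult_le_pos; assumption]).
  assert (HB2 : 0 <= B2) by (unfold B2; apply Rmult_le_pos; [lra|apply Rmult_le_pos; [apply pos_INR|assumption]]).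
  set (h := Rmin 1 (eta / 4 / (B1 + 1))).
  assert (Hh0 : 0 < h) by (apply Rmin_pos; [lra|apply Rdiv_lt_0_compat; lra]).
  assert (Hh1 : h <= 1) by apply Rmin_l.
  assert (Hh2 : B1 * h <= eta / 4).
  { assert (q : h <= eta / 4 / (B1 + 1)) by apply Rmin_r.
    apply Rle_trans with ((B1 + 1) * h); [lra|].
    replace (eta / 4) with ((B1 + 1) * (eta / 4 / (B1 + 1))) by (field; lra). apply Rmult_le_compat_l; lra. }
  set (mu := eta / 4 / (B2 + 1)).
  assert (Hmu0 : 0 < mu) by (unfold mu; apply Rdiv_lt_0_compat; lra).
  assert (Hmu2 : B2 * mu <= eta / 4).
  { apply Rle_trans with ((B2 + 1) * mu); [lra|]. unfold mu. right. field. lra. }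
  destruct (zoom_small_on_line L h mu ltac:(lra) Hh0 Hmu0) as (e1 & He1 & Hline).
  set (ee := del / (2 * L)).
  assert (Hee0 : 0 < ee) by (unfold ee; apply Rdiv_lt_0_compat; lra).
  exists (Rmin e1 ee). split; [apply Rmin_pos; assumption|]. intros e He.
  assert (q1 := Rmin_l e1 ee). assert (q2 := Rmin_r e1 ee).
  assert (HeL : e * (2 * L) < del).
  { apply Rlt_le_trans with (ee * (2 * L)); [apply Rmult_lt_compat_r; lra|]. unfold ee. right. field. lra. }
  assert (He2 : e * 2 <= e * (2 * L)) by (apply Rmult_le_compat_l; lra).
  assert (HeL' : e * L < e * (2 * L)) by (apply Rmult_lt_compat_l; lra).
  set (Z := zoom F x0 gamma e).
  assert (HZh : holo_rect (- (2 * L)) (2 * L) 0 2 Z).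
  { apply (holo_rect_sub (- (2 * L)) (2 * L) 0 (2 * L)); try lra. apply (zoom_holo a b r); trivial; lra. }
  assert (HZg : forall x s, - L <= x <= L -> 0 < s <= 1 -> Cmod (Z (x, s)) * s ^ n <= C1).
  { intros x s Hx Hs'. assert (Hxa : Rabs x <= L) by (apply Rabs_le; lra).
    assert (p1 : e * Rabs x <= e * L) by (apply Rmult_le_compat_l; lra).
    assert (p3 : e * s <= e * 1) by (apply Rmult_le_compat_l; lra).
    eapply Rle_trans; [apply (zoom_growth F x0 gamma n K del e x s Hgrowth); lra|].
    apply Rplus_le_compat.
    - apply Rmult_le_compat_l; [assumption|]. apply pow_incr. generalize (Rabs_pos x); lra.
    - rewrite <- (Rmult_1_r (Cmod gamma)) at 2. apply Rmult_le_compat_l; [apply Cmod_ge_0|].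
      rewrite <- (pow1 n). apply pow_incr. lra. }
  set (phie := fun x => phi ((x - x0) / e)%R).
  assert (Htf : test_function a b phie).
  { split.
    - destruct (proj1 (smooth_iff phi) Hphi) as [S1 S2]. apply smooth_iff. split.
      + apply smooth_R_ext with (fun x => Re (phi (/ e * x + - x0 / e))).
        * intros x. unfold phie. do 2 f_equal. field. lra.
        * apply (smooth_R_affine (fun t => Re (phi t))), S1.
      + apply smooth_R_ext with (fun x => Im (phi (/ e * x + - x0 / e))).
        * intros x. unfold phie. do 2 f_equal. field. lra.
        * apply (smooth_R_affine (fun t => Im (phi t))), S2.
    - exists (x0 - del), (x0 + del). split; [exact Hda|]. split; [exact Hdb|].
      intros x Hx. unfold phie. apply Hs.
      destruct Hx as [Hx|Hx]; [left|right]; apply Rmult_lt_reg_r with e; try lra; unfold Rdiv;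
      rewrite (Rmult_assoc (x - x0)), Rinv_l by lra; lra. }
  destruct (proj1 (filterlim_at_right_0 _ _) (Hf _ Htf) (e * (eta / 4))) as (y0 & Hy0 & HLim).
  { apply Rmult_lt_0_compat; lra. }
  destruct (common_lower_bound y0 del (e * h) 1 Hy0 Hdel ltac:(apply Rmult_lt_0_compat; lra) Rlt_0_1) as (m & Hm & m1 & m2 & m3 & _).
  set (y := m / 2). specialize (HLim y ltac:(unfold y; lra)).
  destruct (rescaled_pairing phi L e y Hphi ltac:(lra) Hs ltac:(lra) ltac:(lra) ltac:(unfold y; lra)) as (Hpi & HZi & HE).
  assert (Hye : 0 < y / e < h).
  { split; [apply Rdiv_lt_0_compat; unfold y; lra|]. apply Rmult_lt_reg_l with e; [lra|].
    replace (e * (y / e)) with y by (field; lra). unfold y; lra. }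
  assert (HS := line_shift phi Hphi (y / e) Z L h n c0 d0 C1 Kp mu ltac:(lra) Hc0 Hd0 Hs0 HZh Hye Hh1 HC1
    HKpb HZg (fun x Hx => Hline e ltac:(lra) x Hx)).
  rewrite (CRInt_gen_support phi _ _ (- L) L); [|lra|apply m_infty_le|apply p_infty_ge|exact Hs|exact Hpi].
  fold Z in HE. fold phie in HLim. change (fun x => phi ((x - x0) / e)) with phie.
  change (fun x => (F (x, y) * phi ((x - x0) / e)%R)%C) with (fun x => (F (x, y) * phie x)%C) in HE.
  set (W := CRInt (fun x => F (x, y) * phie x)%C a b) in *.
  set (I0 := CRInt phi (- L) L) in *.
  replace (RtoC (/ e) * f phie - gamma * I0)%C with ((RtoC (/ e) * W - gamma * I0) + - (RtoC (/ e) * (W - f phie)))%C by ring.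
  eapply Rle_lt_trans; [apply Cmod_triangle|]. rewrite HE, Cmod_opp, Cmod_mult, Cmod_R.
  assert (Hie : 0 < / e) by (apply Rinv_0_lt_compat; lra).
  rewrite Rabs_right by lra.
  assert (HW : / e * Cmod (W - f phie) <= eta / 4).
  { replace (eta / 4) with (/ e * (e * (eta / 4))) by (field; lra). apply Rmult_le_compat_l; lra. }
  replace (4 * L * (mu * (INR (S n) * Kp)) + 8 * L * h * (C1 * Kp)) with (B2 * mu + B1 * h) in HS by (unfold B1, B2; ring).
  lra.
Qed.
End PointValue.

Theorem theorem4 :
  forall (a b r : R) (F : C -> C) (f : (R -> C) -> C) (x0 : R) (gamma : C),
    a < b -> 0 < r ->
    analytic_on_rect a b r F ->
    is_distribution a b f ->
    boundary_value a b F f ->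
    a < x0 < b ->
    radial_dist_limit F x0 gamma ->
    dist_bounded_at a b f x0 ->
    dist_point_value f x0 gamma /\ angular_limit F x0 gamma.
Proof.
  intros a b r F f x0 gamma _ Hr HF _ Hf _ Hrad Hbd.
  destruct (polynomial_growth a b r F f x0 Hr HF Hf Hbd) as (n & K & del & HK & Hdel & Hda & Hdb & Hdr & Hgr).
  assert (HB := zoom_locally_bounded a b r F x0 gamma n K del HF HK Hdel Hda Hdb Hdr Hgr).
  split.
  - apply (point_value_of_sector_limit a b r F f x0 gamma n K del); trivial.
    intros s0 eta Hs Heta. apply sector_limit; trivial. apply zoom_vanishes_on_axis; assumption.
  - apply angular_limit_of_radial; assumption.
Qed.
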